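(* Let $I$ be an ideal in $\mathcal{O}_{X(S)}$. Then $I$ is non-degenerate if and only if $\Gamma_{+}(I)=C(\overline{I})$.
   Context: Setting. $S\subset\mathbb{Z}^n_+$ is a semigroup generated by a finite set $\{b_1,\dots,b_r\}\subset\mathbb{Z}^n_+$ with $\mathbb{Z}b_1+\cdots+\mathbb{Z}b_r=\mathbb{Z}^n$. The affine toric variety is $X(S)=V(I_S)\subset\mathbb{C}^r$, where $I_S=\langle x^{\alpha_+}-x^{\alpha_-}:\alpha\in\mathbb{Z}^r,\ \sum_i\alpha_ib_i=0\rangle\subset\mathbb{C}[x_1,\dots,x_r]$, $\alpha_+=\sum_{\alpha_i>0}\alpha_ie_i$, $\alpha_-=-\sum_{\alpha_i<0}\alpha_ie_i$ (not necessarily normal). $\mathcal{O}_{X(S)}$ is the ring of germs at $0$ of analytic functions on $X(S)$: each $g\in\mathcal{O}_{X(S)}$ is $g=f|_{X(S)}$ with $f:\mathbb{C}^r\to\mathbb{C}$ analytic, with Taylor expansion $f=\sum_ka_kx^k$, where $x^k=x_1^{k_1}\cdots x_r^{k_r}$. Cones. $cone(S)=\{\sum_i\lambda_ib_i:\lambda_i\in\mathbb{R},\ \lambda_i\ge0\}\subset\mathbb{R}^n$ is assumed of dimension $n$ and strongly convex ($cone(S)\cap(-cone(S))=\{0\}$); its dual cone is $cone(S)^\vee=\{u\in(\mathbb{R}^n)^*:\langle u,v\rangle\ge0\ \forall v\in cone(S)\}$. Newton polyhedra. For $A\subset S$, $\Gamma_+(A)$ is the convex hull of $\{k+v:k\in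 A,\ v\in cone(S)\}$. For $v\in cone(S)^\vee$, $\ell(v)=\min\{\langle k,v\rangle:k\in\Gamma_+(A)\}$ and $\Delta(v)=\{k\in\Gamma_+(A):\langle k,v\rangle=\ell(v)\}$; the faces of $\Gamma_+(A)$ are the sets $\Delta(v)$, $v\in cone(S)^\vee$. For $g=f|_{X(S)}$ with $f=\sum_ka_kx^k$, $supp(g)=\{k_1b_1+\cdots+k_rb_r\in S: a_k\ne0,\ k=(k_1,\dots,k_r)\}$. For $G\subseteq\mathcal{O}_{X(S)}$, $supp(G)$ is the union of the supports of the elements of $G$ and $\Gamma_+(G)=\Gamma_+(supp(G))$; if $I$ is the ideal generated by $G$, $\Gamma_+(I)=\Gamma_+(G)$. Integral closure. $\overline{I}$ is the ideal of all $h\in\mathcal{O}_{X(S)}$ satisfying a relation $h^m+a_1h^{m-1}+\cdots+a_m=0$ with $a_i\in I^i$. $C(\overline{I})$ is the convex hull in $cone(S)$ of the set $\{\lambda_1b_1+\cdots+\lambda_rb_r: x^\lambda\in\overline{I}\}$, $\lambda=(\lambda_1,\dots,\lambda_r)$. Non-degeneracy. For $g=f|_{X(S)}$, $f=\sum_ka_kx^k$, and a compact $A\subseteq cone(S)$, $g_A=\sum a_kx^k$, the sum over $k$ with $k_1b_1+\cdots+k_rb_r\in A\cap supp(g)$, and $g_A=0$ if $A\cap supp(g)=\emptyset$. To a representative of a germ $g$ with $0\notin supp(g)$ one associates $L(g)=\sum_{v\in supp(g)}a_vz^v$ in $z=(z_1,\dots,z_n)$, where $a_v=a_k$, $a_k\ne0$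 and $v=k_1b_1+\cdots+k_rb_r$. A set $G=\{g_1,\dots,g_l\}\subseteq\mathcal{O}_{X(S)}$ is non-degenerate if for each compact face $\Delta$ of $\Gamma_+(G)$ the equations $L((g_1)_\Delta)=\cdots=L((g_l)_\Delta)=0$ have no common solution in $(\mathbb{C}^* )^n$. An ideal is non-degenerate if it admits a non-degenerate system of generators.
   Formalization: Since supp(g) and a_v depend on the representative f, a_v is taken as the sum of all a_k with k_1b_1+...+k_rb_r=v and supp(g)={v: a_v≠0}; L(g) is also defined when 0∈supp(g); the b_i are assumed nonzero, so that 0∈X(S). *)

(* Defs.v *)
From HB Require Import structures.
From mathcomp Require Import all_boot all_order all_algebra.
From mathcomp Require Import all_classical all_reals all_analysis.
From mathcomp Require Import complex.
From mathcomp Require summability.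

Set Implicit Arguments.
Unset Strict Implicit.
Unset Printing Implicit Defensive.

Import Order.TTheory GRing.Theory Num.Theory.
Import numFieldNormedType.Exports.

Local Open Scope classical_set_scope.
Local Open Scope ring_scope.
Local Open Scope complex_scope.

(* The generators b_1, ..., b_r of S are the rows of a matrix b with natural
   entries, so that k_1 b_1 + ... + k_r b_r is k *m b for k : 'rV[nat]_r. *)

Definition monomial (T : comNzRingType) (m : nat) (x : 'rV[T]_m)
  (k : 'rV[nat]_m) : T := \prod_(i < m) x 0 i ^+ k 0 i.

Section Cones.
Variables (R : realType) (r n : nat) (b : 'M[nat]_(r, n)).
Implicit Types (A P D : set 'rV[R]_n) (u v w : 'rV[R]_n).

Definition generates_lattice : Prop :=
  forall w : 'rV[int]_n, exists c : 'rV[int]_r, c *m map_mx Posz b = w.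

Definition to_real (p q : nat) (M : 'M[nat]_(p, q)) : 'M[R]_(p, q) :=
  map_mx (fun m => m%:R) M.

Definition cone : set 'rV[R]_n :=
  [set c *m to_real b | c in [set c : 'rV[R]_r | forall i, 0 <= c 0 i]].

(* The dimension of a cone is the dimension of its linear span. *)
Definition cone_dim : nat := \rank (to_real b).

Definition strongly_convex A : Prop := A `&` [set - v | v in A] = [set 0].

Definition pairing u v : R := (u *m v^T) 0 0.

Definition dual_cone : set 'rV[R]_n :=
  [set u | forall v, cone v -> 0 <= pairing u v].

Definition convex_hull A : set 'rV[R]_n :=
  \bigcap_(D in [set D | convex_set D /\ A `<=` D]) D.

Definition newton_polyhedron (A : set 'rV[nat]_n) : set 'rV[R]_n :=
  convex_hull [set w | exists k v, [/\ A k, cone v & w = to_real k + v]].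

(* l is the minimum l(v), which has to be attained: the empty polyhedron has
   no faces. *)
Definition is_face P D : Prop :=
  exists (v : 'rV[R]_n) (l : R),
    [/\ dual_cone v,
        exists2 k, P k & pairing k v = l,
        forall k, P k -> l <= pairing k v
      & D = [set k | P k /\ pairing k v = l] ].

End Cones.

Arguments cone R {r n} b.

Section PowerSeries.
Variables (R : realType) (r n : nat) (b : 'M[nat]_(r, n)).
Local Notation C := R[i].
Implicit Types (a : 'rV[nat]_r -> C) (v : 'rV[nat]_n) (A : set 'rV[R]_n).

(* On X(S) the monomials x^k with the same v = k *m b coincide, and a_v is the
   total coefficient of these monomials; see [coefS_reduced] for a series with
   at most one term over v. The fibres are finite as soon as the rows of b are
   nonzero. *)
Definition coefS a v : C := \sum_(k \in [set k | k *m b = v]) a k.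

Definition supp a : set 'rV[nat]_n := [set v | coefS a v != 0].

Definition restrict_series A a : 'rV[nat]_r -> C :=
  fun k => if `[< supp a (k *m b) /\ A (to_real R (k *m b)) >] then a k else 0.

(* L(g)(z); in the definition of non-degeneracy the support is finite. *)
Definition Lmap a (z : 'rV[C]_n) : C :=
  \sum_(v \in supp a) coefS a v * monomial z v.

Lemma coefS_reduced a k :
  (forall k', k' *m b = k *m b -> a k' != 0 -> k' = k) ->
  coefS a (k *m b) = a k.
Proof.
move=> a_red; rewrite /coefS.
rewrite -(fsbig_widen [set k]) ?fsbig_set1 //; first by move=> _ ->.
move=> k' /= [kk' k'k]; apply/eqP; apply: contrapT => /negP ak'.
by apply: k'k; exact: a_red.
Qed.

End PowerSeries.

(* An element of O_X(S) is represented by a function on C^r that is analytic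
   at 0; two functions represent the same element when they are related by
   [germ_eq], and ideals of O_X(S) are the sets of functions that are ideals
   modulo this relation. *)
Section Germs.
Variables (R : realType) (r n : nat) (b : 'M[nat]_(r, n)).
Local Notation C := R[i].
Local Notation Cr := 'rV[R[i]]_r.
Implicit Types (f g h : Cr -> C) (I J G : set (Cr -> C)).

(* The sum is over the finite sets of multi-indices ordered by inclusion, hence
   the convergence is absolute. *)
Definition has_taylor f (a : 'rV[nat]_r -> C) : Prop :=
  \forall x \near (0 : 'rV[C^o]_r),
    summability.partial_sum (fun k => a k * monomial x k : C^o)
      @ summability.totally --> (f x : C^o).

Definition analytic0 f : Prop := exists a, has_taylor f a.

Definition taylor f : 'rV[nat]_r -> C := xget (fun=> 0) [set a | has_taylor f a].

Definition pos_part (al : 'rV[int]_r) : 'rV[nat]_r :=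
  map_mx (fun m : int => `|Num.max m 0|%N) al.

Definition neg_part (al : 'rV[int]_r) : 'rV[nat]_r := pos_part (- al).

(* The common zeros of the generators of I_S. *)
Definition toric_variety : set Cr :=
  [set x | forall al : 'rV[int]_r, al *m map_mx Posz b = 0 ->
     monomial x (pos_part al) - monomial x (neg_part al) = 0].

Definition germ_eq f g : Prop :=
  \forall x \near (0 : 'rV[C^o]_r), toric_variety x -> f x = g x.

Definition is_ideal I : Prop :=
  [/\ I `<=` analytic0,
      forall f g, analytic0 g -> germ_eq f g -> I f -> I g,
      I (fun=> 0),
      forall f g, I f -> I g -> I (fun x => f x + g x)
    & forall f g, analytic0 f -> I g -> I (fun x => f x * g x) ].

Definition ideal_gen G : set (Cr -> C) :=
  \bigcap_(J in [set J | is_ideal J /\ G `<=` J]) J.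

Definition ideal_pow I (m : nat) : set (Cr -> C) :=
  ideal_gen [set h | exists2 u : 'I_m -> Cr -> C,
    forall j, I (u j) & h = fun x => \prod_(j < m) u j x].

(* The coefficient a_j is [c j.-1]. *)
Definition integral_closure I : set (Cr -> C) :=
  [set h | analytic0 h /\
    exists (m : nat) (c : 'I_m -> Cr -> C),
      [/\ (0 < m)%N,
          forall j : 'I_m, ideal_pow I j.+1 (c j)
        & germ_eq (fun x => h x ^+ m + \sum_(j < m) c j x * h x ^+ (m - j.+1))
                  (fun=> 0) ] ].

(* C(J), written for J the integral closure of an ideal. *)
Definition monomial_hull J : set 'rV[R]_n :=
  convex_hull [set to_real R (k *m b) |
    k in [set k : 'rV[nat]_r | J (fun x => monomial x k)]].

Definition supp_set G : set 'rV[nat]_n := \bigcup_(f in G) supp b (taylor f).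

(* Used for an ideal as well, as an ideal generates itself. *)
Definition newton_of G : set 'rV[R]_n := newton_polyhedron b (supp_set G).

Definition nondegenerate_system (l : nat) (g : 'I_l -> Cr -> C) : Prop :=
  forall D : set 'rV[R]_n, is_face b (newton_of (range g)) D -> compact D ->
    ~ exists z : 'rV[C]_n, (forall j, z 0 j != 0) /\
        forall i, Lmap b (restrict_series b D (taylor (g i))) z = 0.

Definition nondegenerate_ideal I : Prop :=
  exists (l : nat) (g : 'I_l -> Cr -> C),
    [/\ forall i, analytic0 (g i), I = ideal_gen (range g)
      & nondegenerate_system g].

End Germs.

(* Main.v *)
Require Import Defs.
From HB Require Import structures.
From mathcomp Require Import all_boot all_order all_algebra.
From mathcomp Require Import all_classical all_reals all_analysis.
From mathcomp Require Import complex finmap.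
From mathcomp Require Import ring lra zify.
From mathcomp Require summability.
Import Order.TTheory GRing.Theory Num.Theory.
Import numFieldNormedType.Exports.
Local Open Scope classical_set_scope.
Local Open Scope ring_scope.
Local Open Scope complex_scope.

Set Implicit Arguments.
Unset Strict Implicit.
Unset Printing Implicit Defensive.

(* (=>) Let w = k b be in supp(I) + S and suppose that x^k is not integral over
   I. Then I / x^k and the maximal ideal of O generate a proper ideal of the
   algebra O[I / x^k], and the residue map at this ideal extends to a place Psi
   for which one of the finitely many minimal exponents of supp(I), say kw, has
   the least value. By Motzkin's transposition theorem there is a weight v,
   positive on the b_i, that is constant on the minimal exponents of least value
   and larger on the others. The residues of the quotients of the former by x^kw
   extend to a character of Z^n, that is, to a point of the torus, and applying
   Psi to the elements of I divided by x^kw shows that this point is a common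
   zero of the L(g_Delta) for the compact face Delta of v.
   (<=) If z in the torus is a common zero of the L(g_Delta), where Delta is the
   face of v at level l, then every element of I is o(e^(-l s)) along the curve
   s |-> z e^(-v s). Hence so is every element of the integral closure of I,
   whereas a monomial of Delta has order exactly e^(-l s). This needs I to be
   finitely generated, which follows from the division of power series. *)

(** * Summable families *)

(** Only finitely many monomials have to be compared, so finitely many one-element extensions of the
    place suffice and no maximal place is chosen. Such a partial place carries no real-valued
    valuation: it records only which monomial quotients have residue zero and which have a nonzero
    residue. Transposition turns this sign information into a numerical weight, since its failure
    would exhibit the trivial monomial as a product of units and of at least one monomial of residue
    zero. Residues are known on a subgroup of [Z^n] only; they extend because the nonzero complex
    numbers form a divisible group. A germ on [X(S)] has many power series. Its intrinsic data are
    the numbers [coefS], whose independence of the series rests on asymptotics along curves in the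
    torus; the same argument lets germs be compared on the torus, where monomials are invertible.
    The weights [prod_i p_i ^ k_i] with distinct primes serve there and in the division: they order
    exponents totally, and at the point with coordinates [p_i ^ (-s)] a smaller weight means a
    larger monomial. *)

Section Modulus.
Variable R : realType.
Local Notation C := R[i].
Implicit Types x y : C.

(** The norm of [R[i]] is valued in [R[i]] itself; a modulus in [R] gives access to suprema and to
    linear arithmetic. *)
Definition nc x : R := Normc.normc x.

Lemma nc_norm x : `|x| = (nc x)%:C. Proof. by []. Qed.

Lemma nc_ge0 x : 0 <= nc x.
Proof. by case: x => u v; exact: sqrtr_ge0. Qed.

Lemma nc0 : nc 0 = 0. Proof. exact: Normc.normc0. Qed.

Lemma nc1 : nc 1 = 1. Proof. exact: Normc.normc1. Qed.

Lemma nc_eq0 x : (nc x == 0) = (x == 0).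
Proof.
apply/eqP/eqP => [|->]; last exact: nc0.
exact: Normc.eq0_normc.
Qed.

Lemma ncD x y : nc (x + y) <= nc x + nc y.
Proof. by have := ler_normD x y; rewrite !nc_norm -rmorphD lecR. Qed.

Lemma ncN x : nc (- x) = nc x.
Proof. by have := normrN x; rewrite !nc_norm => /complexI. Qed.

Lemma ncB x y : nc (x - y) <= nc x + nc y.
Proof. by rewrite -(ncN y); exact: ncD. Qed.

Lemma nc_distC x y : nc (x - y) = nc (y - x).
Proof. by rewrite -ncN opprB. Qed.

Lemma ncM x y : nc (x * y) = nc x * nc y.
Proof. exact: Normc.normcM. Qed.

Lemma ncX x m : nc (x ^+ m) = nc x ^+ m.
Proof. by elim: m => [|m IH]; rewrite ?expr0 ?nc1 // !exprS ncM IH. Qed.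

Lemma nc_sum (I : Type) (s : seq I) (P : pred I) (F : I -> C) :
  nc (\sum_(i <- s | P i) F i) <= \sum_(i <- s | P i) nc (F i).
Proof.
elim/big_rec2: _ => [|i y x _ h]; first by rewrite nc0.
exact: le_trans (ncD _ _) (lerD _ h).
Qed.

Lemma nc_prod (I : Type) (s : seq I) (P : pred I) (F : I -> C) :
  nc (\prod_(i <- s | P i) F i) = \prod_(i <- s | P i) nc (F i).
Proof. by elim/big_rec2: _ => [|i y x _ <-]; rewrite ?nc1 ?ncM. Qed.

Lemma nc_real (u : R) : 0 <= u -> nc u%:C = u.
Proof. by move=> u0; rewrite /nc /= expr0n addr0 sqrtr_sqr ger0_norm. Qed.

Lemma nc_le_ReIm x : nc x <= `|complex.Re x| + `|complex.Im x|.
Proof.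
case: x => u v /=; rewrite -(ler_pXn2r (ltn0Sn 1)) ?nnegrE ?sqrtr_ge0 ?addr_ge0 //.
rewrite sqr_sqrtr ?addr_ge0 ?sqr_ge0 // sqrrD !real_normK ?num_real //.
by rewrite addrAC lerDl mulrn_wge0 // mulr_ge0.
Qed.

Lemma Re_le_nc x : `|complex.Re x| <= nc x.
Proof.
by case: x => u v /=; rewrite -sqrtr_sqr ler_wsqrtr // lerDl sqr_ge0.
Qed.

Lemma Im_le_nc x : `|complex.Im x| <= nc x.
Proof.
by case: x => u v /=; rewrite -sqrtr_sqr ler_wsqrtr // lerDr sqr_ge0.
Qed.

Lemma ReD x y : complex.Re (x + y) = complex.Re x + complex.Re y.
Proof. by case: x y => ? ? []. Qed.

Lemma ImD x y : complex.Im (x + y) = complex.Im x + complex.Im y.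
Proof. by case: x y => ? ? []. Qed.

End Modulus.

Section FibreSum.
Variables (K L : choiceType) (V : nmodType) (pi : K -> L).

(** Over [k |-> k *m b] this is [coefS]; over addition of exponents it gives the Cauchy product. *)
Definition fsum (a : K -> V) (l : L) : V := \sum_(k \in [set k | pi k = l]) a k.

Definition finite_fibres := forall l, finite_set [set k | pi k = l].

Hypothesis pi_fin : finite_fibres.

Lemma finite_preimage_fset (F : {fset L}) : finite_set (pi @^-1` [set` F]).
Proof.
have -> : pi @^-1` [set` F] = \bigcup_(l in [set` F]) [set k | pi k = l].
  by apply/seteqP; split=> k /=; [move=> h; exists (pi k)|move=> [l /= h ->]].
by apply: bigcup_finite => // l _; exact: pi_fin.
Qed.

Definition fibres (F : {fset L}) : {fset K} := fset_set (pi @^-1` [set` F]).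

Lemma mem_fibres F k : (k \in fibres F) = (pi k \in F).
Proof. by rewrite in_fset_set ?inE //; [exact: asboolb|exact: finite_preimage_fset]. Qed.

Lemma fsumE (F : {fset L}) (a : K -> V) l : l \in F ->
  fsum a l = \sum_(k <- fibres F | pi k == l) a k.
Proof.
move=> lF; rewrite /fsum fsbig_finite //=.
transitivity (\sum_(k <- [fset k in fibres F | pi k == l]%fset) a k); last by rewrite big_fset.
apply: eq_fbigl => k; rewrite in_fset_set // !inE mem_fibres /=.
by apply/idP/andP => [/asboolP ->|[_ /eqP ?]]; [split|apply/asboolP].
Qed.

Lemma sum_fsum (F : {fset L}) (a : K -> V) :
  \sum_(l <- F) fsum a l = \sum_(k <- fibres F) a k.
Proof.
rewrite big_seq (eq_bigr (fun l => \sum_(k <- fibres F | pi k == l) a k)); last first.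
  by move=> l; exact: fsumE.
rewrite -big_seq (exchange_big_dep predT) //= big_seq [RHS]big_seq.
apply: eq_bigr => k; rewrite mem_fibres => kF.
rewrite big_mkcond (big_fsetD1 _ kF) /= eqxx big1_fset ?addr0 // => l.
by rewrite !inE eq_sym => /andP[/negbTE ->].
Qed.

Lemma fsum_neq0 (a : K -> V) l : fsum a l != 0 -> exists2 k, pi k = l & a k != 0.
Proof.
move=> h; apply: contrapT => nex; move/negP: h; apply; apply/eqP.
rewrite /fsum fsbig1 // => k /= kl; apply: contrapT => ak.
by apply: nex; exists k => //; exact/eqP.
Qed.

End FibreSum.

Section Families.
Variables (R : realType).
Local Notation C := R[i].

Definition bnd (K : choiceType) (a : K -> C) (M : R) :=
  forall F : {fset K}, \sum_(k <- F) nc (a k) <= M.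

(** The epsilon form of the limit over finite sets that occurs in [has_taylor]. *)
Definition hassum (K : choiceType) (a : K -> C) (s : C) :=
  forall e : R, 0 < e -> exists F0 : {fset K},
    forall F : {fset K}, (F0 `<=` F)%fset -> nc (\sum_(k <- F) a k - s) < e.

Lemma ler_sum_fsubset (K : choiceType) (F G : {fset K}) (u : K -> R) :
  (F `<=` G)%fset -> (forall k, 0 <= u k) -> \sum_(k <- F) u k <= \sum_(k <- G) u k.
Proof.
move=> sFG u0; rewrite [leRHS](big_fsetID _ (fun k => k \in F)) /= -[leLHS]addr0.
rewrite lerD ?sumr_ge0 // le_eqVlt; apply/orP; left; apply/eqP/eq_fbigl => k.
by rewrite !inE; apply/idP/andP => [kF|[]//]; rewrite (fsubsetP sFG).
Qed.

Section OneType.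
Variable K : choiceType.
Implicit Types (a b : K -> C) (s t : C).

Lemma bnd_ge0 a M : bnd a M -> 0 <= M.
Proof. by move=> /(_ fset0); rewrite big_seq_fset0. Qed.

Lemma bnd_le a b M : (forall k, nc (b k) <= nc (a k)) -> bnd a M -> bnd b M.
Proof. by move=> h aM F; apply: le_trans (aM F); apply: ler_sum. Qed.

Lemma bnd_scale a M c : 0 <= c -> bnd a M ->
  forall b, (forall k, nc (b k) <= c * nc (a k)) -> bnd b (c * M).
Proof.
move=> c0 aM b h F; apply: le_trans (ler_wpM2l c0 (aM F)).
by rewrite mulr_sumr; apply: ler_sum.
Qed.

Lemma bndD a b M N : bnd a M -> bnd b N -> bnd (fun k => a k + b k) (M + N).
Proof.
move=> aM bN F; apply: le_trans (lerD (aM F) (bN F)).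
by rewrite -big_split /=; apply: ler_sum => k _; exact: ncD.
Qed.

Lemma bnd_sum (I : Type) (s : seq I) (a : I -> K -> C) (M : I -> R) :
  (forall i, bnd (a i) (M i)) ->
  bnd (fun k => \sum_(i <- s) a i k) (\sum_(i <- s) M i).
Proof.
move=> h; elim: s => [|i s IH].
  by move=> F; rewrite big_nil big1 // => k _; rewrite big_nil nc0.
by rewrite big_cons; apply: bnd_le (bndD (h i) IH) => k; rewrite big_cons.
Qed.

Lemma hassum_ext a b s : a =1 b -> hassum a s -> hassum b s.
Proof. by move=> /funext ->. Qed.

Lemma hassumD a b s t : hassum a s -> hassum b t ->
  hassum (fun k => a k + b k) (s + t).
Proof.
move=> ha hb e e0; have e2 : 0 < e / 2 by rewrite divr_gt0.
have [F1 h1] := ha _ e2; have [F2 h2] := hb _ e2.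
exists (F1 `|` F2)%fset => F; rewrite fsubUset => /andP[/h1 l1 /h2 l2].
rewrite big_split /= opprD addrACA (le_lt_trans (ncD _ _)) //.
by rewrite [ltRHS](splitr e) ltrD.
Qed.

Lemma hassumZ a s c : hassum a s -> hassum (fun k => c * a k) (c * s).
Proof.
move=> ha e e0; have c1 : 0 < nc c + 1 by rewrite ltr_wpDl ?nc_ge0.
have [F0 h] := ha _ (divr_gt0 e0 c1); exists F0 => F /h.
rewrite -mulr_sumr -mulrBr ncM ltr_pdivlMr // mulrC.
by apply: le_lt_trans; rewrite ler_wpM2r ?nc_ge0 // lerDl.
Qed.

Lemma hassumB a b s t : hassum a s -> hassum b t ->
  hassum (fun k => a k - b k) (s - t).
Proof.
move=> ha /(@hassumZ _ _ (- 1)) hb; rewrite -(mulN1r t).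
by apply: hassum_ext (hassumD ha hb) => k; rewrite mulN1r.
Qed.

Lemma hassum_fin (F0 : {fset K}) a : (forall k, k \notin F0 -> a k = 0) ->
  hassum a (\sum_(k <- F0) a k).
Proof.
move=> h e e0; exists F0 => F sF.
by rewrite -(big_fset_incl _ sF) ?subrr ?nc0 // => k _; exact: h.
Qed.

Lemma hassum0 a : (forall k, a k = 0) -> hassum a 0.
Proof.
by move=> h; have := @hassum_fin fset0 a (fun k _ => h k); rewrite big_seq_fset0.
Qed.

Lemma hassum_le a s M : bnd a M -> hassum a s -> nc s <= M.
Proof.
move=> aM ha; apply/ler_addgt0Pl => e e0; have [F0 /(_ _ (fsubset_refl _)) h] := ha e e0.
rewrite -[s](subrK (\sum_(k <- F0) a k)) (le_trans (ncD _ _)) // nc_distC.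
by rewrite lerD // ?(ltW h) // (le_trans (nc_sum _ _ _)).
Qed.

Lemma hassum_unique a s t : hassum a s -> hassum a t -> s = t.
Proof.
move=> hs ht; apply/eqP; rewrite -subr_eq0 -nc_eq0 eq_le nc_ge0 andbT.
have := hassumB hs ht; apply: hassum_le => F.
by rewrite big1 // => k _; rewrite subrr nc0.
Qed.

(** Absolute values are recovered from moduli of sums by splitting into real and imaginary parts,
    and each of these by sign: four subfamilies, each of sum at most [e]. *)
Lemma bnd_disjoint a (F0 : {fset K}) (e : R) :
  (forall F : {fset K}, (forall k, k \in F -> k \notin F0) ->
     nc (\sum_(k <- F) a k) <= e) ->
  bnd a (4 * e + \sum_(k <- F0) nc (a k)).
Proof.
move=> h.
have part (g : C -> R) (P : pred K) (F : {fset K}) :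
    (forall x y, g (x + y) = g x + g y) -> g 0 = 0 -> (forall x, `|g x| <= nc x) ->
    (forall k, k \in F -> k \notin F0) ->
    \sum_(k <- F) (if P k then g (a k) else 0) <= e.
  move=> gD g0 gle FF0; rewrite -big_mkcond.
  have -> : \sum_(k <- F | P k) g (a k) = g (\sum_(k <- [fset k in F | P k]%fset) a k).
    rewrite big_fset /=; elim: (enum_fset F) => [|k s IH]; rewrite ?big_nil ?g0 //.
    by rewrite !big_cons; case: ifP => // _; rewrite gD IH.
  apply: le_trans (h [fset k in F | P k]%fset _) => [|k].
    exact: le_trans (ler_norm _) (gle _).
  by rewrite !inE => /andP[/FF0].
have abs2 (g : C -> R) (F : {fset K}) :
    (forall x y, g (x + y) = g x + g y) -> g 0 = 0 -> (forall x, `|g x| <= nc x) ->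
    (forall k, k \in F -> k \notin F0) ->
    \sum_(k <- F) `|g (a k)| <= 2 * e.
  move=> gD g0 gle FF0.
  have gN x : g (- x) = - g x by apply/eqP; rewrite -addr_eq0 -gD addNr g0.
  rewrite (eq_bigr (fun k => (if 0 <= g (a k) then g (a k) else 0) +
     (if ~~ (0 <= g (a k)) then - g (a k) else 0))); last first.
    by move=> k _; case: (ger0P (g (a k))); rewrite ?addr0 ?add0r.
  rewrite big_split /= mulr2n mulrDl !mul1r lerD //; first exact: part.
  apply: (part (fun x => - g x) (fun k => ~~ (0 <= g (a k)))) => // [x y||x].
  - by rewrite gD opprD.
  - by rewrite g0 oppr0.
  - by rewrite normrN.
move=> F; rewrite (big_fsetID _ (fun k => k \in F0)) /= addrC lerD //.
  rewrite (le_trans (ler_sum _ (fun k _ => nc_le_ReIm (a k)))) //.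
  rewrite big_split /= (_ : 4 * e = 2 * e + 2 * e); last by rewrite -mulrDl -natrD.
  have sub k : k \in [fset x in F | x \notin F0]%fset -> k \notin F0.
    by rewrite !inE => /andP[].
  rewrite lerD //; apply: abs2 => //.
  - exact: ReD.
  - exact: Re_le_nc.
  - exact: ImD.
  - exact: Im_le_nc.
by apply: ler_sum_fsubset => [|k]; [apply/fsubsetP => k; rewrite !inE => /andP[]|exact: nc_ge0].
Qed.

(** Unconditional convergence of complex families is absolute: a finite sum disjoint from [F0] is a
    difference of two partial sums within 1 of [s], hence the 2 in the bound. *)
Lemma hassum_bnd a s : hassum a s -> exists M, bnd a M.
Proof.
move=> /(_ 1 ltr01)[F0 h].
exists (4 * 2 + \sum_(k <- F0) nc (a k)); apply: bnd_disjoint => F FF0.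
have F0sub : (F0 `<=` F0 `|` F)%fset by rewrite fsubsetUl.
have := h _ F0sub; rewrite (big_fsetID _ (fun k => k \in F0)) /=.
have -> : [fset x in (F0 `|` F) | x \in F0]%fset = F0.
  by apply/fsetP => k; rewrite !inE; case: (k \in F0); rewrite ?andbF.
have -> : [fset x in (F0 `|` F) | x \notin F0]%fset = F.
  apply/fsetP => k; rewrite !inE; case kF : (k \in F); last by rewrite orbF andbN.
  by rewrite orbT FF0.
set u := \sum_(k <- F0) _; set v := \sum_(k <- F) _ => uv.
have := h _ (fsubset_refl F0); rewrite -/u => us.
rewrite (_ : v = (u + v - s) - (u - s)); last by ring.
rewrite (le_trans (ncB _ _)) // -[2](_ : 1 + 1 = _) //.
by rewrite lerD // ltW.
Qed.

Lemma real_family_sum (u : K -> R) M : (forall k, 0 <= u k) ->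
  (forall F : {fset K}, \sum_(k <- F) u k <= M) ->
  exists s : R, forall e, 0 < e -> exists F0 : {fset K},
    forall F : {fset K}, (F0 `<=` F)%fset -> `|\sum_(k <- F) u k - s| < e.
Proof.
move=> u0 uM; pose A := [set x | exists F : {fset K}, x = \sum_(k <- F) u k].
have supA : has_sup A.
  split; first by exists 0; exists fset0; rewrite big_seq_fset0.
  by exists M => x [F ->].
exists (sup A) => e e0; have [_ [F0 ->] hF0] := sup_adherent e0 supA.
exists F0 => F sF; rewrite ltr_norml; apply/andP; split.
  rewrite ltrBrDr addrC (lt_le_trans hF0) //.
  exact: ler_sum_fsubset.
rewrite ltrBlDr (le_lt_trans (y := sup A)) ?ltrDr //.
by apply: (sup_upper_bound supA); exists F.
Qed.

Lemma bnd_hassum a M : bnd a M -> exists s, hassum a s.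
Proof.
move=> aM.
have H (g : C -> R) : (forall x, `|g x| <= nc x) ->
    exists s : R, forall e, 0 < e -> exists F0 : {fset K},
    forall F : {fset K}, (F0 `<=` F)%fset -> `|\sum_(k <- F) g (a k) - s| < e.
  move=> gle.
  (* This family is nonnegative, so it has a sum by monotonicity; subtracting the sum of [nc (a k)]
     leaves that of a real or imaginary part. *)
  have [|F|s hs] := @real_family_sum (fun k => nc (a k) + g (a k)) (M + M).
  - by move=> k; have := gle (a k); rewrite ler_norml => /andP[+ _]; lra.
  - rewrite big_split lerD //; apply: le_trans (aM F); apply: ler_sum => k _.
    exact: le_trans (ler_norm _) (gle _).
  have [|F|t ht] := @real_family_sum (fun k => nc (a k)) M.
  - by move=> k; exact: nc_ge0.
  - exact: aM.
  exists (s - t) => e e0; have e2 : 0 < e / 2 by rewrite divr_gt0.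
  have [F1 h1] := hs _ e2; have [F2 h2] := ht _ e2.
  exists (F1 `|` F2)%fset => F; rewrite fsubUset => /andP[/h1 + /h2].
  by rewrite big_split /= !ltr_norml; lra.
have [s hs] := H (@complex.Re R) (@Re_le_nc R); have [t ht] := H (@complex.Im R) (@Im_le_nc R).
exists (s +i* t) => e e0; have e2 : 0 < e / 2 by rewrite divr_gt0.
have [F1 h1] := hs _ e2; have [F2 h2] := ht _ e2.
exists (F1 `|` F2)%fset => F; rewrite fsubUset => /andP[/h1 l1 /h2 l2].
rewrite (le_lt_trans (nc_le_ReIm _)) // [ltRHS]splitr.
have sumRe (s' : seq K) : complex.Re (\sum_(k <- s') a k) = \sum_(k <- s') complex.Re (a k).
  by elim: s' => [|k s' IH]; rewrite ?big_nil // !big_cons ?ReD ?ImD IH.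
have sumIm (s' : seq K) : complex.Im (\sum_(k <- s') a k) = \sum_(k <- s') complex.Im (a k).
  by elim: s' => [|k s' IH]; rewrite ?big_nil // !big_cons ?ReD ?ImD IH.
rewrite ltrD //.
- by rewrite (_ : complex.Re _ = \sum_(k <- F) complex.Re (a k) - s) // -sumRe; case: (\sum_(_ <- _) _).
- by rewrite (_ : complex.Im _ = \sum_(k <- F) complex.Im (a k) - t) // -sumIm; case: (\sum_(_ <- _) _).
Qed.

End OneType.

Section TwoTypes.
Variables (K L : choiceType).

(** A finite set of [L] pulls back to a finite set of [K], so the regrouped partial sums are partial
    sums of [a]. This is how series on [C^r] become series indexed by the semigroup. *)
Lemma hassum_fsum (pi : K -> L) (a : K -> C) s : finite_fibres pi ->
  hassum a s -> hassum (fsum pi a) s.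
Proof.
move=> fin ha e e0; have [F0 h] := ha e e0.
exists [fset pi k | k in F0]%fset => F sF; rewrite sum_fsum //; apply: h.
apply/fsubsetP => k kF0; rewrite mem_fibres //; apply: (fsubsetP sF).
exact: in_imfset.
Qed.

Lemma nc_fsum (pi : K -> L) (a : K -> C) l : finite_fibres pi ->
  nc (fsum pi a l) <= fsum pi (fun k => nc (a k)) l.
Proof. by move=> fin; rewrite /fsum !fsbig_finite //; exact: nc_sum. Qed.

Lemma bnd_fsum (pi : K -> L) (a : K -> C) M : finite_fibres pi ->
  bnd a M -> bnd (fsum pi a) M.
Proof.
move=> fin aM F; apply: le_trans (aM (fibres pi F)); rewrite -sum_fsum //.
by apply: ler_sum => l _; exact: nc_fsum.
Qed.

Lemma prod_fset_sub (F : {fset K * L}) : exists (A : {fset K}) (B : {fset L}),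
  (F `<=` [fset ((x, y) : K * L) | x in A, y in B])%fset.
Proof.
exists [fset p.1 | p in F]%fset, [fset p.2 | p in F]%fset; apply/fsubsetP => p pF.
apply/imfset2P; exists p.1; first exact: in_imfset.
by exists p.2; [exact: in_imfset|case: (p)].
Qed.

Lemma sum_prod_fset (V : pzRingType) (A : {fset K}) (B : {fset L}) (f : K -> V) (g : L -> V) :
  \sum_(p <- [fset ((x, y) : K * L) | x in A, y in B]%fset) f p.1 * g p.2 =
  (\sum_(x <- A) f x) * (\sum_(y <- B) g y).
Proof.
rewrite big_imfset2 /=; last by move=> [??] [??] _ _ /= [-> ->].
by rewrite mulr_suml; apply: eq_bigr => x _; rewrite mulr_sumr.
Qed.

Lemma bnd_prod (a : K -> C) (b : L -> C) M N : bnd a M -> bnd b N ->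
  bnd (fun p => a p.1 * b p.2) (M * N).
Proof.
move=> aM bN F; have [A [B AB]] := prod_fset_sub F.
apply: (le_trans (y := \sum_(p <- [fset ((x, y) : K * L) | x in A, y in B]%fset) nc (a p.1) * nc (b p.2))).
  under eq_bigr => p _ do rewrite ncM.
  by apply: ler_sum_fsubset => // p; rewrite mulr_ge0 ?nc_ge0.
rewrite (sum_prod_fset A B (fun k => nc (a k)) (fun k => nc (b k))).
apply: ler_pM => //; apply: sumr_ge0 => *; exact: nc_ge0.
Qed.

(** The product family has some sum [w] by absolute summability; its partial sums over large
    rectangles factor, which forces [w = s * t]. *)
Lemma hassum_prod (a : K -> C) (b : L -> C) s t : hassum a s -> hassum b t ->
  hassum (fun p => a p.1 * b p.2) (s * t).
Proof.
move=> ha hb.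
have [M aM] := hassum_bnd ha; have [N bN] := hassum_bnd hb.
have [w hw] := bnd_hassum (bnd_prod aM bN).
suff -> : s * t = w by [].
apply/eqP; rewrite -subr_eq0 -nc_eq0 eq_le nc_ge0 andbT.
apply/ler_addgt0Pl => e e0; rewrite addr0.
pose d := e / (1 + nc s + N + 2).
have N0 := bnd_ge0 bN; have := nc_ge0 s => s0.
have D0 : 0 < 1 + nc s + N + 2 by lra.
have d0 : 0 < d by rewrite divr_gt0.
have [F0 hF0] := hw _ d0.
have [A [B AB]] := prod_fset_sub F0.
have [A1 hA1] := ha _ d0; have [B1 hB1] := hb _ d0.
set A2 := (A `|` A1)%fset; set B2 := (B `|` B1)%fset.
have lA : nc (\sum_(k <- A2) a k - s) < d by apply: hA1; rewrite fsubsetUr.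
have lB : nc (\sum_(k <- B2) b k - t) < d by apply: hB1; rewrite fsubsetUr.
have := hF0 [fset ((x, y) : K * L) | x in A2, y in B2]%fset.
rewrite sum_prod_fset => /(_ _)/wrap[].
  apply: fsubset_trans AB _; apply/fsubsetP => p /imfset2P[x xA [y yB ->]].
  apply/imfset2P; exists x; first by rewrite !inE xA.
  by exists y; rewrite // !inE yB.
set u := \sum_(k <- A2) a k in lA *; set v := \sum_(k <- B2) b k in lB * => luv.
have vN : nc v <= N by apply: le_trans (nc_sum _ _ _) (bN _).
rewrite (_ : s * t - w = (u * v - w) - ((u - s) * v + s * (v - t))); last by ring.
rewrite (le_trans (ncB _ _)) // (le_trans (lerD (ltW luv) (ncD _ _))) // !ncM.
have h1 : nc (u - s) * nc v <= d * N.
  by rewrite ler_pM ?nc_ge0 // ltW.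
have h2 : nc s * nc (v - t) <= nc s * d by rewrite ler_wpM2l // ltW.
apply: (le_trans (y := d * (1 + nc s + N + 2))); last by rewrite /d divfK // gt_eqF.
nra.
Qed.

End TwoTypes.
End Families.

(** * Germs of analytic functions *)

Section Nbhs.
Variables (R : realType).
Local Notation C := R[i].

Lemma hassum_cvgP (K : choiceType) (a : K -> C) (s : C) :
  (summability.partial_sum (a : K -> C^o) @ summability.totally --> (s : C^o)) <->
  hassum a s.
Proof.
have psE F : summability.partial_sum (a : K -> C^o) F = \sum_(k <- F) a k.
  by rewrite /summability.partial_sum big_seq_fsetE.
have FF := @summability.totally_filter K.
split.
  move=> /cvgrPdist_lt h e e0.
  have e0C : 0 < e%:C by rewrite ltcR.
  have [F0 _ hF] := h _ e0C; exists F0 => F /hF /=.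
  by rewrite nc_norm ltcR psE nc_distC.
move=> h; apply/cvgrPdist_lt => e e0.
have [e' e'0 ->] : exists2 e', 0 < e' & e = e'%:C.
  have := e0; rewrite ltcE /= => /andP[/eqP im re]; exists (complex.Re e) => //.
  by case: e {e0} im re => u v /= ->.
have [F0 hF] := h _ e'0; exists F0 => //= F /hF.
by rewrite nc_norm ltcR psE nc_distC.
Qed.

Lemma near0P (m : nat) (P : set 'rV[C^o]_m) :
  (\forall x \near (0 : 'rV[C^o]_m), P x) <->
  exists2 e : R, 0 < e & forall x : 'rV[C]_m, (forall i, nc (x 0 i) < e) -> P x.
Proof.
split.
  move=> /nbhs_ballP[e /= e0 h]; exists (complex.Re e) => [|x hx].
    by move: e0; rewrite ltcE => /andP[].
  apply: h; split=> // i j; rewrite ord1 mxE /ball /= sub0r normrN nc_norm ltcE /= hx.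
  by move: e0; rewrite ltcE => /andP[/= /eqP ->]; rewrite eqxx.
move=> [e e0 h]; apply/nbhs_ballP; exists e%:C => /=; first by rewrite ltcR.
move=> x [_ hx]; apply: h => i; have := hx ord0 i.
by rewrite mxE /ball /= sub0r normrN nc_norm ltcR.
Qed.

End Nbhs.

Section Monomials.
Variables (T : comNzRingType) (m : nat).
Implicit Types (x y : 'rV[T]_m) (k l : 'rV[nat]_m).

Lemma monomial0 x : monomial x 0 = 1.
Proof. by rewrite /monomial big1 // => i _; rewrite mxE. Qed.

Lemma monomialD x k l : monomial x (k + l) = monomial x k * monomial x l.
Proof. by rewrite /monomial -big_split; apply: eq_bigr => i _; rewrite mxE exprD. Qed.

Lemma monomialMn x k s : monomial x (k *+ s) = monomial x k ^+ s.
Proof. by elim: s => [|s IH]; rewrite ?mulr0n ?monomial0 // mulrS monomialD IH exprS. Qed.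

Lemma monomial_mul x y k :
  monomial (\row_i (x 0 i * y 0 i)) k = monomial x k * monomial y k.
Proof. by rewrite /monomial -big_split; apply: eq_bigr => i _; rewrite mxE exprMn. Qed.

Lemma monomial_exp x k s : monomial (\row_i (x 0 i ^+ s)) k = monomial x k ^+ s.
Proof.
by rewrite /monomial -prodrXl; apply: eq_bigr => i _; rewrite mxE -!exprM mulnC.
Qed.

Lemma monomial_zero k : monomial (0 : 'rV[T]_m) k = (k == 0)%:R.
Proof.
have [->|] := eqVneq k 0; first by rewrite monomial0.
move=> k0; have : ~~ [forall i, k 0 i == 0].
  by apply: contra k0 => /forallP h; apply/eqP/rowP => i; rewrite mxE; exact/eqP.
rewrite negb_forall => /existsP[i ki].
by rewrite /monomial (bigD1 i) //= mxE expr0n (negbTE ki) mul0r.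
Qed.

End Monomials.

Lemma monomial_map (T U : comNzRingType) (f : {rmorphism T -> U}) m (x : 'rV[T]_m) k :
  monomial (map_mx f x) k = f (monomial x k).
Proof. by rewrite rmorph_prod; apply: eq_bigr => i _; rewrite mxE rmorphXn. Qed.

Section RealMonomials.
Variable R : realType.
Local Notation C := R[i].
Variable m : nat.

Lemma nc_monomial (x : 'rV[C]_m) k : nc (monomial x k) = monomial (\row_i nc (x 0 i)) k.
Proof. by rewrite nc_prod; apply: eq_bigr => i _; rewrite mxE ncX. Qed.

Lemma monomial_ge0 (x : 'rV[R]_m) k : (forall i, 0 <= x 0 i) -> 0 <= monomial x k.
Proof. by move=> h; apply: prodr_ge0 => i _; rewrite exprn_ge0. Qed.

Lemma monomial_gt0 (x : 'rV[R]_m) k : (forall i, 0 < x 0 i) -> 0 < monomial x k.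
Proof. by move=> h; apply: prodr_gt0 => i _; rewrite exprn_gt0. Qed.

Lemma monomial_le (x y : 'rV[R]_m) k : (forall i, 0 <= x 0 i <= y 0 i) ->
  monomial x k <= monomial y k.
Proof.
move=> h; apply: ler_prod => i _; have /andP[x0 xy] := h i.
by rewrite exprn_ge0 //= lerXn2r // nnegrE // (le_trans x0).
Qed.

End RealMonomials.

Section AnalyticGerms.
Variables (R : realType) (r : nat).
Local Notation C := R[i].
Local Notation K := 'rV[nat]_r.
Implicit Types (a b : K -> C) (f g : 'rV[C]_r -> C).

(** Absolute convergence on a closed polydisc, expressed on the coefficients alone. The division
    needs radii that differ from one coordinate to the next. *)
Definition poly_radius (rho : 'rV[R]_r) a :=
  exists M, bnd (fun k => a k * (monomial rho k)%:C) M.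

Lemma nc_coef_rho (rho : 'rV[R]_r) a k : (forall i, 0 <= rho 0 i) ->
  nc (a k * (monomial rho k)%:C) = nc (a k) * monomial rho k.
Proof. by move=> h; rewrite ncM nc_real // monomial_ge0. Qed.

Lemma poly_radius_le (rho sig : 'rV[R]_r) a : (forall i, 0 <= sig 0 i <= rho 0 i) ->
  poly_radius rho a -> poly_radius sig a.
Proof.
move=> h [M aM]; exists M; apply: bnd_le aM => k.
have sig0 i : 0 <= sig 0 i by have /andP[] := h i.
have rho0 i : 0 <= rho 0 i by have /andP[h1 h2] := h i; rewrite (le_trans h1).
by rewrite !nc_coef_rho // ler_wpM2l ?nc_ge0 // monomial_le.
Qed.

Lemma bnd_at (rho : 'rV[R]_r) a M (x : 'rV[C]_r) :
  bnd (fun k => a k * (monomial rho k)%:C) M -> (forall i, nc (x 0 i) <= rho 0 i) ->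
  bnd (fun k => a k * monomial x k) M.
Proof.
move=> aM h; have rho0 i : 0 <= rho 0 i by rewrite (le_trans (nc_ge0 _) (h i)).
apply: bnd_le aM => k; rewrite nc_coef_rho // ncM ler_wpM2l ?nc_ge0 // nc_monomial.
by apply: monomial_le => i; rewrite mxE nc_ge0 h.
Qed.

Lemma has_taylorP f a : has_taylor f a <->
  exists2 e : R, 0 < e & forall x : 'rV[C]_r, (forall i, nc (x 0 i) < e) ->
    hassum (fun k => a k * monomial x k) (f x).
Proof.
split=> [/near0P[e e0 h]|[e e0 h]].
  by exists e => // x /h; move/hassum_cvgP.
by apply/near0P; exists e => // x /h ?; apply/hassum_cvgP.
Qed.

Lemma has_taylor_radius f a : has_taylor f a ->
  exists2 rho : R, 0 < rho & poly_radius (const_mx rho) a /\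
   forall x : 'rV[C]_r, (forall i, nc (x 0 i) <= rho) ->
    hassum (fun k => a k * monomial x k) (f x).
Proof.
move=> /has_taylorP[e e0 h]; have e2 : 0 < e / 2 by rewrite divr_gt0.
exists (e / 2) => //; split=> [|x hx]; last first.
  by apply: h => i; rewrite (le_lt_trans (hx i)) // ltr_pdivrMr // ltr_pMr // ltr1n.
have [|M aM] := @hassum_bnd _ _ _ _ (h (const_mx (e / 2)%:C) _).
  by move=> i; rewrite mxE nc_real ?(ltW e2) // ltr_pdivrMr // ltr_pMr // ltr1n.
exists M; apply: bnd_le aM => k.
by rewrite -(monomial_map (real_complex R)) map_const_mx.
Qed.

Lemma poly_radius_taylor (rho : 'rV[R]_r) a : (forall i, 0 < rho 0 i) ->
  poly_radius rho a -> exists f, has_taylor f a.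
Proof.
move=> rho0 [M aM].
have [e e0 erho] : exists2 e : R, 0 < e & forall i, e <= rho 0 i.
  exists (\big[Order.min/1]_(i < r) rho 0 i); first by apply: lt_bigmin.
  by move=> i; apply: bigmin_le_cond.
have H (x : 'rV[C]_r) : exists s, (forall i, nc (x 0 i) < e) -> hassum (fun k => a k * monomial x k) s.
  have [hx|nx] := pselect (forall i, nc (x 0 i) < e); last by exists 0.
  have [|s hs] := @bnd_hassum _ _ (fun k => a k * monomial x k) M; last by exists s.
  by apply: bnd_at aM _ => i; rewrite (le_trans (ltW (hx i))).
have [f hf] := choice H; exists f; apply/has_taylorP; exists e => // x; exact: hf.
Qed.

Lemma has_taylor_at0 f a : has_taylor f a -> f 0 = a 0.
Proof.
move=> /has_taylorP[e e0 /(_ 0) h].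
have {}h : hassum (fun k => a k * monomial 0 k) (f 0) by apply: h => i; rewrite mxE nc0.
have := @hassum_fin _ _ [fset 0]%fset (fun k => a k * monomial 0 k).
rewrite big_seq_fset1 monomial0 mulr1 => /(_ _)/wrap[k|].
  by rewrite !inE monomial_zero => /negbTE ->; rewrite mulr0.
exact: hassum_unique.
Qed.

Lemma has_taylor_unique_fun f g a : has_taylor f a -> has_taylor g a ->
  \forall x \near (0 : 'rV[C^o]_r), f x = g x.
Proof.
move=> /has_taylorP[e e0 h] /has_taylorP[d d0 h']; apply/near0P.
exists (Num.min e d) => [|x hx]; first by rewrite lt_min e0.
by apply: hassum_unique (h x _) (h' x _) => i; have := hx i; rewrite lt_min => /andP[].
Qed.

Lemma has_taylorD f g a b : has_taylor f a -> has_taylor g b ->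
  has_taylor (fun x => f x + g x) (fun k => a k + b k).
Proof.
move=> /has_taylorP[e e0 h] /has_taylorP[d d0 h']; apply/has_taylorP.
exists (Num.min e d) => [|x hx]; first by rewrite lt_min e0.
have : hassum (fun k => a k * monomial x k + b k * monomial x k) (f x + g x).
  by apply: hassumD; [apply: h|apply: h'] => i; have := hx i; rewrite lt_min => /andP[].
by apply: hassum_ext => k; rewrite mulrDl.
Qed.

Lemma has_taylorZ f a c : has_taylor f a ->
  has_taylor (fun x => c * f x) (fun k => c * a k).
Proof.
move=> /has_taylorP[e e0 h]; apply/has_taylorP; exists e => // x hx.
by apply: hassum_ext (hassumZ c (h x hx)) => k; rewrite mulrA.
Qed.

Lemma has_taylorB f g a b : has_taylor f a -> has_taylor g b ->
  has_taylor (fun x => f x - g x) (fun k => a k - b k).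
Proof.
move=> hf /(@has_taylorZ _ _ (-1)) hg; have := has_taylorD hf hg.
by under eq_fun do rewrite mulN1r; under [X in has_taylor _ X]eq_fun do rewrite mulN1r.
Qed.

Lemma has_taylor_monomial k0 :
  has_taylor (fun x : 'rV[C]_r => monomial x k0) (fun k => (k == k0)%:R).
Proof.
apply/has_taylorP; exists 1 => // x _.
have := @hassum_fin _ _ [fset k0]%fset (fun k => (k == k0)%:R * monomial x k).
rewrite big_seq_fset1 eqxx mul1r; apply => k.
by rewrite !inE => /negbTE ->; rewrite mul0r.
Qed.

Lemma finite_addition : finite_fibres (fun p : K * K => p.1 + p.2).
Proof.
move=> k; pose N := \max_(i < r) k ord0 i.
pose h (p : {ffun 'I_r -> 'I_N.+1} * {ffun 'I_r -> 'I_N.+1}) : K * K :=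
  (\row_i (p.1 i : nat), \row_i (p.2 i : nat)).
apply: (@sub_finite_set _ _ [set h p | p in [set: _]]); last first.
  by apply: finite_image; exact: finite_finset.
move=> [k1 k2] /= kk; exists ([ffun i => inord (k1 ord0 i)], [ffun i => inord (k2 ord0 i)]) => //.
have le i : (k1 ord0 i <= N)%N && (k2 ord0 i <= N)%N.
  have : (k ord0 i <= N)%N by apply: leq_bigmax.
  rewrite -kk mxE; move: (k1 ord0 i) (k2 ord0 i) => u v uv.
  by rewrite !(leq_trans _ uv) // ?leq_addl ?leq_addr.
congr pair; apply/rowP => i; rewrite mxE ffunE inordK // ltnS; by case/andP: (le i).
Qed.

Definition conv a b : K -> C := fsum (fun p : K * K => p.1 + p.2) (fun p => a p.1 * b p.2).

Lemma conv_neq0 a b k : conv a b k != 0 ->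
  exists k1 k2, [/\ k = k1 + k2, a k1 != 0 & b k2 != 0].
Proof.
move=> /fsum_neq0[[k1 k2] /= <-]; rewrite mulf_eq0 negb_or => /andP[? ?].
by exists k1, k2.
Qed.

(** The weight is arbitrary because it is used with [monomial x], to multiply sums, and with
    positive radii, to multiply norms. *)
Lemma conv_weighted a b (w : K -> C) : (forall k l, w (k + l) = w k * w l) ->
  (fun k => conv a b k * w k) =
  fsum (fun p : K * K => p.1 + p.2) (fun p => (a p.1 * w p.1) * (b p.2 * w p.2)).
Proof.
move=> wD; apply/funext => k; rewrite /conv /fsum.
rewrite !fsbig_finite; [|exact: finite_addition..].
rewrite mulr_suml; apply: eq_fbigr => -[k1 k2].
rewrite in_fset_set ?inE; last exact: finite_addition.
by move=> /asboolP /= <-; rewrite wD mulrACA.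
Qed.

Lemma conv_bnd a b (w : K -> C) M N : (forall k l, w (k + l) = w k * w l) ->
  bnd (fun k => a k * w k) M -> bnd (fun k => b k * w k) N ->
  bnd (fun k => conv a b k * w k) (M * N).
Proof.
move=> wD aM bN; rewrite conv_weighted //.
exact: (bnd_fsum finite_addition (bnd_prod aM bN)).
Qed.

Lemma has_taylorM f g a b : has_taylor f a -> has_taylor g b ->
  has_taylor (fun x => f x * g x) (conv a b).
Proof.
move=> /has_taylorP[e e0 h] /has_taylorP[d d0 h']; apply/has_taylorP.
exists (Num.min e d) => [|x hx]; first by rewrite lt_min e0.
rewrite (conv_weighted _ _ (monomialD x)).
apply: (hassum_fsum finite_addition); apply: (hassum_prod (h x _) (h' x _)) => i;
  by have := hx i; rewrite lt_min => /andP[].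
Qed.

Lemma analyticD f g : analytic0 f -> analytic0 g -> analytic0 (fun x => f x + g x).
Proof. by move=> [a fa] [b gb]; eexists; exact: has_taylorD fa gb. Qed.

Lemma analyticM f g : analytic0 f -> analytic0 g -> analytic0 (fun x => f x * g x).
Proof. by move=> [a fa] [b gb]; eexists; exact: has_taylorM fa gb. Qed.

Lemma analytic_monomial k : analytic0 (fun x : 'rV[C]_r => monomial x k).
Proof. by eexists; exact: has_taylor_monomial. Qed.

Lemma analytic_cst c : analytic0 (fun _ : 'rV[C]_r => c).
Proof.
have := has_taylorZ c (has_taylor_monomial 0).
under eq_fun do rewrite monomial0 mulr1.
by move=> h; eexists; exact: h.
Qed.

Lemma analytic_sum (I : Type) (s : seq I) (F : I -> 'rV[C]_r -> C) :
  (forall i, analytic0 (F i)) -> analytic0 (fun x => \sum_(i <- s) F i x).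
Proof.
move=> h; elim: s => [|i s IH].
  by rewrite (_ : (fun x => _) = cst 0) ?funeqE; [exact: (analytic_cst 0)|move=> x; rewrite big_nil].
rewrite (_ : (fun x => _) = (fun x => F i x + \sum_(j <- s) F j x)).
  exact: (analyticD (h i) IH).
by apply/funext => x; rewrite big_cons.
Qed.

Lemma analytic_prod (I : Type) (s : seq I) (F : I -> 'rV[C]_r -> C) :
  (forall i, analytic0 (F i)) -> analytic0 (fun x => \prod_(i <- s) F i x).
Proof.
move=> h; elim: s => [|i s IH].
  by rewrite (_ : (fun x => _) = cst 1) ?funeqE; [exact: (analytic_cst 1)|move=> x; rewrite big_nil].
rewrite (_ : (fun x => _) = (fun x => F i x * \prod_(j <- s) F j x)).
  exact: (analyticM (h i) IH).
by apply/funext => x; rewrite big_cons.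
Qed.

Lemma analyticX f s : analytic0 f -> analytic0 (fun x => f x ^+ s).
Proof.
move=> h; elim: s => [|s IH]; first exact: (analytic_cst 1).
rewrite (_ : (fun x => _) = (fun x => f x * f x ^+ s)); first exact: (analyticM h IH).
by apply/funext => x; rewrite exprS.
Qed.

Lemma taylorP f : analytic0 f -> has_taylor f (taylor f).
Proof. by move=> [a fa]; apply: (@xgetPex _ _ [set a | has_taylor f a]); exists a. Qed.

End AnalyticGerms.

Lemma fset_setP (T : choiceType) (A : set T) x : finite_set A ->
  reflect (A x) (x \in fset_set A).
Proof.
by move=> fA; apply: (iffP idP); rewrite in_fset_set //; [exact: set_mem|exact: mem_set].
Qed.

Lemma ex_uniform_bound (m : nat) (P : 'I_m -> nat -> Prop) :
  (forall i, exists N, forall s, (N <= s)%N -> P i s) ->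
  exists N, forall s, (N <= s)%N -> forall i, P i s.
Proof.
move=> /choice[N hN]; exists (\max_(i < m) N i) => s hs i; apply: hN.
exact: leq_trans (leq_bigmax i) hs.
Qed.

Lemma finite_box (m N : nat) (A : set 'rV[nat]_m) :
  (forall k, A k -> forall i, (k ord0 i <= N)%N) -> finite_set A.
Proof.
move=> AN; pose h (p : {ffun 'I_m -> 'I_N.+1}) : 'rV[nat]_m := \row_i (p i : nat).
apply: (@sub_finite_set _ _ [set h p | p in [set: _]]); last first.
  by apply: finite_image; exact: finite_finset.
move=> k /AN kN; exists [ffun i => inord (k ord0 i)] => //.
by apply/rowP => i; rewrite mxE ffunE inordK ?ltnS.
Qed.

(** * Injective multiplicative weights on exponents *)

Section Weights.

Lemma distinct_primes : exists p : nat -> nat, (forall i, prime (p i)) /\ injective p.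
Proof.
pose p i := iter i.+1 (fun m => s2val (prime_above m)) 0%N.
have pP i : prime (p i) by exact: (s2valP' (prime_above (iter i _ 0%N))).
have plt i : (p i < p i.+1)%N by exact: (s2valP (prime_above (p i))).
exists p; split=> // i j.
have mono : {homo p : i j / (i < j)%N} by apply: homo_ltn => // ? ? ?; exact: ltn_trans.
by move=> pij; case: (ltngtP i j) => // /mono; rewrite pij ltnn.
Qed.

Lemma logn_prodn (I : Type) (s : seq I) (F : I -> nat) p : (forall i, (0 < F i)%N) ->
  logn p (\prod_(i <- s) F i) = (\sum_(i <- s) logn p (F i))%N.
Proof.
move=> F0; elim: s => [|i s IH]; first by rewrite !big_nil logn1.
by rewrite !big_cons lognM ?IH // prodn_gt0.
Qed.

(** For distinct primes [p i] this is injective by unique factorization. It yields a total order on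
    exponents that is compatible with addition and has finitely many elements below each one. *)
Definition nweight m (p : 'I_m -> nat) (k : 'rV[nat]_m) : nat :=
  (\prod_(i < m) p i ^ k ord0 i)%N.

Lemma injective_weight m : exists p : 'I_m -> nat,
  (forall i, (1 < p i)%N) /\ injective (nweight p).
Proof.
have [q [qP qI]] := distinct_primes; exists (fun i => q i); split=> [i|k l].
  exact: prime_gt1.
have logE (v : 'rV[nat]_m) (i : 'I_m) : logn (q i) (nweight (fun i => q i) v) = v ord0 i.
  rewrite logn_prodn => [|j]; last by rewrite expn_gt0 prime_gt0.
  rewrite (bigD1 i) //= big1 ?addn0 => [|j ji].
    by rewrite lognX logn_prime // eqxx muln1.
  rewrite lognX logn_prime // (_ : (q i == q j) = false) ?muln0 //.
  by apply/negbTE; apply: contra ji => /eqP/qI/val_inj ->.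
by move=> kl; apply/rowP => i; rewrite -!logE kl.
Qed.

Lemma nweightD m (p : 'I_m -> nat) k l : nweight p (k + l) = (nweight p k * nweight p l)%N.
Proof. by rewrite /nweight -big_split /=; apply: eq_bigr => i _; rewrite mxE expnD. Qed.

Lemma nweight_gt0 m (p : 'I_m -> nat) k : (forall i, (1 < p i)%N) -> (0 < nweight p k)%N.
Proof. by move=> p1; apply: prodn_gt0 => i; rewrite expn_gt0 ltnW. Qed.

Lemma monomial_nweight (R : realType) m (p : 'I_m -> nat) k :
  monomial (\row_i ((p i)%:R^-1 : R)) k = (nweight p k)%:R^-1.
Proof.
rewrite /monomial /nweight natr_prod -prodfV; apply: eq_bigr => i _.
by rewrite mxE natrX exprVn.
Qed.

End Weights.

Lemma prodr_le1 (R : realType) (I : finType) (P : pred I) (F : I -> R) :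
  (forall i, P i -> 0 <= F i <= 1) -> \prod_(i | P i) F i <= 1.
Proof.
move=> h; apply: (le_trans (y := \prod_(i | P i) (1 : R))); last by rewrite big1.
exact: ler_prod.
Qed.

Section Geometric.
Variable R : realType.

(** The gap is the source of the geometric decay of nonleading terms. The lower bound [mu / 2] keeps
    [mu'] positive and above all values outside the finite list to which the lemma is applied. *)
Lemma gap_below (T : eqType) (s : seq T) (u : T -> R) (mu : R) : 0 < mu ->
  exists2 mu', mu / 2 <= mu' < mu & forall v, v \in s -> u v < mu -> u v <= mu'.
Proof.
move=> mu0; elim: s => [|v s [mu' /andP[mu1 mu2] h]]; first by exists (mu / 2) => //; lra.
have [vmu|muv] := ltP (u v) mu; last first.
  exists mu' => [|w]; first by rewrite mu1.
  by rewrite inE => /orP[/eqP -> |/h//]; rewrite ltNge muv.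
exists (Num.max mu' (u v)) => [|w]; first by rewrite le_max mu1 gt_max mu2.
by rewrite inE le_max => /orP[/eqP -> | /h hw /hw ->] //; rewrite lexx orbT.
Qed.

Lemma geometric_small (q A e : R) : 0 <= q -> q < 1 -> 0 < e ->
  exists N, forall s, (N <= s)%N -> A * q ^+ s <= e.
Proof.
move=> q0 q1 e0; have := @cvg_geometric R A q.
rewrite ger0_norm // => /(_ q1)/cvgrPdist_le /(_ e e0)[N _ hN].
exists N => s /hN; rewrite sub0r normrN; exact: le_trans (ler_norm _).
Qed.

End Geometric.

(** * Restriction to the toric variety *)

Section Toric.
Variables (R : realType) (r n : nat) (b : 'M[nat]_(r, n)).
Hypothesis b_neq0 : forall i, row i b != 0.
Local Notation C := R[i].
Local Notation K := 'rV[nat]_r.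
Implicit Types (a : K -> C) (f g : 'rV[C]_r -> C) (v : 'rV[nat]_n).

Lemma coord_le_sum (k : K) (i : 'I_r) : (k ord0 i <= \sum_(j < n) (k *m b) ord0 j)%N.
Proof.
have [j bij] : exists j, (0 < b i j)%N.
  apply: contrapT => nex; move/negP: (b_neq0 i); apply; apply/eqP/rowP => j.
  rewrite !mxE; apply/eqP; rewrite -leqn0 leqNgt; apply/negP => h; apply: nex.
  by exists j.
rewrite (bigD1 j) //= (leq_trans _ (leq_addr _ _)) // mxE (bigD1 i) //=.
by rewrite (leq_trans _ (leq_addr _ _)) // leq_pmulr.
Qed.

Lemma finite_toric_fibres : finite_fibres (fun k : K => k *m b).
Proof.
move=> v; apply: (@finite_box _ (\sum_(j < n) v ord0 j)%N) => k /= <-.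
exact: coord_le_sum.
Qed.

Lemma coefSB a a' v : coefS b (fun k => a k - a' k) v = coefS b a v - coefS b a' v.
Proof. by rewrite /coefS !fsbig_finite ?sumrB //; exact: finite_toric_fibres. Qed.

Lemma coefS_neq0 a v : coefS b a v != 0 -> exists2 k, k *m b = v & a k != 0.
Proof. exact: fsum_neq0. Qed.

(** The monomial map [z |-> (z^(b_1), ..., z^(b_r))] into [X(S)], along which germs are pulled
    back. *)
Definition par (T : comNzRingType) (z : 'rV[T]_n) : 'rV[T]_r := \row_i monomial z (row i b).

Lemma monomial_par (T : comNzRingType) (z : 'rV[T]_n) k :
  monomial (par z) k = monomial z (k *m b).
Proof.
rewrite /monomial; under eq_bigr => i _ do rewrite mxE /monomial -prodrXl.
rewrite exchange_big; apply: eq_bigr => j _; rewrite mxE.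
rewrite (big_morph (fun s => z 0 j ^+ s) (exprD (z 0 j)) (expr0 _)).
by apply: eq_bigr => i _; rewrite mxE -exprM mulnC.
Qed.

Lemma int_pos_sub (p q : nat) : absz (Num.max (p%:Z - q%:Z) 0) = (p - q)%N.
Proof. by case: leP; lia. Qed.

Lemma int_pos_neg (m : int) : m = (absz (Num.max m 0))%:Z - (absz (Num.max (- m) 0))%:Z.
Proof. by case: leP; case: leP; lia. Qed.

Lemma pos_part_sub (k l : K) : pos_part (map_mx Posz k - map_mx Posz l) = \row_i (k ord0 i - l ord0 i)%N.
Proof. by apply/rowP => i; rewrite !mxE int_pos_sub. Qed.

Lemma map_Posz_mul (k : K) : map_mx Posz k *m map_mx Posz b = map_mx Posz (k *m b).
Proof.
apply/matrixP => i j; rewrite !mxE; under eq_bigr => l _ do rewrite !mxE -PoszM.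
by rewrite -(big_morph Posz PoszD (erefl _)).
Qed.

(** The defining binomials involve exponents with disjoint supports; the coordinatewise minimum of
    [k] and [l] is factored out to reach the general case. *)
Lemma toric_monomial_eq (x : 'rV[C]_r) k l : toric_variety b x -> k *m b = l *m b ->
  monomial x k = monomial x l.
Proof.
move=> xX kl.
have := xX (map_mx Posz k - map_mx Posz l).
rewrite mulmxBl !map_Posz_mul kl subrr => /(_ erefl)/eqP.
rewrite /neg_part opprB !pos_part_sub subr_eq0 => /eqP h.
have E (u w : K) : u = \row_i (u ord0 i - w ord0 i)%N + \row_i (minn (u ord0 i) (w ord0 i)).
  by apply/rowP => i; rewrite !mxE; move: (u _ _) (w _ _) => p q /=; lia.
rewrite [in LHS](E k l) [in RHS](E l k) !monomialD h; congr (_ * monomial _ _).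
by apply/rowP => i; rewrite !mxE minnC.
Qed.

Lemma par_toric (z : 'rV[C]_n) : toric_variety b (par z).
Proof.
move=> al al0; rewrite !monomial_par.
suff -> : pos_part al *m b = neg_part al *m b by rewrite subrr.
have E : al = map_mx Posz (pos_part al) - map_mx Posz (neg_part al).
  by apply/rowP => i; rewrite !mxE -int_pos_neg.
move: al0; rewrite {1}E mulmxBl !map_Posz_mul => /eqP; rewrite subr_eq0 => /eqP h.
by apply/matrixP => i j; move/matrixP: h => /(_ i j); rewrite !mxE => -[].
Qed.

Lemma coefS_monomial a (x : 'rV[C]_r) k : toric_variety b x ->
  fsum (fun k => k *m b) (fun k => a k * monomial x k) (k *m b) = coefS b a (k *m b) * monomial x k.
Proof.
move=> xX; rewrite /coefS /fsum !fsbig_finite; [|exact: finite_toric_fibres..].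
rewrite mulr_suml; apply: eq_fbigr => l.
rewrite in_fset_set ?inE; last exact: finite_toric_fibres.
by move=> /asboolP /= kl _; rewrite (toric_monomial_eq xX kl).
Qed.

Lemma coefS_par a (z : 'rV[C]_n) v :
  fsum (fun k => k *m b) (fun k => a k * monomial (par z) k) v = coefS b a v * monomial z v.
Proof.
have [[k <-]|nk] := pselect (exists k : K, k *m b = v).
  by rewrite coefS_monomial ?monomial_par //; exact: par_toric.
rewrite /coefS /fsum !fsbig1 ?mul0r // => k /= kv; case: nk; by exists k.
Qed.

Lemma germ_eq0_coefS f a : has_taylor f a -> (forall v, coefS b a v = 0) ->
  germ_eq b f (fun=> 0).
Proof.
move=> /has_taylorP[e e0 h] a0; apply/near0P; exists e => // x hx xX.
apply: hassum_unique (hassum_fsum finite_toric_fibres (h x hx)) _.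
apply: hassum0 => v; have [[k <-]|nk] := pselect (exists k : K, k *m b = v).
  by rewrite coefS_monomial // a0 mul0r.
by rewrite /fsum fsbig1 // => k /= kv; case: nk; exists k.
Qed.

Lemma par_small (e : R) : 0 < e -> exists2 d : R, 0 < d &
  forall z : 'rV[C]_n, (forall j, nc (z 0 j) < d) -> forall i, nc (par z 0 i) < e.
Proof.
move=> e0; exists (Num.min 1 e) => [|z hz i]; first by rewrite lt_min ltr01.
have [j bij] : exists j, (0 < b i j)%N.
  apply: contrapT => nex; move/negP: (b_neq0 i); apply; apply/eqP/rowP => j.
  rewrite !mxE; apply/eqP; rewrite -leqn0 leqNgt; apply/negP => h; apply: nex.
  by exists j.
rewrite mxE nc_monomial /monomial (bigD1 j) //= !mxE.
have z1 l : nc (z 0 l) <= 1 by have := hz l; rewrite lt_min => /andP[/ltW].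
apply: (le_lt_trans (y := nc (z 0 j))); last by have := hz j; rewrite lt_min => /andP[].
rewrite -[leRHS]mulr1 ler_pM ?exprn_ge0 ?nc_ge0 //.
- by apply: prodr_ge0 => l _; rewrite mxE exprn_ge0 ?nc_ge0.
- by case: (b i j) bij => // m _; rewrite exprS ler_piMr ?nc_ge0 // exprn_ile1 ?nc_ge0.
- by apply: prodr_le1 => l _; rewrite !mxE exprn_ge0 ?exprn_ile1 ?nc_ge0.
Qed.

Lemma near_par (P : set 'rV[C]_r) : (\forall x \near (0 : 'rV[C^o]_r), P x) ->
  \forall z \near (0 : 'rV[C^o]_n), P (par z).
Proof.
move=> /near0P[e e0 h]; have [d d0 hd] := par_small e0.
by apply/near0P; exists d => // z /hd; exact: h.
Qed.

Lemma finite_large_monomials (th : 'rV[R]_r) (c : R) :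
  (forall i, 0 < th 0 i < 1) -> 0 < c -> finite_set [set k : K | c <= monomial th k].
Proof.
move=> th01 c0.
have [N hN] : exists N, forall s, (N <= s)%N -> forall i, 1 * th 0 i ^+ s <= c / 2.
  apply: ex_uniform_bound => i; have /andP[t0 t1] := th01 i.
  by apply: geometric_small; rewrite ?divr_gt0 // ltW.
apply: (@finite_box _ N) => k /= ck i; rewrite leqNgt; apply/negP => /ltnW/hN/(_ i).
rewrite mul1r; suff: monomial th k <= th 0 i ^+ k 0 i by lra.
rewrite /monomial (bigD1 i) //= -[leRHS]mulr1 ler_wpM2l ?exprn_ge0 //.
  by have /andP[/ltW] := th01 i.
apply: prodr_le1 => j _; have /andP[t0 t1] := th01 j.
by rewrite exprn_ge0 ?exprn_ile1 // ltW.
Qed.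

Lemma finite_large_toric (om : 'rV[R]_n) (c : R) : (forall j, 0 < om 0 j) ->
  (forall i, monomial om (row i b) < 1) -> 0 < c ->
  finite_set [set v | (exists k : K, k *m b = v) /\ c <= monomial om v].
Proof.
move=> om0 om1 c0.
apply: (@sub_finite_set _ _ [set k *m b | k in [set k : K | c <= monomial (par om) k]]).
  by move=> v /= [[k <-] h]; exists k; rewrite //= monomial_par.
apply/finite_image/finite_large_monomials => // i.
by rewrite mxE monomial_gt0 //= om1.
Qed.

(** The curve [z e^(-v s)] at integer times, with [om] standing for [e^(-v)]. *)
Definition curve (z : 'rV[C]_n) (om : 'rV[R]_n) (s : nat) : 'rV[C]_n :=
  \row_j (z 0 j * (om 0 j ^+ s)%:C).

Lemma monomial_curve z om s v :
  monomial (curve z om s) v = monomial z v * (monomial om v ^+ s)%:C.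
Proof.
rewrite (_ : curve z om s = \row_j (z 0 j * (map_mx (real_complex R) (\row_j (om 0 j ^+ s))) 0 j)).
  by rewrite monomial_mul monomial_map monomial_exp.
by apply/rowP => j; rewrite !mxE.
Qed.

Lemma par_curve_small z (om : 'rV[R]_n) (e : R) : (forall j, 0 < om 0 j) ->
  (forall i, monomial om (row i b) < 1) -> 0 < e ->
  exists N, forall s, (N <= s)%N -> forall i, nc (par (curve z om s) 0 i) <= e.
Proof.
move=> om0 om1 e0; apply: ex_uniform_bound => i.
have [N hN] := geometric_small (nc (monomial z (row i b))) (ltW (monomial_gt0 (row i b) om0)) (om1 i) e0.
exists N => s /hN; rewrite mxE monomial_curve ncM nc_real //.
by rewrite exprn_ge0 // monomial_ge0 // => j; rewrite ltW.
Qed.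

(** The term over [v] decays like [monomial om v ^+ s]. Finitely many [v] of the semigroup have
    weight at least [mu / 2], so the terms of weight other than [mu] have weight at most some
    [mu' < mu], and their sum is bounded by a multiple of [mu' ^+ s]. *)
Lemma asymptotics f a z (om : 'rV[R]_n) (mu : R) : has_taylor f a ->
  (forall j, 0 < om 0 j) -> (forall i, monomial om (row i b) < 1) -> 0 < mu ->
  (forall v, coefS b a v != 0 -> monomial om v <= mu) ->
  forall e, 0 < e -> exists N, forall s, (N <= s)%N ->
    nc (f (par (curve z om s)) -
        (\sum_(v \in [set v | coefS b a v != 0 /\ monomial om v = mu]) coefS b a v * monomial z v) *
          (mu ^+ s)%:C) <= e * mu ^+ s.
Proof.
move=> fa om0 om1 mu0 amu e e0.
set A := [set v | _]; set E := \sum_(v \in A) _.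
have [rho rho0 [_ hf]] := has_taylor_radius fa.
have [s0 hs0] := par_curve_small z om0 om1 rho0.
have hsum s : (s0 <= s)%N ->
    hassum (fun v => coefS b a v * monomial (curve z om s) v) (f (par (curve z om s))).
  move=> /hs0/hf/(hassum_fsum finite_toric_fibres).
  by apply: hassum_ext => v; exact: coefS_par.
have [M aM] := hassum_bnd (hsum s0 (leqnn _)).
pose T := [set v | (exists k : K, k *m b = v) /\ mu / 2 <= monomial om v].
have finT : finite_set T by apply: finite_large_toric; rewrite ?divr_gt0.
have finA : finite_set A.
  apply: sub_finite_set finT => v [/coefS_neq0[k kv _] vmu].
  by split; [exists k|rewrite vmu; lra].
have [mu' /andP[mu'0 mu'mu] hmu'] : exists2 mu' : R, 0 < mu' < mu &
    forall v, coefS b a v != 0 -> monomial om v != mu -> monomial om v <= mu'.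
  have [mu' /andP[mu1 mu2] h] := gap_below (fset_set T) (monomial om) mu0.
  exists mu' => [|v av vmu]; first by rewrite mu2 andbT; lra.
  have vlt : monomial om v < mu by rewrite lt_neqAle vmu amu.
  have [vT|] := leP (mu / 2) (monomial om v); last lra.
  apply: h => //; apply/fset_setP => //.
  by have [k kv _] := coefS_neq0 av; split => //; exists k.
pose c1 v : C := if `[< A v >] then coefS b a v else 0.
have hE s : hassum (fun v => c1 v * monomial (curve z om s) v) (E * (mu ^+ s)%:C).
  have := @hassum_fin _ _ (fset_set A) (fun v => c1 v * monomial (curve z om s) v).
  have -> : E * (mu ^+ s)%:C = \sum_(v <- fset_set A) c1 v * monomial (curve z om s) v.
    rewrite /E fsbig_finite // mulr_suml; apply: eq_fbigr => v.
    move=> /(fset_setP _ finA) vA _; rewrite /c1 asboolT //.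
    by rewrite monomial_curve vA.2 mulrA.
  by apply=> v /(fset_setP _ finA) nA; rewrite /c1 asboolF ?mul0r.
have q0 : 0 <= mu' / mu by rewrite divr_ge0 // ltW.
have q1 : mu' / mu < 1 by rewrite ltr_pdivrMr // mul1r.
have [N hN] := geometric_small (M / mu' ^+ s0) q0 q1 e0.
exists (maxn N s0) => s; rewrite geq_max => /andP[/hN Ns s0s].
have h2 := hassumB (hsum s s0s) (hE s).
(* Nonleading terms at time [s] are at most [mu' ^+ (s - s0)] times their moduli at time [s0], where
   the family is bounded by [M]. *)
apply: (@le_trans _ _ (mu' ^+ (s - s0) * M)).
  apply: hassum_le h2; apply: (bnd_scale _ aM); first by rewrite exprn_ge0 // ltW.
  move=> v; rewrite /c1; case: asboolP => [vA|nA].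
    by rewrite subrr nc0 mulr_ge0 ?nc_ge0 // exprn_ge0 // ltW.
  rewrite mul0r subr0; have [->|av] := eqVneq (coefS b a v) 0.
    by rewrite !mul0r nc0 mulr0.
  have om_ge0 : 0 <= monomial om v by rewrite monomial_ge0 // => j; rewrite ltW.
  rewrite !monomial_curve -(subnK s0s) exprD rmorphM /= !ncM !nc_real ?exprn_ge0 //.
  rewrite subnK // [leLHS](_ : _ = monomial om v ^+ (s - s0) * (nc (coefS b a v) * (nc (monomial z v) * monomial om v ^+ s0))); last by ring.
  apply: ler_wpM2r; first by rewrite !mulr_ge0 ?nc_ge0 ?exprn_ge0.
  rewrite lerXn2r ?nnegrE ?(ltW mu'0) // hmu' //.
  by apply/negP => /eqP vmu; apply: nA.
rewrite [leLHS](_ : _ = M / mu' ^+ s0 * (mu' / mu) ^+ s * mu ^+ s).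
  by rewrite ler_wpM2r // exprn_ge0 // ltW.
rewrite expr_div_n (_ : mu' ^+ s = mu' ^+ (s - s0) * mu' ^+ s0); last by rewrite -exprD subnK.
by field; rewrite !expf_neq0 ?gt_eqF.
Qed.

Definition torus (z : 'rV[C]_n) : Prop := forall j, z 0 j != 0.

Lemma monomial_torus z v : torus z -> monomial z v != 0.
Proof. by move=> zT; apply/prodf_neq0 => j _; rewrite expf_neq0 // zT. Qed.

(** On the curve through [(1, ..., 1)] given by an injective weight there is a single dominant term,
    that of the [v] of least weight with nonzero coefficient; so a vanishing germ has no such [v].
    The curve stays in the torus. *)
Lemma coefS_eq0 f a : has_taylor f a ->
  (\forall z \near (0 : 'rV[C^o]_n), torus z -> f (par z) = 0) ->
  forall v, coefS b a v = 0.
Proof.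
move=> fa /near0P[d d0 f0] v; apply/eqP; apply: contrapT => /negP av.
have [p [p1 pI]] := injective_weight n.
have : exists m, `[< exists2 v, coefS b a v != 0 & nweight p v = m >].
  by exists (nweight p v); apply/asboolP; exists v.
move=> /ex_minnP[m /asboolP[v0 av0 v0m] mmin].
pose om : 'rV[R]_n := \row_j (p j)%:R^-1; pose z : 'rV[C]_n := const_mx 1.
have p0 j : (0 : R) < (p j)%:R by rewrite ltr0n ltnW.
have om0 j : 0 < om 0 j by rewrite mxE invr_gt0.
have om1 j : om 0 j < 1 by rewrite mxE invf_lt1 // ltr1n.
have omb1 i : monomial om (row i b) < 1.
  rewrite monomial_nweight invf_lt1 ?ltr0n ?nweight_gt0 // ltr1n.
  have [j bij] : exists j, (0 < b i j)%N.
    apply: contrapT => nex; move/negP: (b_neq0 i); apply; apply/eqP/rowP => j.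
    rewrite !mxE; apply/eqP; rewrite -leqn0 leqNgt; apply/negP => h; apply: nex.
    by exists j.
  rewrite /nweight (bigD1 j) //= (@leq_trans (p j ^ (row i b) ord0 j)%N) //.
    by rewrite mxE -(exp1n (b i j)) ltn_exp2r.
  by rewrite leq_pmulr // prodn_gt0 // => l; rewrite expn_gt0 ltnW.
pose mu := monomial om v0.
have mu0 : 0 < mu by rewrite monomial_gt0.
have amu w : coefS b a w != 0 -> monomial om w <= mu.
  move=> aw; rewrite /mu !monomial_nweight lef_pV2 ?posrE ?ltr0n ?nweight_gt0 // ler_nat v0m.
  by apply: mmin; apply/asboolP; exists w.
have e0 : 0 < nc (coefS b a v0) / 2.
  by rewrite divr_gt0 // lt_neqAle nc_ge0 andbT eq_sym nc_eq0.
have [N hN] := asymptotics z fa om0 omb1 mu0 amu e0.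
have [N' hN'] : exists N, forall s, (N <= s)%N -> forall j, 1 * om 0 j ^+ s <= d / 2.
  by apply: ex_uniform_bound => j; apply: geometric_small; rewrite ?divr_gt0 ?om1 // ltW.
have /hN := leq_maxl N N'; rewrite f0 => [||j]; last 2 first.
- move=> j; rewrite !mxE mul1r nc_real ?exprn_ge0 // ?invr_ge0 ?(ltW (p0 j)) //.
  have /hN'/(_ j) := leq_maxr N N'; rewrite mul1r mxE; lra.
- rewrite !mxE mul1r; apply/eqP => /complexI/eqP.
  by rewrite expf_eq0 invr_eq0 gt_eqF ?andbF.
have -> : [set w | coefS b a w != 0 /\ monomial om w = mu] = [set v0].
  apply/seteqP; split=> [w [aw]|w ->] //=.
  by rewrite /mu !monomial_nweight => /invr_inj/eqP; rewrite eqr_nat => /eqP/pI.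
rewrite fsbig_set1 sub0r ncN ncM nc_real ?exprn_ge0 ?(ltW mu0) //.
rewrite ler_pM2r ?exprn_gt0 // (_ : monomial z v0 = 1) ?mulr1; first lra.
by rewrite /monomial big1 // => j _; rewrite mxE expr1n.
Qed.

(** The form of density of the torus that allows identities of germs to be proved after division by
    monomials. *)
Lemma germ_eq_torus f g : analytic0 f -> analytic0 g ->
  (\forall z \near (0 : 'rV[C^o]_n), torus z -> f (par z) = g (par z)) -> germ_eq b f g.
Proof.
move=> [a fa] [a' ga] h; have fg := has_taylorB fa ga.
have : germ_eq b (fun x => f x - g x) (fun=> 0).
  apply: (germ_eq0_coefS fg); apply: (coefS_eq0 fg).
  by apply: filterS h => z hz /hz ->; rewrite subrr.
by apply: filterS => x hx /hx/eqP; rewrite subr_eq0 => /eqP.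
Qed.

Lemma germ_eq_par f g : germ_eq b f g ->
  \forall z \near (0 : 'rV[C^o]_n), f (par z) = g (par z).
Proof. by move=> /near_par; apply: filterS => z; apply; exact: par_toric. Qed.

Lemma germ_eq_coefS f g a a' : has_taylor f a -> has_taylor g a' -> germ_eq b f g ->
  coefS b a = coefS b a'.
Proof.
move=> fa ga fg; apply/funext => v; apply/eqP; rewrite -subr_eq0 -coefSB; apply/eqP.
apply: (coefS_eq0 (has_taylorB fa ga)).
by have := germ_eq_par fg; apply: filterS => z ->; rewrite subrr.
Qed.

Lemma coefS_germ_eq f g a a' : has_taylor f a -> has_taylor g a' ->
  coefS b a = coefS b a' -> germ_eq b f g.
Proof.
move=> fa ga aa'; have := germ_eq0_coefS (has_taylorB fa ga).
move=> /(_ _)/wrap[v|]; first by rewrite coefSB aa' subrr.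
by apply: filterS => x hx /hx/eqP; rewrite subr_eq0 => /eqP.
Qed.

End Toric.

(** * Division of power series *)

Section Dickson.
Variable m : nat.
Implicit Types (k l : 'rV[nat]_m) (A : set 'rV[nat]_m).

Definition lek l k : bool := [forall i, (l ord0 i <= k ord0 i)%N].

Definition subk k l : 'rV[nat]_m := \row_i (k ord0 i - l ord0 i)%N.

Lemma subkK l k : lek l k -> l + subk k l = k.
Proof. by move=> /forallP lk; apply/rowP => i; rewrite !mxE; exact: (subnKC (lk i)). Qed.

Lemma addkK l k : subk (l + k) l = k.
Proof. by apply/rowP => i; rewrite !mxE; exact: addKn. Qed.

Lemma lek_addr l k : lek l (l + k).
Proof. by apply/forallP => i; rewrite mxE; exact: leq_addr. Qed.

Lemma lek0 k : lek 0 k.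
Proof. by apply/forallP => i; rewrite mxE. Qed.

Lemma addkI l : injective (fun k => l + k).
Proof. by move=> k k' /(congr1 (subk^~ l)); rewrite !addkK. Qed.

(** Induction on the number [j] of coordinates compared. Elements whose next coordinate is at least
    the maximum [N] over a list for [j] are handled by that list; each of the finitely many smaller
    values [t] gets a list [f t] of its own. *)
Lemma dickson A : exists s : seq 'rV[nat]_m,
  (forall l, l \in s -> A l) /\ forall k, A k -> exists2 l, l \in s & lek l k.
Proof.
have H j : forall A, exists s : seq 'rV[nat]_m, (forall l, l \in s -> A l) /\
    forall k, A k -> exists2 l, l \in s & forall i : 'I_m, (i < j)%N -> (l ord0 i <= k ord0 i)%N.
  elim: j => [|j IH] B.
    have [[l Bl]|nB] := pselect (exists l, B l).
      exists [:: l]; split=> [k|k _]; first by rewrite inE => /eqP ->.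
      by exists l => //; rewrite inE.
    by exists [::]; split=> // k Bk; case: nB; exists k.
  have [jm|mj] := ltnP j m; last first.
    have [s [sB hs]] := IH B; exists s; split=> // k /hs[l ls hl].
    by exists l => // i _; apply: hl; exact: leq_trans (ltn_ord i) mj.
  pose jo := Ordinal jm.
  have [s0 [s0B hs0]] := IH B.
  pose N := \max_(l <- s0) l ord0 jo.
  have /choice[f hf] : forall t, exists s : seq 'rV[nat]_m,
      (forall l, l \in s -> (B l /\ l ord0 jo = t)) /\
      forall k, B k /\ k ord0 jo = t ->
      exists2 l, l \in s & forall i : 'I_m, (i < j)%N -> (l ord0 i <= k ord0 i)%N.
    by move=> t; exact: (IH [set l | B l /\ l ord0 jo = t]).
  exists (s0 ++ flatten [seq f t | t <- iota 0 N]); split=> [l|k Bk].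
    rewrite mem_cat => /orP[/s0B//|/flatten_mapP[t _ lt]].
    by have [/(_ l lt)[]] := hf t.
  have [kN|Nk] := ltnP (k ord0 jo) N.
    have [fs /(_ k (conj Bk erefl))[l lf hl]] := hf (k ord0 jo).
    exists l.
      rewrite mem_cat; apply/orP; right; apply/flatten_mapP.
      by exists (k ord0 jo); rewrite // mem_iota.
    move=> i; rewrite ltnS leq_eqVlt => /orP[/eqP ij|/hl//].
    have -> : i = jo by exact: val_inj.
    by have [_ ->] := fs l lf.
  have [l ls hl] := hs0 k Bk; exists l; first by rewrite mem_cat ls.
  move=> i; rewrite ltnS leq_eqVlt => /orP[/eqP ij|/hl//].
  have -> : i = jo by exact: val_inj.
  by apply: leq_trans Nk; exact: (leq_bigmax_seq _ ls).
have [s [sA hs]] := H m A; exists s; split=> // k /hs[l ls hl].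
by exists l => //; apply/forallP => i; exact: hl.
Qed.

End Dickson.

Section Division.
Variables (R : realType) (r : nat).
Local Notation C := R[i].
Local Notation K := 'rV[nat]_r.
Implicit Types (a g : K -> C) (W : K -> R).

Lemma bnd_inj (L M : choiceType) (h : L -> M) (a : M -> C) B :
  injective h -> bnd a B -> bnd (fun k => a (h k)) B.
Proof.
move=> hI aB F; apply: le_trans (aB [fset h k | k in F]%fset).
by rewrite big_imfset //= => x y _ _ /hI.
Qed.

Definition mshift (e : K) (q : K -> C) : K -> C :=
  fun k => if lek e k then q (subk k e) else 0.

Lemma conv_delta e q : conv (fun k => (k == e)%:R) q = mshift e q.
Proof.
apply/funext => k; rewrite /conv /fsum /mshift; case: ifP => [ek|nek].
  rewrite -(fsbig_widen [set (e, subk k e)]) ?fsbig_set1 /=; first by rewrite eqxx mul1r.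
    by move=> p /= ->; exact: subkK.
  move=> [k1 k2] /= [kk ne]; have [k1e|] := eqVneq k1 e; last by rewrite mul0r.
  by case: ne; rewrite -kk k1e addkK.
rewrite fsbig1 // => -[k1 k2] /= kk; have [k1e|] := eqVneq k1 e; last by rewrite mul0r.
by move: nek; rewrite -kk k1e lek_addr.
Qed.

Lemma convDl a a' g k : conv (fun l => a l + a' l) g k = conv a g k + conv a' g k.
Proof.
rewrite /conv /fsum !fsbig_finite; [|exact: finite_addition..].
by rewrite -big_split; apply: eq_bigr => p _; rewrite mulrDl.
Qed.

Lemma has_taylor_sum (I : finType) (F : I -> 'rV[C]_r -> C) (c : I -> K -> C) :
  (forall i, has_taylor (F i) (c i)) ->
  has_taylor (fun x => \sum_i F i x) (fun k => \sum_i c i k).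
Proof.
move=> h; elim: (index_enum I) => [|i s IH].
  have := has_taylorZ 0 (has_taylor_monomial R (0 : K)).
  under eq_fun do rewrite mul0r; under [X in has_taylor _ X]eq_fun do rewrite mul0r.
  rewrite (_ : (fun x => \sum_(i <- [::]) F i x) = fun=> 0).
    rewrite (_ : (fun k => \sum_(i <- [::]) c i k) = fun=> 0) //.
    by apply/funext => k; rewrite big_nil.
  by apply/funext => x; rewrite big_nil.
rewrite (_ : (fun x => _) = (fun x => F i x + \sum_(j <- s) F j x)); last first.
  by apply/funext => x; rewrite big_cons.
rewrite (_ : (fun k => _) = (fun k => c i k + \sum_(j <- s) c j k)); last first.
  by apply/funext => x; rewrite big_cons.
exact: has_taylorD (h i) IH.
Qed.

Section MonomialDivision.
Variables (m : nat) (e : 'I_m -> K).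

(** Choosing one divisor per exponent makes the quotients and the remainder disjoint pieces of [g]:
    there is no cancellation, and norm bounds come for free. *)
Definition divisor k : option 'I_m := [pick i | lek (e i) k].

Definition mquo g i : K -> C := fun k => if divisor (e i + k) == Some i then g (e i + k) else 0.

Definition mrem g : K -> C := fun k => if divisor k is None then g k else 0.

Lemma mrem_neq0 g k i : mrem g k != 0 -> ~~ lek (e i) k.
Proof. by rewrite /mrem /divisor; case: pickP => [j _|-> //]; rewrite eqxx. Qed.

Lemma mdivE g k : g k = \sum_(i < m) mshift (e i) (mquo g i) k + mrem g k.
Proof.
rewrite (eq_bigr (fun i => if divisor k == Some i then g k else 0)) => [|i _]; last first.
  rewrite /mshift; case: ifP => [ek|]; first by rewrite /mquo subkK.
  by rewrite /divisor; case: pickP => // j ej; case: eqP => // -[<-]; rewrite ej.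
rewrite /mrem; case: (divisor k) => [j|]; last by rewrite big1 ?add0r.
rewrite (bigD1 j) //= eqxx big1 ?addr0 // => i ij.
by case: eqP => // -[ji]; move: ij; rewrite ji eqxx.
Qed.

Lemma mquo_bnd W g M i : (forall k, 0 < W k) -> (forall k l, W (k + l) = W k * W l) ->
  bnd (fun k => g k * (W k)%:C) M -> bnd (fun k => mquo g i k * (W k)%:C) ((W (e i))^-1 * M).
Proof.
move=> W0 WD gM; apply: (bnd_scale _ (bnd_inj (@addkI _ (e i)) gM)) => [|k].
  by rewrite invr_ge0 ltW.
rewrite /mquo; case: ifP => _; last by rewrite mul0r nc0 !mulr_ge0 ?nc_ge0 ?invr_ge0 // ltW.
rewrite !ncM !nc_real ?(ltW (W0 _)) // WD.
rewrite [leRHS](_ : _ = nc (g (e i + k)) * W k) //; field.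
by rewrite gt_eqF.
Qed.

Lemma mrem_bnd W g M :
  bnd (fun k => g k * (W k)%:C) M -> bnd (fun k => mrem g k * (W k)%:C) M.
Proof.
apply: bnd_le => k; rewrite /mrem; case: divisor => [j|//].
by rewrite mul0r nc0 nc_ge0.
Qed.

End MonomialDivision.

Lemma monomial_division (m : nat) (e : 'I_m -> K) f a : has_taylor f a ->
  exists (q : 'I_m -> 'rV[C]_r -> C) rm, [/\ forall i, has_taylor (q i) (mquo e a i),
    has_taylor rm (mrem e a) &
    \forall x \near (0 : 'rV[C^o]_r), f x = \sum_(i < m) monomial x (e i) * q i x + rm x].
Proof.
move=> fa; have [rho rho0 [[M aM] _]] := has_taylor_radius fa.
pose W : K -> R := monomial (const_mx rho).
have rho_gt0 i : (0 : R) < (const_mx rho : 'rV_r) 0 i by rewrite mxE.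
have W0 k : 0 < W k by exact: monomial_gt0.
have WD k l : W (k + l) = W k * W l by exact: monomialD.
have /choice[q hq] i : exists q, has_taylor q (mquo e a i).
  by apply: (poly_radius_taylor rho_gt0); eexists; exact: mquo_bnd aM.
have [rm hrm] : exists q, has_taylor q (mrem e a).
  by apply: (poly_radius_taylor rho_gt0); eexists; exact: mrem_bnd aM.
exists q, rm; split=> //; apply: has_taylor_unique_fun fa _.
rewrite [a](_ : _ = fun k => \sum_(i < m) conv (fun k => (k == e i)%:R) (mquo e a i) k + mrem e a k).
  apply: has_taylorD hrm; apply: has_taylor_sum => i.
  exact: has_taylorM (has_taylor_monomial R (e i)) (hq i).
apply/funext => k; rewrite {1}(mdivE e a k); congr (_ + _).
by apply: eq_bigr => i _; rewrite conv_delta.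
Qed.

Section LeadingTerms.
Variables (p : 'I_r -> nat) (p1 : forall i, (1 < p i)%N) (pI : injective (nweight p)).
Variables (m : nat) (e : 'I_m -> K) (u : 'I_m -> K -> C).
Hypothesis u_lead : forall i, u i (e i) = 1.
Hypothesis u_tail : forall i k, u i k != 0 -> k != e i -> (nweight p (e i) < nweight p k)%N.

Definition utail i k : C := u i k - (k == e i)%:R.

Lemma utail_neq0 i k : utail i k != 0 -> (nweight p (e i) < nweight p k)%N /\ utail i k = u i k.
Proof.
rewrite /utail; have [->|ke] := eqVneq k (e i); first by rewrite u_lead subrr eqxx.
by rewrite subr0 => uk; split=> //; exact: u_tail.
Qed.

(** At a fixed point [g], the series [a] is [g] plus the tails times the quotients of [g]. Monomial
    division of [g] supplies the leading monomials times the same quotients, and both together form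
    the products with the [u i]. *)
Definition dstep a g : K -> C := fun k => a k - \sum_(i < m) conv (utail i) (mquo e g i) k.

(** Multiplication by a tail strictly raises the weight. *)
Lemma dstep_local a g g' k :
  (forall l, (nweight p l < nweight p k)%N -> g l = g' l) -> dstep a g k = dstep a g' k.
Proof.
move=> gg'; rewrite /dstep; congr (_ - _); apply: eq_bigr => i _.
rewrite /conv /fsum; apply: eq_fsbigr => -[k1 k2] /set_mem /= kk.
have [->|t0] := eqVneq (utail i k1) 0; first by rewrite !mul0r.
congr (_ * _); rewrite /mquo; case: ifP => // _; apply: gg'.
rewrite -kk !nweightD ltn_mul2r nweight_gt0 //=.
by have [] := utail_neq0 t0.
Qed.

Definition dapprox a N := iter N (dstep a) a.

(** Weights are positive integers and each step settles one more value, so the coefficient at [k] is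
    final after [nweight p k] iterations. *)
Lemma dapprox_stable a N N' k : (nweight p k <= N)%N -> (N <= N')%N ->
  dapprox a N' k = dapprox a N k.
Proof.
have H M l : (nweight p l <= M)%N -> dapprox a M.+1 l = dapprox a M l.
  elim: M l => [|M IH] l lM; first by have := leq_trans (nweight_gt0 l p1) lM.
  change (dstep a (dapprox a M.+1) l = dstep a (dapprox a M) l); apply: dstep_local => l' l'l.
  by apply: IH; rewrite -ltnS; exact: leq_trans l'l lM.
move=> kN /subnKC <-; elim: (N' - N)%N => [|d IH]; first by rewrite addn0.
by rewrite addnS H // (leq_trans kN) // leq_addr.
Qed.

Definition dlimit a k := dapprox a (nweight p k) k.

Lemma limitE a k : dlimit a k = dstep a (dlimit a) k.
Proof.
rewrite /dlimit -(@dapprox_stable _ _ (nweight p k).+1) //.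
change (dstep a (dapprox a (nweight p k)) k = dstep a (dlimit a) k); apply: dstep_local => l lk.
by rewrite (@dapprox_stable _ (nweight p l)) // ltnW.
Qed.

(** A step preserves the bound: [M + m * eps * (2 * M) <= 2 * M] since [m * eps <= 1 / 2]. Finitely
    many coefficients of the limit all occur in one iterate, so the bound passes to the limit. *)
Lemma dlimit_bnd W a M (eps : R) : (forall k, 0 < W k) -> (forall k l, W (k + l) = W k * W l) ->
  0 <= eps -> eps *+ m <= 1 / 2 ->
  (forall i, bnd (fun k => utail i k * (W k)%:C) (eps * W (e i))) ->
  bnd (fun k => a k * (W k)%:C) M -> bnd (fun k => dlimit a k * (W k)%:C) (2 * M).
Proof.
move=> W0 WD eps0 epsm tb aM; have M0 := bnd_ge0 aM.
have WDC k l : (W (k + l))%:C = (W k)%:C * (W l)%:C by rewrite WD rmorphM.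
have H N : bnd (fun k => dapprox a N k * (W k)%:C) (2 * M).
  elim: N => [|N IH].
    by move=> F; apply: le_trans (aM F) _; lra.
  have tb' i : bnd (fun k => conv (utail i) (mquo e (dapprox a N) i) k * (W k)%:C) (eps * (2 * M)).
    have := conv_bnd WDC (tb i) (mquo_bnd e i W0 WD IH).
    by rewrite [X in bnd _ X -> _](_ : _ = eps * (2 * M)) //; field; rewrite gt_eqF.
  pose S k : C := \sum_(i < m) conv (utail i) (mquo e (dapprox a N) i) k * (W k)%:C.
  have Sb : bnd (fun k => - S k) (\sum_(i < m) eps * (2 * M)).
    by apply: bnd_le (bnd_sum (index_enum 'I_m) tb') => k; rewrite ncN.
  move=> F; apply: (@le_trans _ _ (M + \sum_(i < m) eps * (2 * M))); last first.
    by rewrite sumr_const card_ord -mulrnAl; nra.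
  apply: le_trans (bndD aM Sb F); apply: ler_sum => k _.
  change (nc (dstep a (dapprox a N) k * (W k)%:C) <= nc (a k * (W k)%:C - S k)).
  by rewrite /dstep mulrBl mulr_suml.
move=> F; pose N := \max_(k <- F) nweight p k.
apply: le_trans (H N F); rewrite big_seq [leRHS]big_seq; apply: ler_sum => k kF.
by rewrite (@dapprox_stable a (nweight p k) N) //; exact: (leq_bigmax_seq _ kF).
Qed.

Lemma utail_nc i k : nc (utail i k) <= nc (u i k).
Proof.
have [->|/utail_neq0[_ ->]//] := eqVneq (utail i k) 0.
by rewrite nc0 nc_ge0.
Qed.

Lemma dlimit_conv a k :
  a k = \sum_(i < m) conv (u i) (mquo e (dlimit a) i) k + mrem e (dlimit a) k.
Proof.
have : dlimit a k = a k - \sum_(i < m) conv (utail i) (mquo e (dlimit a) i) k := limitE a k.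
move=> /eqP; rewrite eq_sym subr_eq => /eqP ->; rewrite {1}(mdivE e (dlimit a) k).
rewrite addrAC -big_split /=; congr (_ + _); apply: eq_bigr => i _.
rewrite -conv_delta -convDl (_ : (fun l => _) = u i) //.
by apply/funext => l; rewrite /utail addrC subrK.
Qed.

End LeadingTerms.

Section PrimeRadius.
Variables (p : 'I_r -> nat) (p1 : forall i, (1 < p i)%N).

(** The radii [p_i ^ (-s)], at which [x^k] has norm [nweight p k ^ (-s)]: as [s] grows, terms of
    smaller weight dominate. *)
Definition prho s : 'rV[R]_r := \row_i ((\row_j ((p j)%:R^-1 : R)) 0 i ^+ s).

Lemma monomial_prho s k : monomial (prho s) k = (nweight p k)%:R^-1 ^+ s.
Proof. by rewrite monomial_exp monomial_nweight. Qed.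

Lemma prho_gt0 s i : 0 < prho s 0 i.
Proof. by rewrite !mxE exprn_gt0 // invr_gt0 ltr0n ltnW. Qed.

Lemma prho_small (rho : R) : 0 < rho ->
  exists S, forall s, (S <= s)%N -> forall i, prho s 0 i <= rho.
Proof.
move=> rho0; apply: ex_uniform_bound => i.
have [||S hS] := @geometric_small R (p i)%:R^-1 1 rho _ _ rho0.
- by rewrite invr_ge0.
- by rewrite invf_lt1 ?ltr0n ?(ltnW (p1 i)) // ltr1n.
by exists S => s /hS; rewrite !mxE mul1r.
Qed.

Lemma poly_radius_prho rho a s : (forall i, prho s 0 i <= rho) ->
  poly_radius (const_mx rho) a -> poly_radius (prho s) a.
Proof.
by move=> h; apply: poly_radius_le => i; rewrite ltW ?prho_gt0 //= [leRHS]mxE.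
Qed.

(** Weights are integers, so the exponents of the tail have weight at least [P + 1] against [P] for
    the leading one; relative to the latter the tail shrinks like [(P / (P + 1)) ^+ s]. *)
Lemma tail_small (v : K -> C) (e0 : K) (rho eps : R) : 0 < rho -> 0 < eps ->
  poly_radius (const_mx rho) v -> (forall k, v k != 0 -> (nweight p e0 < nweight p k)%N) ->
  exists S, forall s, (S <= s)%N ->
    bnd (fun k => v k * (monomial (prho s) k)%:C) (eps * monomial (prho s) e0).
Proof.
move=> rho0 eps0 vr vtail; have [s0 /(_ _ (leqnn _)) hs0] := prho_small rho0.
have [M vM] := poly_radius_prho hs0 vr.
pose P : R := (nweight p e0)%:R; have P0 : 0 < P by rewrite ltr0n nweight_gt0.
have [||S hS] := @geometric_small R (P / (P + 1)) (M * (P + 1) ^+ s0) eps _ _ eps0.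
- by rewrite divr_ge0 //; lra.
- by rewrite ltr_pdivrMr; lra.
exists (maxn S s0) => s; rewrite geq_max => /andP[/hS sS s0s].
have P1 : 0 < P + 1 by lra.
apply: (@bnd_le _ _ (fun k => ((P + 1)^-1 ^+ (s - s0))%:C * (v k * (monomial (prho s0) k)%:C))).
  move=> k; have [->|vk] := eqVneq (v k) 0; first by rewrite !mul0r mulr0.
  have Pk : P + 1 <= (nweight p k)%:R by rewrite /P natr1 ler_nat vtail.
  rewrite !monomial_prho !ncM !nc_real ?exprn_ge0 ?invr_ge0 ?(ltW P1) //.
  rewrite [_ ^+ s](_ : _ = (nweight p k)%:R^-1 ^+ (s - s0) * (nweight p k)%:R^-1 ^+ s0); last first.
    by rewrite -exprD subnK.
  rewrite mulrCA ler_wpM2r ?mulr_ge0 ?nc_ge0 ?exprn_ge0 ?invr_ge0 // lerXn2r ?nnegrE ?invr_ge0 ?(ltW P1) //.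
  by rewrite lef_pV2 ?posrE // (lt_le_trans P1).
move=> F; apply: (@le_trans _ _ ((P + 1)^-1 ^+ (s - s0) * M)).
  rewrite (eq_bigr (fun k => (P + 1)^-1 ^+ (s - s0) * nc (v k * (monomial (prho s0) k)%:C))).
    by rewrite -mulr_sumr ler_wpM2l ?exprn_ge0 ?invr_ge0 ?(ltW P1).
  by move=> k _; rewrite ncM nc_real // exprn_ge0 // invr_ge0 ltW.
rewrite monomial_prho -/P.
rewrite [leLHS](_ : _ = M * (P + 1) ^+ s0 * (P / (P + 1)) ^+ s * P^-1 ^+ s).
  by rewrite ler_wpM2r // exprn_ge0 // invr_ge0 ltW.
rewrite -mulrA -exprMn [_ * P^-1](_ : _ = (P + 1)^-1); last first.
  by field; rewrite !gt_eqF.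
rewrite [(P + 1)^-1 ^+ s](_ : _ = (P + 1)^-1 ^+ (s - s0) * (P + 1)^-1 ^+ s0); last first.
  by rewrite -exprD subnK.
by rewrite mulrCA -(mulrA M) -exprMn mulfV ?gt_eqF // expr1n mulr1.
Qed.

End PrimeRadius.

(* Grauert-Hironaka division, with leading terms for the injective weight p^k. *)
Lemma division (p : 'I_r -> nat) (m : nat) (e : 'I_m -> K) (u : 'I_m -> K -> C)
    (g : 'I_m -> 'rV[C]_r -> C) f a :
  (forall i, (1 < p i)%N) -> (forall i, has_taylor (g i) (u i)) -> (forall i, u i (e i) = 1) ->
  (forall i k, u i k != 0 -> k != e i -> (nweight p (e i) < nweight p k)%N) ->
  has_taylor f a ->
  exists (q : 'I_m -> 'rV[C]_r -> C) rm ra,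
    [/\ forall i, analytic0 (q i), has_taylor rm ra,
      forall k i, ra k != 0 -> ~~ lek (e i) k &
      \forall x \near (0 : 'rV[C^o]_r), f x = \sum_(i < m) q i x * g i x + rm x].
Proof.
move=> p1 gu u_lead u_tail fa.
(* The successor keeps [eps] positive when there are no divisors. *)
pose eps : R := (2 * m.+1%:R)^-1.
have m0 : (0 : R) < m.+1%:R by rewrite ltr0n.
have eps0 : 0 < eps by rewrite invr_gt0 mulr_gt0.
have epsm : eps *+ m <= 1 / 2.
  rewrite /eps invfM -mulrnAr div1r ler_piMr ?invr_ge0 // -mulr_natl.
  by rewrite ler_pdivrMr // mul1r ler_nat.
have [S1 hS1] : exists S, forall s, (S <= s)%N -> forall i,
    bnd (fun k => utail e u i k * (monomial (prho p s) k)%:C) (eps * monomial (prho p s) (e i)).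
  apply: ex_uniform_bound => i; have [rho rho0 [ur _]] := has_taylor_radius (gu i).
  apply: (tail_small p1 rho0 eps0) => [|k].
    have [M uM] := ur; exists M; apply: bnd_le uM => k.
    by rewrite !ncM ler_wpM2r ?nc_ge0 // (utail_nc u_lead u_tail).
  by move=> /(utail_neq0 u_lead u_tail)[].
have [rho rho0 [ar _]] := has_taylor_radius fa.
have [S2 hS2] := prho_small p1 rho0.
pose s := maxn S1 S2.
have [M aM] := poly_radius_prho p1 (hS2 s (leq_maxr _ _)) ar.
pose W : K -> R := monomial (prho p s).
have W0 k : 0 < W k by apply: monomial_gt0 => i; exact: prho_gt0.
have WD k l : W (k + l) = W k * W l by exact: monomialD.
have lb := dlimit_bnd p1 u_lead u_tail W0 WD (ltW eps0) epsm (hS1 s (leq_maxl _ _)) aM.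
have /choice[q hq] i : exists q, has_taylor q (mquo e (dlimit p e u a) i).
  by apply: (poly_radius_taylor (prho_gt0 p1 s)); eexists; exact: (mquo_bnd e i W0 WD lb).
have [rm hrm] : exists q, has_taylor q (mrem e (dlimit p e u a)).
  by apply: (poly_radius_taylor (prho_gt0 p1 s)); eexists; exact: (mrem_bnd e lb).
exists q, rm, (mrem e (dlimit p e u a)); split=> [i|//|k i|].
- by eexists; exact: hq.
- exact: mrem_neq0.
apply: has_taylor_unique_fun fa _.
rewrite [a](_ : _ = fun k => \sum_(i < m) conv (u i) (mquo e (dlimit p e u a) i) k + mrem e (dlimit p e u a) k).
  apply: has_taylorD hrm; rewrite (_ : (fun x => _) = fun x => \sum_(i < m) g i x * q i x).
    by apply: has_taylor_sum => i; exact: has_taylorM.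
  by apply/funext => x; apply: eq_bigr => i _; rewrite mulrC.
apply/funext => k; exact: dlimit_conv.
Qed.

End Division.

(** * Ideals *)

Section Ideals.
Variables (R : realType) (r n : nat) (b : 'M[nat]_(r, n)).
Hypothesis b_neq0 : forall i, row i b != 0.
Local Notation C := R[i].
Local Notation Cr := 'rV[R[i]]_r.
Local Notation K := 'rV[nat]_r.
Implicit Types (f g h : Cr -> C) (I J G : set (Cr -> C)) (a : K -> C) (v : 'rV[nat]_n).

Lemma germ_eqT f g : (\forall x \near (0 : 'rV[C^o]_r), f x = g x) -> germ_eq b f g.
Proof. by apply: filterS. Qed.

Lemma germ_eq_refl f : germ_eq b f f.
Proof. exact: filterE. Qed.

Lemma germ_eq_sym f g : germ_eq b f g -> germ_eq b g f.
Proof. by apply: filterS => x h /h ->. Qed.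

Lemma germ_eq_trans f g h : germ_eq b f g -> germ_eq b g h -> germ_eq b f h.
Proof. by move=> fg gh; near=> x => xX; rewrite (near fg x) // (near gh x).
Unshelve. all: by end_near. Qed.

Lemma germ_eqD f f' g g' : germ_eq b f f' -> germ_eq b g g' ->
  germ_eq b (fun x => f x + g x) (fun x => f' x + g' x).
Proof. by move=> ff gg; near=> x => xX; rewrite (near ff x) // (near gg x).
Unshelve. all: by end_near. Qed.

Lemma germ_eqM f f' g g' : germ_eq b f f' -> germ_eq b g g' ->
  germ_eq b (fun x => f x * g x) (fun x => f' x * g' x).
Proof. by move=> ff gg; near=> x => xX; rewrite (near ff x) // (near gg x).
Unshelve. all: by end_near. Qed.

Local Opaque germ_eq has_taylor taylor.

Lemma ideal_analytic I f : is_ideal b I -> I f -> analytic0 f.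
Proof. by case=> h _ _ _ _ /h. Qed.

Lemma ideal_germ I f g : is_ideal b I -> analytic0 g -> germ_eq b f g -> I f -> I g.
Proof. by case=> _ h _ _ _; exact: h. Qed.

Lemma ideal0 I : is_ideal b I -> I (fun=> 0).
Proof. by case. Qed.

Lemma idealD I f g : is_ideal b I -> I f -> I g -> I (fun x => f x + g x).
Proof. by case=> _ _ _ h _; exact: h. Qed.

Lemma idealM I f g : is_ideal b I -> analytic0 f -> I g -> I (fun x => f x * g x).
Proof. by case=> _ _ _ _ h; exact: h. Qed.

Lemma ideal_sum I (T : Type) (s : seq T) (F : T -> Cr -> C) : is_ideal b I ->
  (forall i, I (F i)) -> I (fun x => \sum_(i <- s) F i x).
Proof.
move=> II IF; elim: s => [|i s IH].
  by rewrite (_ : (fun x => _) = fun=> 0) ?funeqE; [exact: (ideal0 II)|move=> x; rewrite big_nil].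
rewrite (_ : (fun x => _) = (fun x => F i x + \sum_(j <- s) F j x)).
  exact: (idealD II (IF i) IH).
by apply/funext => x; rewrite big_cons.
Qed.

Lemma all_analytic_ideal : is_ideal b (@analytic0 R r).
Proof.
split.
- exact: subset_refl.
- by move=> f g ga _ _; exact: ga.
- exact: (analytic_cst _ 0).
- by move=> f g; exact: analyticD.
- by move=> f g; exact: analyticM.
Qed.

Lemma sub_ideal_gen G : G `<=` ideal_gen b G.
Proof. by move=> f Gf J [_]; exact. Qed.

Lemma ideal_gen_sub G J : is_ideal b J -> G `<=` J -> ideal_gen b G `<=` J.
Proof. by move=> JI GJ f; apply. Qed.

Lemma ideal_gen_ideal G : G `<=` @analytic0 R r -> is_ideal b (ideal_gen b G).
Proof.
move=> Ga; split.
- exact: ideal_gen_sub all_analytic_ideal Ga.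
- by move=> f g ga fg h J JG; exact: (ideal_germ JG.1 ga fg (h J JG)).
- by move=> J JG; exact: (ideal0 JG.1).
- by move=> f g hf hg J JG; exact: (idealD JG.1 (hf J JG) (hg J JG)).
- by move=> f g fa hg J JG; exact: (idealM JG.1 fa (hg J JG)).
Qed.

(** Membership of products can thus be checked on generators, one factor at a time. *)
Lemma colon_ideal J g : is_ideal b J -> analytic0 g ->
  is_ideal b [set f | analytic0 f /\ J (fun x => f x * g x)].
Proof.
move=> JI ga; split.
- by move=> f [].
- move=> f f' fa' ff' [fa Jf]; split; first exact: fa'.
  exact: (ideal_germ JI (analyticM fa' ga) (germ_eqM ff' (germ_eq_refl g)) Jf).
- split; first exact: (analytic_cst _ 0).
  rewrite (_ : (fun x => _) = fun=> 0); first exact: (ideal0 JI).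
  by apply/funext => x; rewrite mul0r.
- move=> f f' [fa Jf] [fa' Jf']; split; first exact: (analyticD fa fa').
  rewrite (_ : (fun x => _) = (fun x => f x * g x + f' x * g x)).
    exact: (idealD JI Jf Jf').
  by apply/funext => x; rewrite mulrDl.
- move=> f f' fa [fa' Jf']; split; first exact: (analyticM fa fa').
  rewrite (_ : (fun x => _) = (fun x => f x * (f' x * g x))).
    exact: (idealM JI fa Jf').
  by apply/funext => x; rewrite mulrA.
Qed.

Lemma ideal_pow_gen_analytic I m : is_ideal b I ->
  [set h | exists2 u : 'I_m -> Cr -> C,
    forall j, I (u j) & h = fun x => \prod_(j < m) u j x] `<=` @analytic0 R r.
Proof.
by move=> II h [u Iu ->]; apply: analytic_prod => j; exact: (ideal_analytic II (Iu j)).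
Qed.

Lemma ideal_pow_ideal I m : is_ideal b I -> is_ideal b (ideal_pow b I m).
Proof. by move=> II; apply: ideal_gen_ideal; exact: ideal_pow_gen_analytic. Qed.

Lemma ideal_pow_prod I m (u : 'I_m -> Cr -> C) : (forall j, I (u j)) ->
  ideal_pow b I m (fun x => \prod_(j < m) u j x).
Proof. by move=> Iu; apply: sub_ideal_gen; exists u. Qed.

Lemma ideal_pow1 I f : I f -> ideal_pow b I 1 f.
Proof.
move=> If; have := @ideal_pow_prod I 1 (fun=> f) (fun=> If).
by rewrite (_ : (fun x => _) = f) //; apply/funext => x; rewrite big_ord1.
Qed.

Lemma ideal_pow0 I f : is_ideal b I -> analytic0 f -> ideal_pow b I 0 f.
Proof.
move=> II fa; have h1 : ideal_pow b I 0 (fun=> 1).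
  have := @ideal_pow_prod I 0 (fun=> f); rewrite (_ : (fun x => _) = fun=> 1).
    by apply; case.
  by apply/funext => x; rewrite big_ord0.
rewrite (_ : f = fun x => f x * 1); first exact: (idealM (ideal_pow_ideal 0 II) fa h1).
by apply/funext => x; rewrite mulr1.
Qed.

Lemma ideal_powM I i j f g : is_ideal b I -> ideal_pow b I i f -> ideal_pow b I j g ->
  ideal_pow b I (i + j) (fun x => f x * g x).
Proof.
move=> II If Ig; have IIij := ideal_pow_ideal (i + j) II.
have fa := ideal_analytic (ideal_pow_ideal i II) If.
have ga := ideal_analytic (ideal_pow_ideal j II) Ig.
suff Hf : [set f | analytic0 f /\ ideal_pow b I (i + j) (fun x => f x * g x)] f.
  exact: Hf.2.
apply: (ideal_gen_sub (colon_ideal IIij ga) _ If) => _ [u Iu ->].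
pose pu x := \prod_(k < i) u k x.
have pua : analytic0 pu by apply: (ideal_pow_gen_analytic II); exists u.
split; first exact: pua.
rewrite (_ : (fun x => _) = fun x => g x * pu x); last first.
  by apply/funext => x; rewrite mulrC.
suff Hg : [set f | analytic0 f /\ ideal_pow b I (i + j) (fun x => f x * pu x)] g.
  exact: Hg.2.
apply: (ideal_gen_sub (colon_ideal IIij pua) _ Ig) => _ [w Iw ->].
split; first by apply: (ideal_pow_gen_analytic II); exists w.
pose uw (k : 'I_(i + j)) := match fintype.split k with inl k1 => u k1 | inr k2 => w k2 end.
rewrite (_ : (fun x => _) = fun x => \prod_(k < i + j) uw k x).
  by apply: ideal_pow_prod => k; rewrite /uw; case: fintype.split.
apply/funext => x; rewrite big_split_ord /= mulrC; congr (_ * _).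
  by apply: eq_bigr => k _; rewrite /uw (unsplitK (inl _ k)).
by apply: eq_bigr => k _; rewrite /uw (unsplitK (inr _ k)).
Qed.

(** By Dickson's lemma finitely many elements of [I] have leading exponents below all those of [I].
    The remainder of a division by them lies in [I]; were it nonzero, its leading exponent would be
    above one of theirs, which remainders exclude. *)
Lemma noetherian I : is_ideal b I -> exists m (g : 'I_m -> Cr -> C),
  (forall i, I (g i)) /\ forall f, I f -> exists q : 'I_m -> Cr -> C,
    (forall i, analytic0 (q i)) /\ germ_eq b f (fun x => \sum_(i < m) q i x * g i x).
Proof.
move=> II; have [p [p1 pI]] := injective_weight r.
pose lead (f : Cr -> C) a e := [/\ I f, has_taylor f a, a e = 1 &
  forall k, a k != 0 -> k != e -> (nweight p e < nweight p k)%N].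
have [s [sA hs]] := dickson [set e | exists f a, lead f a e].
pose e (i : 'I_(size s)) := nth 0 s i.
have /choice[ga hga] (i : 'I_(size s)) : exists ga, lead ga.1 ga.2 (e i).
  by have [f [a fa]] := sA (e i) (mem_nth 0 (ltn_ord i)); exists (f, a).
exists (size s), (fun i => (ga i).1); split=> [i|f If]; first by case: (hga i).
have [a fa] := ideal_analytic II If.
have [q [rm [ra [qa rmra ra0 fE]]]] := @division _ _ p _ e (fun i => (ga i).2) (fun i => (ga i).1)
  f a p1 (fun i => let: And4 _ h _ _ := hga i in h) (fun i => let: And4 _ _ h _ := hga i in h)
  (fun i => let: And4 _ _ _ h := hga i in h) fa.
have Irm : I rm.
  have Ig i : I (ga i).1 by case: (hga i).
  have IS : I (fun x => f x + \sum_i (-1 * q i x) * (ga i).1 x).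
    apply: (idealD II If); apply: (ideal_sum _ II) => i.
    exact: (idealM II (analyticM (analytic_cst r (-1)) (qa i)) (Ig i)).
  apply: (ideal_germ II _ _ IS); first by exists ra.
  apply: germ_eqT; apply: filterS fE => x ->.
  rewrite addrAC -big_split big1 ?add0r // => i _ /=; ring.
have ra_eq0 k : ra k = 0.
  apply/eqP; apply: contrapT => /negP rak.
  have : exists N, `[< exists2 k, ra k != 0 & nweight p k = N >].
    by exists (nweight p k); apply/asboolP; exists k.
  move=> /ex_minnP[N /asboolP[k0 rak0 k0N] Nmin].
  have [|l ls lk0] := hs k0.
    exists (fun x => (ra k0)^-1 * rm x), (fun k => (ra k0)^-1 * ra k); split.
    - exact: (idealM II (analytic_cst r _) Irm).
    - exact: has_taylorZ.
    - exact: mulVf.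
    move=> k1; rewrite mulf_eq0 negb_or => /andP[_ rak1] k10.
    rewrite ltn_neqAle; apply/andP; split; first by apply: contra k10 => /eqP/pI ->.
    by rewrite k0N; apply: Nmin; apply/asboolP; exists k1.
  have ils : (index l s < size s)%N by rewrite index_mem.
  by have := ra0 k0 (Ordinal ils) rak0; rewrite /e /= nth_index // lk0.
exists q; split=> //.
have rm0 : germ_eq b rm (fun=> 0).
  by apply: (germ_eq0_coefS b_neq0 rmra) => v; rewrite /coefS fsbig1.
apply: germ_eq_trans (germ_eqT fE) _.
have := germ_eqD (germ_eq_refl (fun x => \sum_i q i x * (ga i).1 x)) rm0.
by under [X in germ_eq _ _ X]eq_fun do rewrite addr0.
Qed.

(** Division of 1 by [f] normalized to constant term 1: the leading exponent 0 is below every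
    exponent, so no remainder is left. *)
Lemma analytic_inverse f : analytic0 f -> f 0 != 0 ->
  exists2 g, analytic0 g & \forall x \near (0 : 'rV[C^o]_r), f x * g x = 1.
Proof.
move=> [a fa] f0; have [p [p1 pI]] := injective_weight r.
have a0 : a 0 != 0 by rewrite -(has_taylor_at0 fa).
have [||||q [rm [ra [qa rmra ra0 fE]]]] := @division _ _ p 1 (fun=> 0) (fun _ k => (a 0)^-1 * a k)
  (fun _ x => (a 0)^-1 * f x) (fun=> 1) (fun k => (k == 0)%:R) p1.
- by move=> _; exact: has_taylorZ.
- by move=> _; exact: mulVf.
- move=> _ k _ k0; rewrite ltn_neqAle; apply/andP; split.
    by apply: contra k0 => /eqP/pI ->.
  rewrite {1}/nweight big1 => [|i _]; first exact: nweight_gt0.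
  by rewrite mxE expn0.
- have := has_taylor_monomial R (0 : K).
  by rewrite (_ : (fun x => _) = fun=> 1) //; apply/funext => x; rewrite monomial0.
exists (fun x => (a 0)^-1 * q ord0 x); first exact: (analyticM (analytic_cst r _) (qa ord0)).
have rm0 : has_taylor rm (fun=> 0).
  rewrite (_ : (fun=> 0) = ra) //; apply/funext => k; apply/esym/eqP; apply: contrapT => /negP.
  by move=> /(ra0 k ord0); rewrite lek0.
have z0 : has_taylor (fun _ : Cr => 0 : C) (fun=> 0).
  have := has_taylorZ 0 rm0; under eq_fun do rewrite mul0r.
  by under [X in has_taylor _ X]eq_fun do rewrite mul0r.
have := has_taylor_unique_fun rm0 z0 => h; near=> x.
rewrite -[RHS](_ : \sum_(i < 1) q i x * ((a 0)^-1 * f x) + rm x = 1).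
  by rewrite big_ord1 (near h x) // addr0; ring.
by rewrite -(near fE x).
Unshelve. all: by end_near. Qed.

Lemma coefSD a a' v : coefS b (fun k => a k + a' k) v = coefS b a v + coefS b a' v.
Proof. by rewrite /coefS !fsbig_finite ?big_split //; exact: finite_toric_fibres. Qed.

(** A series of the same germ without the exponents over points where the coefficients cancel on
    [X(S)]. All remaining exponents lie over the support, which is what controls supports of
    products. *)
Definition reduce a : K -> C := fun k => if coefS b a (k *m b) == 0 then 0 else a k.

Lemma coefS_reduce a : coefS b (reduce a) = coefS b a.
Proof.
apply/funext => v; have [av|av] := eqVneq (coefS b a v) 0.
  by rewrite [LHS]/coefS fsbig1 // => k /= kv; rewrite /reduce kv av eqxx.
by apply: eq_fsbigr => k /set_mem /= kv; rewrite /reduce kv (negbTE av).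
Qed.

Lemma reduce_neq0 a k : reduce a k != 0 -> supp b a (k *m b).
Proof. by rewrite /reduce /supp /=; case: ifP => // _; rewrite eqxx. Qed.

Lemma has_taylor_reduce f a : has_taylor f a ->
  exists2 f', has_taylor f' (reduce a) & germ_eq b f f'.
Proof.
move=> fa; have [rho rho0 [[M aM] _]] := has_taylor_radius fa.
have [||f' fr] := @poly_radius_taylor _ _ (const_mx rho) (reduce a).
- by move=> i; rewrite mxE.
- exists M; apply: bnd_le aM => k; rewrite /reduce; case: ifP => // _.
  by rewrite mul0r nc0 nc_ge0.
exists f'; first exact: fr.
by apply: (coefS_germ_eq b_neq0 fa fr); rewrite coefS_reduce.
Qed.

Lemma supp_germE f f' a v : analytic0 f -> germ_eq b f f' -> has_taylor f' a ->
  supp b (taylor f) v <-> coefS b a v != 0.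
Proof. by move=> fa ff' fa'; rewrite /supp /= (germ_eq_coefS b_neq0 (taylorP fa) fa' ff'). Qed.

Lemma supp_taylorE f a v : has_taylor f a -> supp b (taylor f) v <-> coefS b a v != 0.
Proof. by move=> fa; apply: (supp_germE _ _ (germ_eq_refl f) fa); exists a. Qed.

Lemma supp_mul f g v : analytic0 f -> analytic0 g ->
  supp b (taylor (fun x => f x * g x)) v ->
  exists v1 v2, [/\ supp b (taylor f) v1, supp b (taylor g) v2 & v = v1 + v2].
Proof.
move=> [a fa] [a' ga]; have [f' fa' ff'] := has_taylor_reduce fa.
have [g' ga' gg'] := has_taylor_reduce ga.
have fg := has_taylorM fa' ga'.
have fgE : germ_eq b (fun x => f x * g x) (fun x => f' x * g' x) by exact: germ_eqM.
have fga : analytic0 (fun x => f x * g x) by apply: analyticM; [exists a|exists a'].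
move=> /(supp_germE _ fga fgE fg)/coefS_neq0[k <- /conv_neq0[k1 [k2 [-> /reduce_neq0 h1 /reduce_neq0 h2]]]].
exists (k1 *m b), (k2 *m b); split; last by rewrite mulmxDl.
- exact/(supp_taylorE _ fa).
- exact/(supp_taylorE _ ga).
Qed.

Lemma supp_semigroup a v : supp b a v -> exists k : K, k *m b = v.
Proof. by move=> /coefS_neq0[k kv _]; exists k. Qed.

(** Since [ideal_gen] is an intersection of ideals, a bound on supports passes from generators to
    the ideal by being itself an ideal. *)
Lemma supp_ideal (Y : set 'rV[nat]_n) : (forall v (k : K), Y v -> Y (v + k *m b)) ->
  is_ideal b [set f : Cr -> C | analytic0 f /\ supp b (taylor f) `<=` Y].
Proof.
move=> YS; split.
- by move=> f [].
- move=> f g ga fg [fa fY]; split; first exact: ga.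
  move=> v /(supp_germE _ ga (germ_eq_sym fg) (taylorP fa)); exact: fY.
- have z0 : has_taylor (fun _ : Cr => 0 : C) (fun=> 0).
    have := has_taylorZ 0 (has_taylor_monomial R (0 : K)); under eq_fun do rewrite mul0r.
    by under [X in has_taylor _ X]eq_fun do rewrite mul0r.
  split; first by exists (fun=> 0).
  by move=> v /(supp_taylorE _ z0)/coefS_neq0[k _]; rewrite eqxx.
- move=> f g [fa fY] [ga gY]; split; first exact: (analyticD fa ga).
  move=> v /(supp_taylorE _ (has_taylorD (taylorP fa) (taylorP ga))).
  have [f0|f0 _] := eqVneq (coefS b (taylor f) v) 0; last exact: (fY v f0).
  have [g0|g0 _] := eqVneq (coefS b (taylor g) v) 0; last exact: (gY v g0).
  move: (taylor f) (taylor g) f0 g0 => a a' a0 a'0.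
  by rewrite (coefSD a a') a0 a'0 addr0 eqxx.
- move=> f g fa [ga gY]; split; first exact: (analyticM fa ga).
  move=> v /(supp_mul fa ga)[v1 [v2 [/supp_semigroup[k <-] /gY gv ->]]].
  by rewrite addrC; exact: YS.
Qed.

Lemma supp_ideal_gen G (Y : set 'rV[nat]_n) f : (forall v (k : K), Y v -> Y (v + k *m b)) ->
  G `<=` @analytic0 R r -> supp_set b G `<=` Y -> ideal_gen b G f -> supp b (taylor f) `<=` Y.
Proof.
move=> YS Ga GY /(ideal_gen_sub (supp_ideal YS))[] // g Gg; split; first exact: Ga.
by move=> v gv; apply: GY; exists g.
Qed.

Lemma has_taylor1 : has_taylor (fun _ : Cr => 1 : C) (fun k => (k == 0)%:R).
Proof.
have := has_taylor_monomial R (0 : K).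
by rewrite (_ : (fun x => _) = fun=> 1) //; apply/funext => x; rewrite monomial0.
Qed.

Lemma supp_prod m (u : 'I_m -> Cr -> C) v : (forall i, analytic0 (u i)) ->
  supp b (taylor (fun x => \prod_(i < m) u i x)) v ->
  exists w : 'I_m -> 'rV[nat]_n, (forall i, supp b (taylor (u i)) (w i)) /\ v = \sum_(i < m) w i.
Proof.
elim: m u v => [|m IH] u v ua.
  rewrite (_ : (fun x => _) = fun=> 1); last by apply/funext => x; rewrite big_ord0.
  move=> /(supp_taylorE _ has_taylor1)/coefS_neq0[k <-].
  have [-> _|_] := eqVneq k 0; last by rewrite eqxx.
  by exists (fun=> 0); split; [case|rewrite big_ord0 mul0mx].
rewrite (_ : (fun x => _) = fun x => u ord0 x * \prod_(i < m) u (lift ord0 i) x); last first.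
  by apply/funext => x; rewrite big_ord_recl.
move=> /supp_mul[||v1 [v2 [u0 /IH[//|w [uw ->]] ->]]]; [exact: ua|by apply: analytic_prod|].
exists (fun i => if unlift ord0 i is Some j then w j else v1); split=> [i|].
  by case: unliftP => [j ->|->]; [exact: uw|exact: u0].
rewrite big_ord_recl unlift_none; congr (_ + _).
by apply: eq_bigr => i _; rewrite liftK.
Qed.

Lemma supp_ideal_pow I m f v : is_ideal b I -> ideal_pow b I m f -> supp b (taylor f) v ->
  exists (w : 'I_m -> 'rV[nat]_n) (k : K),
    (forall i, supp_set b I (w i)) /\ v = \sum_(i < m) w i + k *m b.
Proof.
move=> II If.
pose Y := [set v | exists (w : 'I_m -> 'rV[nat]_n) (k : K),
    (forall i, supp_set b I (w i)) /\ v = \sum_(i < m) w i + k *m b].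
have YS w (k : K) : Y w -> Y (w + k *m b).
  by move=> [u [l [Iu ->]]]; exists u, (l + k); rewrite mulmxDl addrA.
suff GY : supp_set b [set h | exists2 u : 'I_m -> Cr -> C,
    forall j, I (u j) & h = fun x => \prod_(j < m) u j x] `<=` Y.
  move=> fv; exact: (supp_ideal_gen YS (ideal_pow_gen_analytic II) GY If fv).
move=> w [_ [u Iu ->]] /supp_prod[i|u' [uu' ->]]; first exact: (ideal_analytic II (Iu i)).
exists u', 0; rewrite mul0mx addr0; split=> // i.
by exists (u i); [exact: Iu|exact: uu'].
Qed.

End Ideals.

(** * Extension of places *)

(* A place is presented by its graph: a partial ring morphism from B to C,
   defined on a subring of B that contains the constants. *)
Section Places.
Variables (C : closedFieldType) (B : comNzRingType) (iota : {rmorphism C -> B}).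
Implicit Types (Phi Psi : set (B * C)) (x y : B) (p q : B * C) (P Q : {poly (B * C)}).

Definition place Phi : Prop :=
  [/\ forall c, Phi (iota c, c),
      forall p q, Phi p -> Phi q -> Phi (p + q),
      forall p q, Phi p -> Phi q -> Phi (p * q) &
      ~ Phi (0, 1)].

Section OnePlace.
Variable Phi : set (B * C).
Hypothesis Phi_cst : forall c, Phi (iota c, c).
Hypothesis PhiD : forall p q, Phi p -> Phi q -> Phi (p + q).
Hypothesis PhiM : forall p q, Phi p -> Phi q -> Phi (p * q).

Lemma Phi0 : Phi 0.
Proof. by have := Phi_cst 0; rewrite rmorph0. Qed.

Lemma Phi1 : Phi 1.
Proof. by have := Phi_cst 1; rewrite rmorph1. Qed.

Lemma PhiN p : Phi p -> Phi (- p).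
Proof.
move=> hp; have -> : - p = (iota (-1), -1) * p.
  by case: p {hp} => u v; rewrite rmorphN1; congr pair; rewrite /= mulN1r.
exact: PhiM (Phi_cst _) hp.
Qed.

Lemma Phi_sum (I : Type) (s : seq I) (F : I -> B * C) : (forall i, Phi (F i)) ->
  Phi (\sum_(i <- s) F i).
Proof. by move=> h; elim/big_ind: _ => //; exact: Phi0. Qed.

Definition coefs_in P : Prop := forall i, Phi P`_i.

Lemma coefs_inC p : Phi p -> coefs_in p%:P.
Proof. by move=> hp i; rewrite coefC; case: eqP => // _; exact: Phi0. Qed.

Lemma coefs_inX : coefs_in 'X.
Proof. by move=> i; rewrite coefX; case: eqP => _; [exact: Phi1|exact: Phi0]. Qed.

Lemma coefs_inD P Q : coefs_in P -> coefs_in Q -> coefs_in (P + Q).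
Proof. by move=> hP hQ i; rewrite coefD; exact: PhiD. Qed.

Lemma coefs_inM P Q : coefs_in P -> coefs_in Q -> coefs_in (P * Q).
Proof. by move=> hP hQ i; rewrite coefM; apply: Phi_sum => j; exact: PhiM. Qed.

(** The extension of the place by [x |-> al]; polynomials over the product ring treat elements and
    residues at once. *)
Definition adjoin x (al : C) : set (B * C) :=
  [set p | exists2 P, coefs_in P & p = P.[(x, al)]].

Lemma adjoin_sub x al : Phi `<=` adjoin x al.
Proof. by move=> p hp; exists p%:P; [exact: coefs_inC|rewrite hornerC]. Qed.

Lemma adjoin_gen x al : adjoin x al (x, al).
Proof. by exists 'X; [exact: coefs_inX|rewrite hornerX]. Qed.

Lemma adjoin_place x al : ~ adjoin x al (0, 1) -> place (adjoin x al).
Proof.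
move=> h; split=> //.
- by move=> c; exact: adjoin_sub.
- by move=> _ _ [P hP ->] [Q hQ ->]; exists (P + Q); [exact: coefs_inD|rewrite hornerD].
- by move=> _ _ [P hP ->] [Q hQ ->]; exists (P * Q); [exact: coefs_inM|rewrite hornerM].
Qed.

(** Residues of the polynomial relations of [x] over the domain of [Phi]. They form an ideal of
    [C[X]], and [x] can be sent to [al] exactly when no member takes the value 1 at [al]. *)
Definition relations x : set {poly C} :=
  [set q | exists P, [/\ coefs_in P, (map_poly fst P).[x] = 0 & q = map_poly snd P]].

Lemma adjoin_relation x al : adjoin x al (0, 1) -> exists2 q, relations x q & q.[al] = 1.
Proof.
move=> [P hP E]; exists (map_poly snd P).
  by exists P; split=> //; have := horner_map fst P (x, al); rewrite /= => ->; rewrite -E.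
by have := horner_map snd P (x, al); rewrite /= => ->; rewrite -E.
Qed.

Lemma relationsD x (q q' : {poly C}) : relations x q -> relations x q' -> relations x (q + q').
Proof.
move=> [P [hP Px ->]] [P' [hP' Px' ->]]; exists (P + P'); split.
- exact: coefs_inD.
- by rewrite rmorphD hornerD Px Px' addr0.
- by rewrite rmorphD.
Qed.

Lemma relationsM x (q q' : {poly C}) : relations x q -> relations x (q' * q).
Proof.
move=> [P [hP Px ->]]; pose Q := map_poly (fun c => (iota c, c)) q'.
have Q0 : (iota 0, 0) = 0 :> B * C by rewrite rmorph0.
have QE i : Q`_i = (iota q'`_i, q'`_i) by rewrite coef_map_id0.
exists (Q * P); split.
- by apply: coefs_inM => // i; rewrite QE.
- by rewrite rmorphM hornerM Px mulr0.
- by rewrite rmorphM /=; congr (_ * _); apply/polyP => i; rewrite coef_map QE.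
Qed.

(** Nullstellensatz in one variable: a nonzero member of least size divides all others, and a root
    of it would be a common zero; over a closed field it is therefore constant. *)
Lemma relations_unit x : (forall al, exists2 q, relations x q & q.[al] = 1) -> relations x 1.
Proof.
move=> h; have [q0 rq0 q01] := h 0.
have : exists d, `[< exists q : {poly C}, [/\ relations x q, q != 0 & size q = d] >].
  exists (size q0); apply/asboolP; exists q0; split=> //.
  by apply/eqP => q00; move: q01; rewrite q00 horner0 => /eqP; rewrite eq_sym oner_eq0.
move=> /ex_minnP[d /asboolP[g [rg g0 gd]] dmin].
have gdiv (q : {poly C}) : relations x q -> g %| q.
  move=> rq; rewrite /dvdp; apply: contrapT => /negP qg0.
  have rqg : relations x (q %% g).
    rewrite (_ : q %% g = q + (- (q %/ g)) * g); first exact: relationsD (relationsM _ rg).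
    by rewrite {2}(divp_eq q g) mulNr addrC addKr.
  have : (d <= size (q %% g)%R)%N by apply: dmin; apply/asboolP; exists (q %% g).
  by rewrite leqNgt -gd ltn_modp g0.
have [g1|gN1] := eqVneq (size g) 1%N.
  have /size_poly1P[c c0 gc] : size g == 1%N by rewrite g1.
  have := relationsM c^-1%:P rg; by rewrite gc -polyCM mulVf.
have [al gal] := closed_rootP g gN1; have [q rq q1] := h al.
have := gdiv q rq; move=> /dvdpP[u qu]; move/eqP: q1.
by rewrite qu hornerM (rootP gal) mulr0 eq_sym oner_eq0.
Qed.

(** The descent of Chevalley's extension theorem. Residue 1 means that the constant coefficient has
    residue 1 and the others residue 0. The reversal of [Q] in degree [M] vanishes at [x], the
    inverse of [y]; it cancels the leading term of [P] without changing the residue polynomial. A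
    constant [Q] can only be [(0, 1)]. *)
Lemma relations_descent N x y P Q : x * y = 1 -> (size P + size Q <= N)%N ->
  coefs_in P -> (map_poly fst P).[x] = 0 -> map_poly snd P = 1 ->
  coefs_in Q -> (map_poly fst Q).[y] = 0 -> map_poly snd Q = 1 -> Phi (0, 1).
Proof.
elim: N x y P Q => [|N IH] x y P Q xy.
  rewrite leqn0 addn_eq0 size_poly_eq0 => /andP[/eqP -> _] _ _.
  by rewrite rmorph0 => /eqP; rewrite eq_sym oner_eq0.
wlog QP : x y P Q xy / (size Q <= size P)%N.
  move=> wl sN hP Px P1 hQ Qy Q1; have [le|/ltnW le] := leqP (size Q) (size P).
    exact: (wl x y P Q).
  by apply: (wl y x Q P) => //; rewrite 1?mulrC // addnC.
move=> sN hP Px P1 hQ Qy Q1.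
have sP0 (S : {poly B * C}) : map_poly snd S = 1 -> (0 < size S)%N.
  move=> S1; rewrite size_poly_gt0; apply/eqP => S0.
  by move/eqP: S1; rewrite S0 rmorph0 eq_sym oner_eq0.
have coef_snd (S : {poly B * C}) i : map_poly snd S = 1 -> (S`_i).2 = (i == 0%N)%:R.
  by move=> S1; rewrite -[RHS](coef1 C) -S1 coef_map.
have [sQ|sQ] := leqP (size Q) 1.
  have := hQ 0%N; rewrite (size1_polyC sQ) in Qy *; move: Qy.
  rewrite map_polyC hornerC coefC eqxx /=.
  have := coef_snd Q 0%N Q1; case: (Q`_0) => u v /= -> ->.
  exact.
have [M PM] : exists M, size P = M.+1 by exists (size P).-1; rewrite prednK // sP0.
have M0 : (0 < M)%N by rewrite -ltnS -PM (leq_trans sQ).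
pose S := \poly_(j < M.+1) Q`_(M - j).
pose P' := Q`_0 *: P - P`_M *: S.
have hS : coefs_in S by move=> j; rewrite coef_poly; case: ifP => _ //; exact: Phi0.
apply: (IH x y P' Q) => //.
- rewrite -ltnS; apply: leq_trans sN; rewrite PM addSn ltnS leq_add2r.
  apply/leq_sizeP => j; rewrite leq_eqVlt => /orP[/eqP <-|Mj].
    by rewrite coefB !coefZ coef_poly ltnSn subnn mulrC subrr.
  have Pj : P`_j = 0 by rewrite nth_default // PM.
  by rewrite coefB !coefZ coef_poly Pj ltnS leqNgt Mj /= !mulr0 subr0.
- move=> j; rewrite coefB !coefZ; apply: PhiD; first exact: PhiM.
  by apply: PhiN; exact: PhiM.
- rewrite rmorphB /= !map_polyZ /= hornerD hornerN !hornerZ Px mulr0 sub0r.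
  suff -> : (map_poly fst S).[x] = 0 by rewrite mulr0 oppr0.
  have -> : (map_poly fst S).[x] = x ^+ M * (map_poly fst Q).[y]; last by rewrite Qy mulr0.
  have sS : (size (map_poly fst S) <= M.+1)%N.
    by rewrite (leq_trans (size_poly _ _)) // size_poly.
  have sQM : (size (map_poly fst Q) <= M.+1)%N.
    by rewrite (leq_trans (size_poly _ _)) // -PM.
  rewrite (horner_coef_wide _ sS) (horner_coef_wide _ sQM) mulr_sumr.
  rewrite (reindex_inj rev_ord_inj) /=; apply: eq_bigr => j _.
  have jM : (j <= M)%N by rewrite -ltnS.
  rewrite !coef_map /= coef_poly subSS ltnS leq_subr subKn // mulrCA; congr (_ * _).
  by move: (nat_of_ord j) jM => d /subnK {2}<-; rewrite exprD -mulrA -exprMn xy expr1n mulr1.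
- rewrite rmorphB /= !map_polyZ /= P1 !coef_snd // eqxx scale1r.
  by rewrite (gtn_eqF M0) scale0r subr0.
Qed.

End OnePlace.

(** If no value worked for [x] nor for [y], both would have a relation of residue 1, and the descent
    would put [(0, 1)] in [Phi]. *)
Lemma place_extend Phi x y : place Phi -> x * y = 1 -> exists Psi al,
  [/\ place Psi, Phi `<=` Psi & Psi (x, al) \/ Psi (y, al)].
Proof.
move=> [Pc PD PM P01] xy; apply: contrapT => nex.
have bad z : z = x \/ z = y -> relations Phi z 1.
  move=> zxy; apply: relations_unit => // al; apply: adjoin_relation.
  apply: contrapT => h; apply: nex; exists (adjoin Phi z al), al; split.
  - exact: adjoin_place.
  - exact: adjoin_sub.
  - by case: zxy => <-; [left|right]; exact: adjoin_gen.
have [P [hP Px P1]] := bad x (or_introl erefl).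
have [Q [hQ Qy Q1]] := bad y (or_intror erefl).
exact: P01 (relations_descent Pc PD PM xy (leqnn _) hP Px (esym P1) hQ Qy (esym Q1)).
Qed.

End Places.

Lemma mulrz_rowE n (p : 'rV[int]_n) (m : int) j : (p *~ m) 0 j = p 0 j * m.
Proof. by rewrite -scaler_int mxE intz mulrC. Qed.

(** * Transposition theorem and characters *)

Section Motzkin.
Variable n : nat.
Implicit Types (p w : 'rV[int]_n) (v : 'rV[rat]_n).

Definition qpair p v : rat := \sum_j (p 0 j)%:~R * v 0 j.

Lemma qpairDl p w v : qpair (p + w) v = qpair p v + qpair w v.
Proof. by rewrite /qpair -big_split; apply: eq_bigr => j _; rewrite mxE intrD mulrDl. Qed.

Lemma qpairDr p v v' : qpair p (v + v') = qpair p v + qpair p v'.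
Proof. by rewrite /qpair -big_split; apply: eq_bigr => j _; rewrite mxE mulrDr. Qed.

Lemma qpairZr p c v : qpair p (c *: v) = c * qpair p v.
Proof. by rewrite /qpair mulr_sumr; apply: eq_bigr => j _; rewrite mxE mulrCA. Qed.

Lemma qpair0 v : qpair 0 v = 0.
Proof. by rewrite /qpair big1 // => j _; rewrite mxE mul0r. Qed.

Lemma qpairMz p (m : int) v : qpair (p *~ m) v = m%:~R * qpair p v.
Proof.
rewrite /qpair mulr_sumr; apply: eq_bigr => j _.
by rewrite mulrz_rowE intrM mulrA [m%:~R * _]mulrC.
Qed.

Lemma qpairMn p (m : nat) v : qpair (p *+ m) v = m%:R * qpair p v.
Proof. by rewrite pmulrn qpairMz. Qed.

Lemma qpair_sum (I : Type) (s : seq I) (F : I -> 'rV[int]_n) v :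
  qpair (\sum_(i <- s) F i) v = \sum_(i <- s) qpair (F i) v.
Proof. by elim/big_rec2: _ => [|i y x _ <-]; rewrite ?qpair0 ?qpairDl. Qed.

Lemma clear_denominators q (D : 'rV[rat]_q) : exists (c : nat) (ga : 'I_q -> int),
  (0 < c)%N /\ forall j, D 0 j * c%:R = (ga j)%:~R.
Proof.
exists (\prod_j `|denq (D ord0 j)|)%N,
  (fun j => numq (D 0 j) * (\prod_(i | i != j) `|denq (D ord0 i)|)%N%:Z); split.
  by apply: prodn_gt0 => j; rewrite absz_gt0 denq_eq0.
move=> j; rewrite (bigD1 j) //= natrM mulrA -{1}(divq_num_den (D 0 j)) intrM; congr (_ * _).
by rewrite natr_absz gtr0_norm ?denq_gt0 // divfK // intr_eq0 denq_eq0.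
Qed.

(** Linear algebra over the rationals: a column of the cokernel of the [E j] separates [p] from
    their span. Clearing denominators makes the first alternative integral. *)
Lemma span_or_separated q (E : 'I_q -> 'rV[int]_n) p :
  (exists (c : nat) (ga : 'I_q -> int), (0 < c)%N /\ p *+ c = \sum_j E j *~ ga j) \/
  (exists v, (forall j, qpair (E j) v = 0) /\ qpair p v = 1).
Proof.
pose M : 'M[rat]_(q, n) := \matrix_(i, j) (E i 0 j)%:~R.
pose pq : 'rV[rat]_n := \row_j (p 0 j)%:~R.
case: (boolP (pq <= M)%MS) => [/submxP[D pD]|].
  left; have [c [ga [c0 h]]] := clear_denominators D; exists c, ga; split=> //.
  apply/rowP => j; rewrite summxE; apply: (@intr_inj rat).
  rewrite pmulrn mulrz_rowE intrM rmorph_sum /=.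
  have := congr1 (fun A : 'rV_n => A 0 j) pD; rewrite !mxE => ->.
  rewrite mulr_suml; apply: eq_bigr => i _.
  by rewrite !mxE mulrz_rowE intrM mulrAC h mulrC.
rewrite submxE => /matrix0Pn[i [k]]; rewrite (ord1 i) => nz; right.
exists (((pq *m cokermx M) 0 k)^-1 *: (col k (cokermx M))^T).
have E1 (w : 'rV[int]_n) : qpair w (col k (cokermx M))^T = ((\row_j (w 0 j)%:~R) *m cokermx M) 0 k.
  by rewrite /qpair [RHS]mxE; apply: eq_bigr => j _; rewrite !mxE.
split=> [j|]; rewrite qpairZr E1; last exact: mulVf.
have -> : \row_l (E j 0 l)%:~R = row j M by apply/rowP => l; rewrite !mxE.
by rewrite -row_mul mulmx_coker !mxE mulr0.
Qed.

(** Induction on the number of strict inequalities. Unless a solution [v1] for the others is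
    positive on the first one, [p], or a multiple of [p] is a combination of the [E j], the
    condition on [p] is made an equation; a solution [v2] of that system is then corrected by some
    [v3] with value 1 on [p]. *)
Lemma motzkin a q (P : 'I_a -> 'rV[int]_n) (E : 'I_q -> 'rV[int]_n) :
  (exists v, (forall i, 0 < qpair (P i) v) /\ (forall j, qpair (E j) v = 0)) \/
  (exists (al : 'I_a -> nat) (ga : 'I_q -> int),
     \sum_i P i *+ al i + \sum_j E j *~ ga j = 0 /\ exists i, al i != 0%N).
Proof.
elim: a q P E => [|a IH] q P E.
  left; exists 0; split=> [[]//|j].
  by rewrite /qpair big1 // => k _; rewrite mxE mulr0.
pose p := P ord0; pose P' i := P (lift ord0 i).
have cons_cert c (al : 'I_a -> nat) (ga : 'I_q -> int) :
    p *+ c + \sum_i P' i *+ al i + \sum_j E j *~ ga j = 0 ->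
    (c != 0%N \/ exists i, al i != 0%N) ->
    exists (al : 'I_a.+1 -> nat) (ga : 'I_q -> int),
     \sum_i P i *+ al i + \sum_j E j *~ ga j = 0 /\ exists i, al i != 0%N.
  move=> h nz; exists (fun i => if unlift ord0 i is Some j then al j else c), ga; split.
    rewrite big_ord_recl unlift_none -[RHS]h; congr (_ + _ + _).
    by apply: eq_bigr => i _; rewrite liftK.
  case: nz => [c0|[i ai]]; first by exists ord0; rewrite unlift_none.
  by exists (lift ord0 i); rewrite liftK.
have [[v1 [P1 E1]]|[al [ga [h nz]]]] := IH q P' E; last first.
  by right; apply: (cons_cert 0%N al ga); [rewrite mulr0n add0r|right].
have [p1|p1] := ltP 0 (qpair p v1).
  left; exists v1; split=> // i; case: (unliftP ord0 i) => [j ->|->//]; exact: P1.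
have [[c [ga [c0 pc]]]|[v3 [E3 p3]]] := span_or_separated E p.
  right; apply: (cons_cert c (fun=> 0%N) (fun j => - ga j)); last by left; rewrite -lt0n.
  rewrite big1 => [|i _]; last by rewrite mulr0n.
  by rewrite addr0 pc -big_split big1 // => j _; rewrite /= mulrNz subrr.
pose E' (j : 'I_q.+1) := if unlift ord0 j is Some i then E i else p.
have E'0 : E' ord0 = p by rewrite /E' unlift_none.
have E'l j : E' (lift ord0 j) = E j by rewrite /E' liftK.
have [[v2 [P2 E2]]|[al [ga [h [i0 ai0]]]]] := IH q.+1 P' E'.
  (* So large that [N *: v2] absorbs the possibly negative values of [v3] on the [P' i]. *)
  left; pose N := 1 + \sum_i (`|qpair (P' i) v3| / qpair (P' i) v2).
  exists (N *: v2 + v3); split=> [i|j]; rewrite qpairDr qpairZr; last first.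
    by rewrite E3 -E'l E2 mulr0 addr0.
  case: (unliftP ord0 i) => [k ->|->]; last by rewrite -/p p3 -E'0 E2 mulr0 add0r.
  have y0 := P2 k; rewrite -/(P' k).
  have : `|qpair (P' k) v3| / qpair (P' k) v2 < N.
    rewrite /N (bigD1 k) //= addrCA ltrDl ltr_wpDr //.
    by apply: sumr_ge0 => l _; rewrite divr_ge0 // ltW.
  rewrite ltr_pdivrMr // => lt; have := ler_norm (- qpair (P' k) v3); rewrite normrN.
  by lra.
right; move: h; rewrite big_ord_recl E'0.
under [X in _ + (_ + X)]eq_bigr do rewrite E'l.
(* A nonnegative coefficient of [p] gives a certificate. A negative one is refuted at [v1], where
   [p] is nonpositive and the [P' i] are positive. *)
case: (ga ord0) => c.
  rewrite -pmulrn addrCA addrA => h.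
  by apply: (cons_cert c al (fun j => ga (lift ord0 j)) h); right; exists i0.
move=> /(congr1 (fun w => qpair w v1)); rewrite qpair0 !qpairDl !qpair_sum NegzE qpairMz.
rewrite [X in _ + (_ + X)]big1 ?addr0 => [|j _]; last by rewrite qpairMz E1 mulr0.
suff : 0 < \sum_i qpair (P' i *+ al i) v1.
  by move=> s0 /eqP; rewrite gt_eqF // ltr_wpDr // intrN mulNr -mulrN mulr_ge0 ?oppr_ge0.
rewrite (bigD1 i0) //= qpairMn ltr_wpDr ?mulr_gt0 ?ltr0n ?lt0n // ?P1 //.
by apply: sumr_ge0 => i _; rewrite qpairMn mulr_ge0 // ltW.
Qed.

End Motzkin.

Section Characters.
Variables (C : closedFieldType) (n : nat).
Implicit Types (X Y : set ('rV[int]_n * C)) (v w e : 'rV[int]_n) (c d : C).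

(** The graph of a homomorphism from a subgroup of [Z^n] to the nonzero elements of [C]. *)
Definition partial_character X : Prop :=
  [/\ X (0, 1), forall v w c d, X (v, c) -> X (w, d) -> X (v + w, c * d),
      forall v c, X (v, c) -> X (- v, c^-1) /\ c != 0 &
      forall c, X (0, c) -> c = 1].

Lemma partial_characterMz X v c (m : int) : partial_character X -> X (v, c) ->
  X (v *~ m, c ^ m).
Proof.
move=> [X0 XD XN _] Xv.
have H (k : nat) : X (v *+ k, c ^+ k).
  by elim: k => [|k IH]; [rewrite mulr0n expr0|rewrite mulrS exprS; exact: XD].
case: m => k; first exact: H.
by have [] := XN _ _ (H k.+1).
Qed.

(** If no positive multiple of [e] is in the domain, any value will do. Otherwise the least such
    multiple [m0] divides all others, and any [m0]-th root of its value is consistent; one exists in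
    a closed field. *)
Lemma partial_character_extend X e : partial_character X -> exists Y c,
  [/\ partial_character Y, X `<=` Y & Y (e, c)].
Proof.
move=> XC; have [X0 XD XN X1] := XC.
suff [c c0 hc] : exists2 c, c != 0 & forall (m : int) d, X (e *~ m, d) -> d = c ^ m.
  exists [set p | exists v d (m : int), X (v, d) /\ p = (v + e *~ m, d * c ^ m)], c; split.
  - split.
    + by exists 0, 1, 0; rewrite mulr0z addr0 mulr1.
    + move=> _ _ _ _ [v [d [m [Xv [-> ->]]]]] [w [d' [m' [Xw [-> ->]]]]].
      exists (v + w), (d * d'), (m + m'); split; first exact: XD.
      by rewrite mulrzDr addrACA expfzDr // mulrACA.
    + move=> _ _ [v [d [m [Xv [-> ->]]]]]; have [XNv d0] := XN _ _ Xv.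
      split; last by rewrite mulf_neq0 // expfz_neq0.
      by exists (- v), d^-1, (- m); rewrite opprD mulrNz invfM invr_expz.
    + move=> c1 [v [d [m [Xv [/esym/eqP]]]]]; rewrite addrC addr_eq0 => /eqP em ->.
      have [XNv d0] := XN _ _ Xv.
      by rewrite -(hc m d^-1) ?mulfV // em.
  - by move=> [v d] Xv; exists v, d, 0; rewrite mulr0z addr0 mulr1.
  - by exists 0, 1, 1; rewrite mulr1z add0r mul1r expr1z.
have [[m Pm]|none] := pselect (exists m : nat, (0 < m)%N /\ exists d, X (e *+ m, d)); last first.
  exists 1 => [|m d Xd]; first exact: oner_neq0.
  rewrite exp1rz; case: m Xd => [[|m]|m]; first by rewrite mulr0z => /X1.
    by move=> Xd; case: none; exists m.+1; split=> //; exists d.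
  rewrite NegzE mulrNz => /XN[+ _]; rewrite opprK => Xd.
  by case: none; exists m.+1; split=> //; exists d^-1.
have : exists m : nat, `[< (0 < m)%N /\ exists d, X (e *+ m, d) >] by exists m; apply/asboolP.
move=> /ex_minnP[m0 /asboolP[m00 [d0 Xd0]] mmin] {m Pm}.
have [_ d0_neq0] := XN _ _ Xd0.
have szX : size ('X^m0 - d0%:P) != 1%N by rewrite size_XnsubC // eqSS -lt0n.
have [c] := closed_rootP _ szX.
rewrite rootE !hornerE subr_eq0 => /eqP cm0.
have c0 : c != 0.
  by apply: contraNneq d0_neq0 => c0; rewrite -cm0 c0 expr0n gtn_eqF.
exists c => // m d Xd; pose q := (m %/ m0)%Z; pose s := (m %% m0)%Z.
have mE : m = q * m0%:Z + s := divz_eq m m0.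
have s0 : 0 <= s by rewrite modz_ge0 // -lt0n.
have sm0 : s < m0%:Z by rewrite ltz_pmod.
have Xs : X (e *~ s, d * d0 ^ (- q)).
  have := partial_characterMz (- q) XC Xd0 => /(XD _ _ _ _ Xd).
  by rewrite pmulrn -mulrzA -mulrzDr mE mulrN [q * _]mulrC addrAC subrr add0r.
have sE : s = 0.
  case: (s) s0 sm0 Xs => // -[|k] // _; rewrite ltz_nat => km0 Xk.
  have : (m0 <= k.+1)%N by apply: mmin; apply/asboolP; split=> //; exists (d * d0 ^ (- q)).
  by rewrite leqNgt km0.
move: Xs; rewrite sE mulr0z => /X1 dq.
rewrite mE sE addr0 mulrC -exprz_exp -[c ^ m0]/(c ^+ m0) cm0.
by rewrite -[LHS]mulr1 -(mulVf (expfz_neq0 q d0_neq0)) mulrA invr_expz dq mul1r.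
Qed.

Lemma character_point X : partial_character X -> exists zt : 'rV[C]_n,
  (forall j, zt 0 j != 0) /\ forall v c, X (v, c) -> \prod_j zt 0 j ^ v 0 j = c.
Proof.
move=> XC.
have H m : exists Y (zt : 'I_n -> C), [/\ partial_character Y, X `<=` Y &
    forall j : 'I_n, (j < m)%N -> Y (delta_mx 0 j, zt j)].
  elim: m => [|m [Y [zt [YC XY Yz]]]]; first by exists X, (fun=> 1); split.
  have [mn|nm] := ltnP m n; last first.
    by exists Y, zt; split=> // j _; apply: Yz; exact: leq_trans nm.
  have [Y' [c [Y'C YY' Y'c]]] := partial_character_extend (delta_mx 0 (Ordinal mn)) YC.
  exists Y', (fun j => if j == Ordinal mn then c else zt j); split=> //.
    exact: subset_trans YY'.
  move=> j; have [->//|jm] := eqVneq j (Ordinal mn); rewrite ltnS leq_eqVlt => /orP[/eqP jE|/Yz/YY'//].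
  by case/eqP: jm; exact: val_inj.
have [Y [zt [YC XY Yz]]] := H n; have [Y0 YD YN Y1] := YC.
exists (\row_j zt j); split=> [j|v c Xv].
  by rewrite mxE; have [] := YN _ _ (Yz j (ltn_ord j)).
have Yv : Y (v, \prod_j (\row_j zt j) 0 j ^ v 0 j).
  have vE : v = \sum_j (delta_mx 0 j : 'rV[int]_n) *~ v 0 j.
    by rewrite {1}(row_sum_delta v); apply: eq_bigr => j _; rewrite -scaler_int intz.
  rewrite {1}vE; elim: (index_enum _) => [|j s IH]; first by rewrite !big_nil.
  rewrite !big_cons; apply: YD IH; rewrite mxE; apply: partial_characterMz => //.
  exact: Yz.
have [YNv z0] := YN _ _ Yv; have := YD _ _ _ _ (XY _ Xv) YNv; rewrite subrr => /Y1 cz.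
by rewrite -[RHS](mulfVK z0) cz mul1r.
Qed.

End Characters.

(** * Newton polyhedra *)

Section Convexity.
Variables (R : realType) (n : nat).
Implicit Types (A D : set 'rV[R]_n) (u v w x y : 'rV[R]_n) (t : R).

Lemma convex_setP D : convex_set D <->
  forall t x y, 0 <= t <= 1 -> D x -> D y -> D (t *: x + (1 - t) *: y).
Proof.
split=> [cD t x y /andP[t0 t1] Dx Dy|cD x y t /set_mem Dx /set_mem Dy].
  by have := cD x y (Itv01 t0 t1) (mem_set Dx) (mem_set Dy) => /set_mem.
by apply: mem_set; apply: cD => //; rewrite ge0 le1.
Qed.

Lemma convex_hull_convex A : convex_set (convex_hull A).
Proof.
apply/convex_setP => t x y t01 hx hy D [cD AD].
by move/convex_setP: (cD); apply => //; [apply: hx|apply: hy].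
Qed.

Lemma sub_convex_hull A : A `<=` convex_hull A.
Proof. by move=> x Ax D [_]; exact. Qed.

Lemma convex_hull_sub A D : convex_set D -> A `<=` D -> convex_hull A `<=` D.
Proof. by move=> cD AD x; apply. Qed.

Lemma pairingE u v : pairing u v = \sum_j u 0 j * v 0 j.
Proof. by rewrite /pairing mxE; apply: eq_bigr => j _; rewrite mxE. Qed.

Lemma pairingDl u w v : pairing (u + w) v = pairing u v + pairing w v.
Proof. by rewrite !pairingE -big_split; apply: eq_bigr => j _; rewrite mxE mulrDl. Qed.

Lemma pairingZl t u v : pairing (t *: u) v = t * pairing u v.
Proof. by rewrite !pairingE mulr_sumr; apply: eq_bigr => j _; rewrite mxE mulrA. Qed.

Lemma pairingC u v : pairing u v = pairing v u.
Proof. by rewrite !pairingE; apply: eq_bigr => j _; rewrite mulrC. Qed.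

Lemma pairing0 v : pairing 0 v = 0.
Proof. by rewrite pairingE big1 // => j _; rewrite mxE mul0r. Qed.

Lemma pairing_sum (I : Type) (s : seq I) (F : I -> 'rV[R]_n) v :
  pairing (\sum_(i <- s) F i) v = \sum_(i <- s) pairing (F i) v.
Proof. by elim/big_rec2: _ => [|i y x _ <-]; rewrite ?pairing0 ?pairingDl. Qed.

Lemma open_halfspace_convex v l : convex_set [set x : 'rV[R]_n | l < pairing x v].
Proof.
apply/convex_setP => t x y /andP[t0 t1] /= lx ly; rewrite pairingDl !pairingZl.
(* One of the two coefficients is at least 1/2, and the strict inequality is kept at that end. *)
have [t_half|t_half] := leP t (1 / 2).
  apply: (@lt_le_trans _ _ (t * l + (1 - t) * pairing y v)).
    by rewrite {1}(_ : l = t * l + (1 - t) * l); [rewrite ltrD2l ltr_pM2l //; lra|ring].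
  by rewrite lerD2r ler_wpM2l // ltW.
apply: (@lt_le_trans _ _ (t * pairing x v + (1 - t) * l)).
  by rewrite {1}(_ : l = t * l + (1 - t) * l); [rewrite ltrD2r ltr_pM2l //; lra|ring].
by rewrite lerD2l ler_wpM2l ?subr_ge0 // ltW.
Qed.

(** With [A] the hull of the exponents at level [l], this set traps the Newton polyhedron, so that
    its face at level [l] is no larger than that hull. *)
Lemma face_union_convex v l A : convex_set A -> (forall x, A x -> pairing x v = l) ->
  convex_set [set x : 'rV[R]_n | A x \/ l < pairing x v].
Proof.
move=> /convex_setP cA Al; apply/convex_setP => t x y /andP[t0 t1] hx hy.
have lx : l <= pairing x v by case: hx => [/Al ->//|/ltW].
have ly : l <= pairing y v by case: hy => [/Al ->//|/ltW].
have [->|tn0] := eqVneq t 0; first by rewrite scale0r add0r subr0 scale1r.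
have [->|tn1] := eqVneq t 1; first by rewrite subrr scale0r addr0 scale1r.
have tp : 0 < t by rewrite lt_neqAle eq_sym tn0.
have tm : 0 < 1 - t by rewrite subr_gt0 lt_neqAle tn1.
case: hx hy => [Ax|xl] [Ay|yl]; first by left; apply: cA; rewrite ?t0.
all: by right; rewrite pairingDl !pairingZl; nra.
Qed.

Lemma translate_convex A w : convex_set A -> convex_set [set x : 'rV[R]_n | A (x + w)].
Proof.
move=> /convex_setP cA; apply/convex_setP => t x y t01 /= Ax Ay.
have := cA t _ _ t01 Ax Ay; rewrite (_ : _ + _ = t *: x + (1 - t) *: y + w) //.
by rewrite !scalerDr addrACA -[t *: w + _]scalerDl [t + _]addrC subrK scale1r.
Qed.

Lemma convex_average m A (x : 'I_m.+1 -> 'rV[R]_n) : convex_set A -> (forall i, A (x i)) ->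
  A (m.+1%:R^-1 *: \sum_(i < m.+1) x i).
Proof.
move=> cA; move/convex_setP: (cA) => cA'; elim: m x => [|m IH] x Ax.
  by rewrite big_ord1 invr1 scale1r.
rewrite big_ord_recl.
have := cA' m.+2%:R^-1 _ _ _ (Ax ord0) (IH (fun i => x (lift ord0 i)) (fun i => Ax _)).
have m1 : (0 : R) < m.+1%:R by rewrite ltr0n.
have m2 : (0 : R) < m.+2%:R by rewrite ltr0n.
rewrite invr_ge0 ler0n invf_le1 // ler1n => /(_ isT); rewrite scalerDr scalerA.
rewrite [_ * _](_ : _ = m.+2%:R^-1) //.
have -> : (m.+2%:R : R) = m.+1%:R + 1 by rewrite natr1.
by field; rewrite !gt_eqF //; lra.
Qed.

(** Inductively, the hull of [x :: s] is the union of the segments from [x] to the hull of [s], a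
    continuous image of a compact product. *)
Lemma compact_hull (s : seq 'rV[R]_n) : compact (convex_hull [set` s]).
Proof.
elim: s => [|x s IH].
  rewrite (_ : convex_hull _ = set0); first exact: compact0.
  apply/seteqP; split=> // y /(_ set0); apply; split=> [|z /=]; last by rewrite in_nil.
  by move=> ? ? ?; rewrite in_set0.
have [->|[y0 sy0]] : s = [::] \/ exists y, y \in s.
- by case: (s) => [|y ?]; [left|right; exists y; rewrite inE eqxx].
- rewrite (_ : convex_hull _ = [set x]); first exact: compact_set1.
  apply/seteqP; split.
    apply: convex_hull_sub => [|z /=]; last by rewrite inE => /eqP.
    apply/convex_setP => t u v _ /= -> ->.
    by rewrite -scalerDl [t + _]addrC subrK scale1r.
  by move=> z ->; apply: sub_convex_hull; rewrite /= inE.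
pose h (p : R * 'rV[R]_n) := p.1 *: x + (1 - p.1) *: p.2.
have -> : convex_hull [set` x :: s] = [set h p | p in (`[0, 1]%classic : set R) `*` convex_hull [set` s]].
  apply/seteqP; split.
    apply: convex_hull_sub => [|z /=]; last first.
      rewrite inE => /orP[/eqP ->|zs].
        exists (1, y0); last by rewrite /h /= subrr scale1r scale0r addr0.
        by split; [rewrite /= in_itv /= ler01 lexx|exact: sub_convex_hull].
      exists (0, z); last by rewrite /h /= scale0r add0r subr0 scale1r.
      by split; [rewrite /= in_itv /= ler01 lexx|exact: sub_convex_hull].
    apply/convex_setP => t _ _ /andP[t0 t1] [[a u] [/= a01 hu] <-] [[c v] [/= c01 hv] <-].
    move: a01 c01; rewrite !in_itv /= => /andP[a0 a1] /andP[c0 c1].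
    pose T := t * a + (1 - t) * c.
    have T0 : 0 <= T by rewrite addr_ge0 // mulr_ge0 // subr_ge0.
    have T1 : T <= 1 by rewrite /T; nra.
    have [TE|TE] := eqVneq T 1.
      have e1 : t * (1 - a) = 0 by have := mulr_ge0 t0 (_ : 0 <= 1 - a); rewrite /T in TE; nra.
      have e2 : (1 - t) * (1 - c) = 0 by rewrite /T in TE; nra.
      exists (1, u); first by split => //=; rewrite in_itv /= ler01 lexx.
      rewrite /h /= !scalerDr !scalerA e1 e2 !scale0r !addr0 -scalerDl -/T TE scale1r.
      by rewrite subrr scale0r addr0.
    have Tm : 0 < 1 - T by rewrite subr_gt0 lt_neqAle TE.
    exists (T, (t * (1 - a) / (1 - T)) *: u + (1 - t * (1 - a) / (1 - T)) *: v).
      split; first by rewrite /= in_itv /= T0.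
      have /convex_setP := @convex_hull_convex [set` s]; apply => //.
      have ta0 : 0 <= t * (1 - a) by rewrite mulr_ge0 // subr_ge0.
      rewrite divr_ge0 ?(ltW Tm) //= ler_pdivrMr // mul1r /T; nra.
    rewrite /h /= !scalerDr !scalerA addrACA -scalerDl -/T; congr (_ + (_ *: _ + _ *: _)).
      by field; rewrite gt_eqF.
    by rewrite /T; field; rewrite -/T gt_eqF.
  move=> _ [[t y] [/= t01 hy] <-]; have /convex_setP := @convex_hull_convex [set` x :: s]; apply.
  - by move: t01; rewrite in_itv.
  - by apply: sub_convex_hull; rewrite /= inE eqxx.
  - apply: convex_hull_sub hy; first exact: convex_hull_convex.
    by move=> z zs; apply: sub_convex_hull; rewrite /= inE zs orbT.
apply: continuous_compact; last by apply: compact_setX => //; exact: segment_compact.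
apply: continuous_subspaceT => -[t y]; apply: cvgD; apply: cvgZ.
- exact: cvg_fst.
- exact: cvg_cst.
- by apply: cvgB; [exact: cvg_cst|exact: cvg_fst].
- exact: cvg_snd.
Qed.

End Convexity.

Section NewtonPolyhedra.
Variables (R : realType) (r n : nat) (b : 'M[nat]_(r, n)).
Hypothesis b_neq0 : forall i, row i b != 0.
Local Notation C := R[i].
Local Notation Cr := 'rV[R[i]]_r.
Local Notation K := 'rV[nat]_r.
Implicit Types (f g h : Cr -> C) (I J G : set (Cr -> C)) (A : set 'rV[nat]_n)
  (D : set 'rV[R]_n) (k : K) (v w : 'rV[R]_n).
Local Opaque germ_eq has_taylor taylor.

Lemma to_realD m (k l : 'rV[nat]_m) : to_real R (k + l) = to_real R k + to_real R l.
Proof. by apply/rowP => i; rewrite !mxE natrD. Qed.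

Lemma to_real0 m : to_real R (0 : 'rV[nat]_m) = 0.
Proof. by apply/rowP => i; rewrite !mxE. Qed.

Lemma to_real_sum m (I : Type) (s : seq I) (F : I -> 'rV[nat]_m) :
  to_real R (\sum_(i <- s) F i) = \sum_(i <- s) to_real R (F i).
Proof. by elim/big_rec2: _ => [|i y x _ <-]; rewrite ?to_real0 ?to_realD. Qed.

Lemma to_realMn m (k : 'rV[nat]_m) p : to_real R (k *+ p) = p%:R *: to_real R k.
Proof.
by elim: p => [|p IH]; rewrite ?mulr0n ?to_real0 ?scale0r // mulrS to_realD IH -natr1 addrC scalerDl scale1r.
Qed.

Lemma to_real_mul k : to_real R (k *m b) = to_real R k *m to_real R b.
Proof.
apply/rowP => j; rewrite !mxE natr_sum; apply: eq_bigr => i _.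
by rewrite !mxE natrM.
Qed.

Lemma mulmx_muln k p : (k *+ p) *m b = k *m b *+ p.
Proof. by elim: p => [|p IH]; rewrite ?mulr0n ?mul0mx // !mulrS mulmxDl IH. Qed.

Lemma cone_mul k : cone R b (to_real R (k *m b)).
Proof. by rewrite to_real_mul; exists (to_real R k) => // i; rewrite mxE. Qed.

Lemma cone0 : cone R b 0.
Proof. by exists 0; [move=> i; rewrite mxE|rewrite mul0mx]. Qed.

Lemma coneD v w : cone R b v -> cone R b w -> cone R b (v + w).
Proof.
move=> [c c0 <-] [d d0 <-]; exists (c + d); last by rewrite mulmxDl.
by move=> i; rewrite mxE addr_ge0.
Qed.

Lemma newton_sub A D : convex_set D ->
  (forall (k : 'rV[nat]_n) v, A k -> cone R b v -> D (to_real R k + v)) -> newton_polyhedron b A `<=` D.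
Proof. by move=> cD h; apply: convex_hull_sub => // w [k [v [Ak vb ->]]]; exact: h. Qed.

Lemma newton_gen A (k : 'rV[nat]_n) v : A k -> cone R b v -> newton_polyhedron b A (to_real R k + v).
Proof. by move=> Ak vb; apply: sub_convex_hull; exists k, v. Qed.

Lemma newton_mem A (k : 'rV[nat]_n) : A k -> newton_polyhedron b A (to_real R k).
Proof. by move=> Ak; rewrite -[to_real R k]addr0; apply: newton_gen => //; exact: cone0. Qed.

Lemma newton_convex A : convex_set (newton_polyhedron b A : set 'rV[R]_n).
Proof. exact: convex_hull_convex. Qed.

Lemma newton_add A (x : 'rV[R]_n) v : newton_polyhedron b A x -> cone R b v -> newton_polyhedron b A (x + v).
Proof.
move=> hx vb.
suff H (k : 'rV[nat]_n) w : A k -> cone R b w -> newton_polyhedron b A (to_real R k + w + v).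
  have cD := @translate_convex R n _ v (@newton_convex A).
  exact: (newton_sub cD H hx).
move=> Ak wb; rewrite -addrA; apply: newton_gen Ak _; exact: coneD.
Qed.

Lemma newton_mono A A' : A `<=` A' ->
  newton_polyhedron b A `<=` (newton_polyhedron b A' : set 'rV[R]_n).
Proof.
move=> AA'; apply: newton_sub; first exact: newton_convex.
by move=> k v /AA'; exact: newton_gen.
Qed.

Lemma newton_ideal_gen G : G `<=` @analytic0 R r ->
  newton_of b (ideal_gen b G) = newton_of b G.
Proof.
move=> Ga; apply/seteqP; split; last first.
  by apply: newton_mono => v [f Gf fv]; exists f => //; exact: sub_ideal_gen.
apply: newton_sub => [|k v [f Gf fk] vb]; first exact: newton_convex.
apply: newton_add => //.
have YS (w : 'rV[nat]_n) (k' : K) : newton_of b G (to_real R w) -> newton_of b G (to_real R (w + k' *m b)).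
  by move=> hw; rewrite to_realD; apply: newton_add => //; exact: cone_mul.
have GY : supp_set b G `<=` [set w | newton_of b G (to_real R w)] by move=> w; exact: newton_mem.
exact: (supp_ideal_gen b_neq0 (Y := [set w | newton_of b G (to_real R w)]) YS Ga GY Gf fk).
Qed.

(* Rounds the coordinates of c one at a time to the neighbouring integers. *)
Lemma cone_in_hull k v D : convex_set D -> (forall k', D (to_real R ((k + k') *m b))) ->
  cone R b v -> D (to_real R (k *m b) + v).
Proof.
move=> /convex_setP cD Dk [c c0 <-].
suff H m (d : 'rV[R]_r) : (forall i, 0 <= d 0 i) -> (forall i : 'I_r, (m <= i)%N -> exists p : nat, d 0 i = p%:R) ->
    D (to_real R (k *m b) + d *m to_real R b).
  by apply: (H r) => // i; rewrite leqNgt ltn_ord.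
elim: m d => [|m IH] d d0 dN.
  have /choice[p hp] i := dN i (leq0n i).
  rewrite (_ : d = to_real R (\row_i p i)); last by apply/rowP => i; rewrite !mxE hp.
  by rewrite -to_real_mul -to_realD -mulmxDl.
have [mr|rm] := ltnP m r; last first.
  by apply: IH => // i mi; have := leq_trans (ltn_ord i) (leq_trans rm mi); rewrite ltnn.
pose io := Ordinal mr; pose p := Num.truncn (d 0 io).
have /andP[pd dp] := truncn_itv (d0 io).
pose d' (q : nat) : 'rV[R]_r := \row_i (if i == io then q%:R else d 0 i).
have Dd' q : D (to_real R (k *m b) + d' q *m to_real R b).
  apply: IH => i; first by rewrite mxE; case: ifP.
  rewrite mxE; case: eqP => [_ _|ne mi]; first by exists q.
  apply: dN; rewrite ltn_neqAle mi andbT; apply/eqP => mE; apply: ne; exact: val_inj.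
pose t : R := 1 - (d 0 io - p%:R).
have t01 : 0 <= t <= 1 by rewrite /t; move: dp pd; rewrite -/p -natr1; lra.
have := cD t _ _ t01 (Dd' p) (Dd' p.+1).
rewrite !scalerDr addrACA -[t *: to_real R (k *m b) + _]scalerDl [t + _]addrC subrK scale1r.
rewrite !scalemxAl -mulmxDl (_ : t *: d' p + (1 - t) *: d' p.+1 = d) //.
apply/rowP => i; rewrite !mxE; case: eqP => [->|_]; rewrite -?natr1 /t; ring.
Qed.

Lemma supp_sum (T : Type) (s : seq T) (F : T -> Cr -> C) (v : 'rV[nat]_n) :
  (forall i, analytic0 (F i)) -> supp b (taylor (fun x => \sum_(i <- s) F i x)) v ->
  exists i, supp b (taylor (F i)) v.
Proof.
move=> Fa.
elim: s => [|i s IH].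
  rewrite (_ : (fun x => _) = fun=> 0); last by apply/funext => x; rewrite big_nil.
  have z0 : has_taylor (fun _ : Cr => 0 : C) (fun=> 0).
    have := has_taylorZ 0 (has_taylor_monomial R (0 : K)); under eq_fun do rewrite mul0r.
    by under [X in has_taylor _ X]eq_fun do rewrite mul0r.
  by move=> /(supp_taylorE b_neq0 _ z0)/coefS_neq0[k _]; rewrite eqxx.
rewrite (_ : (fun x => _) = fun x => F i x + \sum_(j <- s) F j x); last first.
  by apply/funext => x; rewrite big_cons.
have sa := analytic_sum s Fa.
move=> /(supp_taylorE b_neq0 _ (has_taylorD (taylorP (Fa i)) (taylorP sa))).
have [a0|a0 _] := eqVneq (coefS b (taylor (F i)) v) 0; last by exists i; exact: a0.
have [s0|s0 _] := eqVneq (coefS b (taylor (fun x => \sum_(j <- s) F j x)) v) 0; last exact: (IH s0).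
move: (taylor _) (taylor _) a0 s0 => a a' a0 a'0.
by rewrite (coefSD b_neq0 a' a) a0 a'0 addr0 eqxx.
Qed.

Lemma supp_monomial k (v : 'rV[nat]_n) : supp b (taylor (fun x : Cr => monomial x k)) v <-> v = k *m b.
Proof.
rewrite (supp_taylorE b_neq0 v (has_taylor_monomial R k)); split.
  move=> /coefS_neq0[k' <-]; have [->//|_] := eqVneq k' k.
  by rewrite eqxx.
move=> ->; rewrite coefS_reduced ?eqxx ?oner_eq0 // => k' _.
by have [->//|_] := eqVneq k' k; rewrite eqxx.
Qed.

(** Some term of the integral equation must contain [x^(m k)]. Hence for some [j] the exponent
    [(j + 1) k b] is a sum of [j + 1] points of the support of [I] and of an element of [S];
    dividing by [j + 1] gives an average of points of the polyhedron. *)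
Lemma integral_monomial_newton I k : is_ideal b I ->
  integral_closure b I (fun x => monomial x k) -> newton_of b I (to_real R (k *m b)).
Proof.
move=> II [ha [m [c [m0 cI ceq]]]].
have ca (j : 'I_m) := ideal_analytic (ideal_pow_ideal j.+1 II) (cI j).
pose F (j : 'I_m) x := (-1 * c j x) * monomial x (k *+ (m - j.+1)).
have Fa j : analytic0 (F j).
  by apply: analyticM; [exact: analyticM (analytic_cst r (-1)) (ca j)|exact: analytic_monomial].
have Feq : germ_eq b (fun x => monomial x (k *+ m)) (fun x => \sum_(j < m) F j x).
  apply: (@germ_eq_trans _ _ _ _ _ (fun x => (monomial x k ^+ m + \sum_(j < m) c j x * monomial x k ^+ (m - j.+1)) +
     \sum_(j < m) F j x)).
    apply: germ_eqT; apply: filterE => x; rewrite -addrA -big_split big1 ?addr0.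
      by rewrite monomialMn.
    by move=> j _; rewrite /F /= monomialMn; ring.
  have := germ_eqD ceq (germ_eq_refl b (fun x => \sum_(j < m) F j x)).
  by under [X in germ_eq _ _ X -> _]eq_fun do rewrite add0r.
have sm : supp b (taylor (fun x => \sum_(j < m) F j x)) ((k *+ m) *m b).
  have sa := analytic_sum (index_enum 'I_m) Fa.
  apply/(supp_germE b_neq0 _ sa (germ_eq_sym Feq) (taylorP (analytic_monomial R (k *+ m)))).
  by apply/supp_monomial.
have [j] := supp_sum Fa sm.
have ca' : ideal_pow b I j.+1 (fun x => -1 * c j x).
  exact: (idealM (ideal_pow_ideal j.+1 II) (analytic_cst r (-1)) (cI j)).
move=> /(supp_mul b_neq0 (ideal_analytic (ideal_pow_ideal j.+1 II) ca') (analytic_monomial R _)).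
move=> [v1 [v2 [v1s /supp_monomial -> vE]]].
have v1E : v1 = (k *+ j.+1) *m b.
  apply: (@addkI _ ((k *+ (m - j.+1)) *m b)).
  by rewrite addrC -vE -mulmxDl -mulrnDr subnK.
have [w [k' [wI wE]]] := supp_ideal_pow b_neq0 II ca' v1s.
(* The element of [S] is absorbed by the first of the averaged points. *)
pose x (i : 'I_j.+1) := if i == ord0 then to_real R (w i) + to_real R (k' *m b) else to_real R (w i).
have xN i : newton_of b I (x i).
  rewrite /x; case: ifP => _; last exact: newton_mem.
  by apply: newton_gen => //; exact: cone_mul.
have := convex_average (@newton_convex _) xN.
rewrite (_ : \sum_(i < _) x i = j.+1%:R *: to_real R (k *m b)).
  by rewrite scalerA mulVf ?scale1r // pnatr_eq0.
rewrite -to_realMn -mulmx_muln -v1E wE to_realD to_real_sum !big_ord_recl /x eqxx addrAC; congr (_ + _).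
Qed.

Lemma monomial_hull_newton I : is_ideal b I ->
  monomial_hull b (integral_closure b I) `<=` newton_of b I.
Proof.
move=> II; apply: convex_hull_sub => [|_ [k kI <-]]; first exact: newton_convex.
exact: integral_monomial_newton.
Qed.

(** Integral translates [k'] suffice: rounding expresses a real direction of the cone as a convex
    combination of them. *)
Lemma newton_monomial_hull I :
  (forall k k', supp_set b I (k *m b) -> integral_closure b I (fun x => monomial x (k + k'))) ->
  newton_of b I `<=` monomial_hull b (integral_closure b I).
Proof.
move=> h; apply: newton_sub => [|v w [f If fv] wb]; first exact: convex_hull_convex.
have [k kv] := supp_semigroup fv; rewrite -kv in fv *.
apply: cone_in_hull wb; first exact: convex_hull_convex.
by move=> k'; apply: sub_convex_hull; exists (k + k') => //; apply: h; exists f.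
Qed.

End NewtonPolyhedra.

(** * Decay along curves *)

Section Decay.
Variables (R : realType) (r n : nat) (b : 'M[nat]_(r, n)).
Hypothesis b_neq0 : forall i, row i b != 0.
Local Notation C := R[i].
Local Notation Cr := 'rV[R[i]]_r.
Implicit Types (f g h : Cr -> C) (I : set (Cr -> C)) (M : R).
Variable x : nat -> Cr.
Hypothesis x_toric : forall s, toric_variety b (x s).
Hypothesis x_small : forall e : R, 0 < e -> \forall s \near \oo, forall i, nc (x s 0 i) < e.
Local Opaque germ_eq has_taylor taylor.

Definition decays f M : Prop :=
  forall e, 0 < e -> \forall s \near \oo, nc (f (x s)) <= e * M ^+ s.

Lemma near_along (P : set 'rV[C^o]_r) : (\forall y \near (0 : 'rV[C^o]_r), P y) ->
  \forall s \near \oo, P (x s).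
Proof. by move=> /near0P[e e0 h]; apply: filterS (x_small e0) => s; exact: h. Qed.

Lemma analytic_bounded f : analytic0 f -> exists2 B : R, 0 < B &
  \forall s \near \oo, nc (f (x s)) <= B.
Proof.
move=> [a /has_taylor_radius[rho rho0 [[M aM] fa]]].
exists (M + 1); first by have := bnd_ge0 aM; lra.
apply: filterS (x_small rho0) => s xs.
have xs' i : nc (x s 0 i) <= rho by exact: ltW.
have := hassum_le (bnd_at aM (fun i => _ : nc (x s 0 i) <= const_mx rho 0 i)) (fa _ xs').
by move=> /(_ (fun i => eq_ind_r (fun t => nc (x s 0 i) <= t) (xs' i) (mxE _ _ _ _))); lra.
Qed.

Lemma decaysM f g M M' B : 0 <= M -> 0 <= M' -> decays f M ->
  (\forall s \near \oo, nc (g (x s)) <= B * M' ^+ s) -> decays (fun y => f y * g y) (M * M').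
Proof.
move=> M0 M'0 fM gM e e0; have B0 : 0 < `|B| + 1 by rewrite ltr_wpDl.
apply: filterS2 (fM _ (divr_gt0 e0 B0)) gM => s fs gs.
rewrite ncM exprMn; apply: (@le_trans _ _ (e / (`|B| + 1) * M ^+ s * ((`|B| + 1) * M' ^+ s))).
  apply: ler_pM => //; try exact: nc_ge0.
  apply: (le_trans gs); rewrite ler_wpM2r ?exprn_ge0 //.
  by rewrite (le_trans (ler_norm B)) // lerDl.
rewrite le_eqVlt; apply/orP; left; apply/eqP; field.
by rewrite gt_eqF.
Qed.

Lemma decays_bound f M : decays f M -> \forall s \near \oo, nc (f (x s)) <= 1 * M ^+ s.
Proof. by move=> /(_ 1 ltr01). Qed.

Lemma decays0 M : 0 <= M -> decays (fun=> 0) M.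
Proof.
move=> M0 e e0; apply: filterE => s.
by rewrite nc0 mulr_ge0 ?exprn_ge0 // ltW.
Qed.

Lemma decaysD f g M : decays f M -> decays g M -> decays (fun y => f y + g y) M.
Proof.
move=> fM gM e e0; have e2 : 0 < e / 2 by rewrite divr_gt0.
apply: filterS2 (fM _ e2) (gM _ e2) => s fs gs.
by rewrite (le_trans (ncD _ _)) // (le_trans (lerD fs gs)) // -mulrDl -splitr.
Qed.

Lemma decays_sum (T : Type) (s : seq T) (F : T -> Cr -> C) M : 0 <= M ->
  (forall i, decays (F i) M) -> decays (fun y => \sum_(i <- s) F i y) M.
Proof.
move=> M0 h; elim: s => [|i s IH].
  by rewrite (_ : (fun y => _) = fun=> 0) ?funeqE; [exact: decays0|move=> y; rewrite big_nil].
rewrite (_ : (fun y => _) = (fun y => F i y + \sum_(j <- s) F j y)); first exact: decaysD.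
by apply/funext => y; rewrite big_cons.
Qed.

Lemma decays_germ f g M : germ_eq b f g -> decays f M -> decays g M.
Proof.
move=> fg fM e e0; apply: filterS2 (near_along fg) (fM e e0) => s fgs.
by rewrite fgs.
Qed.

Lemma decays_ideal M : 0 <= M -> is_ideal b [set f | analytic0 f /\ decays f M].
Proof.
move=> M0; split.
- by move=> f [].
- move=> f g ga fg [fa fM]; split; first exact: ga.
  exact: (decays_germ fg fM).
- by split; [exact: (analytic_cst r 0)|exact: decays0].
- move=> f g [fa fM] [ga gM]; split; first exact: (analyticD fa ga).
  exact: decaysD.
- move=> f g fa [ga gM]; split; first exact: (analyticM fa ga).
  have [B B0 fB] := analytic_bounded fa.
  rewrite (_ : (fun y => f y * g y) = (fun y => g y * f y)); last first.
    by apply/funext => y; rewrite mulrC.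
  rewrite -(mulr1 M); apply: (decaysM M0 ler01 gM (B := B)).
  by apply: filterS fB => s; rewrite expr1n mulr1.
Qed.

(** The number of factors is a successor because the empty product 1 is not o(1). *)
Lemma decays_prod m (u : 'I_m.+1 -> Cr -> C) M : 0 <= M -> (forall j, decays (u j) M) ->
  decays (fun y => \prod_(j < m.+1) u j y) (M ^+ m.+1).
Proof.
move=> M0; elim: m u => [|m IH] u uM.
  by rewrite (_ : (fun y => _) = u ord0) //; apply/funext => y; rewrite big_ord1.
rewrite (_ : (fun y => _) = fun y => u ord0 y * \prod_(j < m.+1) u (lift ord0 j) y); last first.
  by apply/funext => y; rewrite big_ord_recl.
rewrite exprS; apply: (decaysM M0 (exprn_ge0 _ M0) (uM ord0) (decays_bound _)).
by apply: IH => j; exact: uM.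
Qed.

Lemma decays_ideal_pow I m f M : 0 <= M -> is_ideal b I -> (forall g, I g -> decays g M) ->
  ideal_pow b I m.+1 f -> decays f (M ^+ m.+1).
Proof.
move=> M0 II IM If.
suff [] : [set f | analytic0 f /\ decays f (M ^+ m.+1)] f by [].
apply: (ideal_gen_sub (decays_ideal (exprn_ge0 _ M0)) _ If) => h [u Iu hE].
split; first by apply: (ideal_pow_gen_analytic II); exists u.
by rewrite hE; apply: decays_prod => // j; apply: IM; exact: Iu.
Qed.

(* The leading coefficient of an integral equation cannot be cancelled when
   the coefficients c_j in I^j decay faster than the powers of h. *)
Lemma integral_decay I h M Z : 0 < M -> 0 < Z -> is_ideal b I ->
  (forall g, I g -> decays g M) -> (\forall s \near \oo, nc (h (x s)) = Z * M ^+ s) ->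
  ~ integral_closure b I h.
Proof.
move=> M0 Z0 II IM hZ [ha [m [c [m0 cI ceq]]]].
have hX p : \forall s \near \oo, nc (h (x s) ^+ p) = Z ^+ p * (M ^+ p) ^+ s.
  by apply: filterS hZ => s hs; rewrite ncX hs exprMn -!exprM mulnC.
have cd (j : 'I_m) : decays (fun y => c j y * h y ^+ (m - j.+1)) (M ^+ m).
  have -> : M ^+ m = M ^+ j.+1 * M ^+ (m - j.+1) by rewrite -exprD subnKC.
  have cj := decays_ideal_pow (ltW M0) II IM (cI j).
  apply: (decaysM (exprn_ge0 _ (ltW M0)) (exprn_ge0 _ (ltW M0)) cj (B := Z ^+ (m - j.+1))).
  by apply: filterS (hX (m - j.+1)%N) => s ->.
have := decays_sum (index_enum 'I_m) (exprn_ge0 m (ltW M0)) cd.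
have Zm : 0 < Z ^+ m / 2 by rewrite divr_gt0 ?exprn_gt0.
move=> /(_ _ Zm) S; have eqs := near_along ceq.
have [s [cs [hs /(_ (x_toric s))]]] := filter_ex (filterI S (filterI (hX m) eqs)).
move=> /eqP; rewrite addr_eq0 => /eqP hE; move: cs.
rewrite -[leLHS]ncN -hE hs ler_pM2r ?exprn_gt0 //.
have := Zm; lra.
Qed.

End Decay.

(** * From the equality of polyhedra to non-degeneracy *)

Section Faces.
Variables (R : realType) (r n : nat) (b : 'M[nat]_(r, n)).
Hypothesis b_neq0 : forall i, row i b != 0.
Local Notation C := R[i].
Local Notation Cr := 'rV[R[i]]_r.
Local Notation K := 'rV[nat]_r.
Implicit Types (I : set (Cr -> C)) (A D : set 'rV[R]_n) (a : K -> C) (v : 'rV[R]_n)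
  (w : 'rV[nat]_n) (z : 'rV[C]_n).
Local Opaque germ_eq has_taylor taylor.

Lemma coefS_restrict A a w : coefS b (restrict_series b A a) w =
  if `[< supp b a w /\ A (to_real R w) >] then coefS b a w else 0.
Proof.
case: asboolP => h.
  by apply: eq_fsbigr => k /set_mem /= kw; rewrite /restrict_series kw asboolT.
by rewrite /coefS fsbig1 // => k /= kw; rewrite /restrict_series kw asboolF.
Qed.

Lemma LmapE A a z : Lmap b (restrict_series b A a) z =
  \sum_(w \in [set w | supp b a w /\ A (to_real R w)]) coefS b a w * monomial z w.
Proof.
rewrite /Lmap; have -> : supp b (restrict_series b A a) = [set w | supp b a w /\ A (to_real R w)].
  have E w : supp b (restrict_series b A a) w = (coefS b (restrict_series b A a) w != 0) by [].
  apply/seteqP; split=> w; rewrite E coefS_restrict; case: asboolP => //.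
    by rewrite eqxx.
  by move=> h _; exact: h.1.
apply: eq_fsbigr => w /set_mem h; rewrite coefS_restrict asboolT //.
Qed.

Definition exp_weights v : 'rV[R]_n := \row_j expR (- v 0 j).

Lemma monomial_exp_weights v w : monomial (exp_weights v) w = expR (- pairing (to_real R w) v).
Proof.
rewrite pairingE -sumrN expR_sum; apply: eq_bigr => j _.
by rewrite mxE -expRM_natl !mxE mulrN.
Qed.

Lemma monomial_exp_weights_le v w l :
  (monomial (exp_weights v) w <= expR (- l)) = (l <= pairing (to_real R w) v).
Proof. by rewrite monomial_exp_weights ler_expR lerN2. Qed.

Lemma monomial_exp_weights_eq v w l :
  monomial (exp_weights v) w = expR (- l) <-> pairing (to_real R w) v = l.
Proof. by rewrite monomial_exp_weights; split=> [/expR_inj/oppr_inj|->]. Qed.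

Lemma cone_row i : cone R b (to_real R (row i b)).
Proof. by rewrite rowE; exact: cone_mul. Qed.

Lemma coneZ t v : 0 <= t -> cone R b v -> cone R b (t *: v).
Proof.
move=> t0 [c c0 <-]; exists (t *: c); last by rewrite scalemxAl.
by move=> i; rewrite mxE mulr_ge0.
Qed.

(** If [b_i] paired to zero with [v], the ray from [x] in its direction would stay in the face, and
    a coordinate would exceed any bound. *)
Lemma compact_face_positive (A : set 'rV[nat]_n) v l x : dual_cone b v ->
  newton_polyhedron b A x -> pairing x v = l ->
  compact [set y | newton_polyhedron b A y /\ pairing y v = l] ->
  forall i, 0 < pairing (to_real R (row i b)) v.
Proof.
move=> vb Ax xl cD i; have := vb _ (cone_row i); rewrite pairingC le_eqVlt => /orP[/eqP p0|//].
have [M [_ hM]] := compact_bounded cD.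
have {}hM y : newton_polyhedron b A y -> pairing y v = l -> `|y| <= M + 1.
  by move=> h1 h2; apply: (hM (M + 1)) => //; rewrite ltrDl.
have [j bij] : exists j, (0 < b i j)%N.
  apply: contrapT => nex; move/negP: (b_neq0 i); apply; apply/eqP/rowP => j.
  rewrite !mxE; apply/eqP; rewrite -leqn0 leqNgt; apply/negP => h; apply: nex.
  by exists j.
pose t := `|M + 1| + `|x 0 j| + 1.
have t0 : 0 <= t by rewrite !addr_ge0.
have := hM (x + t *: to_real R (row i b)).
rewrite pairingDl pairingZl -p0 mulr0 addr0 => /(_ _ xl)/wrap[|le].
  by apply: newton_add => //; apply: coneZ => //; exact: cone_row.
have : `|(x + t *: to_real R (row i b)) 0 j| <= M + 1.
  by apply: le_trans le; rewrite [leRHS]mx_normrE; exact: (le_bigmax _ _ (0, j)).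
rewrite !mxE => le'; have := ler_norm (M + 1); have := ler_norm (- x 0 j); rewrite normrN.
have := le_trans (ler_norm _) le'.
have b1 : (1 : R) <= (b i j)%:R by rewrite ler1n.
have : t <= t * (b i j)%:R by rewrite ler_peMr.
by rewrite /t; lra.
Qed.

Lemma nondegenerate_of_newton_eq I : is_ideal b I ->
  newton_of b I = monomial_hull b (integral_closure b I) -> nondegenerate_ideal b I.
Proof.
move=> II NE; have [m [g [Ig gI]]] := noetherian b_neq0 II.
have ga i := ideal_analytic II (Ig i).
have Iga : range g `<=` @analytic0 R r by move=> _ [i _ <-]; exact: ga.
have IE : I = ideal_gen b (range g).
  apply/seteqP; split.
    move=> f If; have [q [qa fq]] := gI f If.
    have JI := ideal_gen_ideal b Iga.
    apply: (ideal_germ JI (ideal_analytic II If) (germ_eq_sym fq)).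
    apply: (ideal_sum _ JI) => i; apply: (idealM JI (qa i)).
    by apply: sub_ideal_gen; exists i.
  by apply: ideal_gen_sub => // _ [i _ <-]; exact: Ig.
exists m, g; split=> // D [v [l [vb [x0 x0N x0l] lmin DE]]] cD [z [zT zL]].
have NgE : newton_of b (range g) = newton_of b I by rewrite IE newton_ideal_gen.
rewrite DE in cD; have vpos := compact_face_positive vb x0N x0l cD.
(* Otherwise the monomials of the integral closure all lie strictly above level [l], and so does
   their hull, which contains [x0]. *)
have [k kI kl] : exists2 k, integral_closure b I (fun x => monomial x k) &
    pairing (to_real R (k *m b)) v = l.
  apply: contrapT => nex.
  have : monomial_hull b (integral_closure b I) x0 by rewrite -NE -NgE.
  have sub : monomial_hull b (integral_closure b I) `<=` [set x : 'rV[R]_n | l < pairing x v].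
    apply: convex_hull_sub => [|_ [k kI <-]]; first exact: open_halfspace_convex.
    rewrite /= lt_neqAle; apply/andP; split.
      by apply/eqP => kl; apply: nex; exists k.
    by apply: lmin; rewrite NgE; exact: integral_monomial_newton.
  by move=> /sub; rewrite /= x0l ltxx.
pose om := exp_weights v; pose mu := expR (- l); have mu0 : 0 < mu by exact: expR_gt0.
have om0 j : 0 < om 0 j by rewrite mxE expR_gt0.
have om1 i : monomial om (row i b) < 1.
  by rewrite monomial_exp_weights -expR0 ltr_expR oppr_lt0.
pose x s := par b (curve z om s).
have x_toric s : toric_variety b (x s) by exact: par_toric.
have x_small e : 0 < e -> \forall s \near \oo, forall i, nc (x s 0 i) < e.
  move=> e0; have e2 : 0 < e / 2 by rewrite divr_gt0.
  have [N hN] := par_curve_small z om0 om1 e2.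
  exists N => // s /= /hN h i; rewrite (le_lt_trans (h i)) //; lra.
have g_decays i : decays x (g i) mu.
  move=> e e0.
  have gN w : coefS b (taylor (g i)) w != 0 -> l <= pairing (to_real R w) v.
    by move=> gw; apply: lmin; apply: newton_mem; exists (g i); [exists i|].
  have [N hN] := asymptotics b_neq0 z (taylorP (ga i)) om0 om1 mu0
    (fun w gw => eq_ind_r is_true (gN w gw) (monomial_exp_weights_le v w l)) e0.
  exists N => // s /= /hN; set E := \sum_(_ \in _) _.
  (* [E] is [L((g i)_D)(z)]: weight [mu] means level [l], that is, membership in the face. *)
  suff -> : E = 0 by rewrite mul0r subr0.
  rewrite -(zL i) LmapE /E; apply: eq_fsbigl; apply/seteqP; split=> w /= [gw h]; split=> //.
    rewrite DE; split; first by apply: newton_mem; exists (g i); [exists i|].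
    by apply/monomial_exp_weights_eq.
  by move: h; rewrite DE => -[_ h]; apply/monomial_exp_weights_eq.
have I_decays f : I f -> decays x f mu.
  rewrite IE => If; suff [] : [set f | analytic0 f /\ decays x f mu] f by [].
  apply: (ideal_gen_sub (decays_ideal x_toric x_small (ltW mu0)) _ If) => _ [i _ <-].
  by split; [exact: ga|exact: g_decays].
have Z0 : 0 < nc (monomial z (k *m b)).
  by rewrite lt_neqAle nc_ge0 andbT eq_sym nc_eq0; exact: monomial_torus.
apply: (integral_decay x_toric x_small mu0 Z0 II I_decays _ kI).
apply: filterE => s; rewrite /x monomial_par monomial_curve ncM nc_real ?exprn_ge0 //.
  by congr (_ * _ ^+ _); apply/monomial_exp_weights_eq.
by rewrite monomial_ge0 // => j; rewrite ltW.
Qed.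

End Faces.

(** * Places and weights *)

Section FunctionRings.
Variables (R : realType) (m : nat).
Local Notation C := R[i].

Definition funring : comNzRingType := ('rV[C^o]_m -> C)%type.

Definition cstfun (c : C) : funring := fun=> c.

Lemma cstfun_is_additive : additive cstfun.
Proof. by []. Qed.

Lemma cstfun_is_multiplicative : multiplicative cstfun.
Proof. by []. Qed.

HB.instance Definition _ := GRing.isAdditive.Build C funring cstfun cstfun_is_additive.
HB.instance Definition _ := GRing.isMultiplicative.Build C funring cstfun cstfun_is_multiplicative.

Definition evalfun (x : 'rV[C^o]_m) (f : funring) : C := f x.

Lemma evalfun_is_additive x : additive (evalfun x).
Proof. by []. Qed.

Lemma evalfun_is_multiplicative x : multiplicative (evalfun x).
Proof. by []. Qed.

HB.instance Definition _ x := GRing.isAdditive.Build funring C (evalfun x) (evalfun_is_additive x).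
HB.instance Definition _ x := GRing.isMultiplicative.Build funring C (evalfun x) (evalfun_is_multiplicative x).

(* The junk factor 1 makes every [mon v] invertible on the whole space. *)
Definition mon (v : 'rV[int]_m) : funring :=
  fun z => \prod_j (if z 0 j == 0 then 1 else z 0 j) ^ v 0 j.

Lemma monD v w : mon (v + w) = mon v * mon w.
Proof.
apply/funext => z; rewrite /mon [RHS]/GRing.mul /= -big_split; apply: eq_bigr => j _.
by rewrite mxE expfzDr //; case: ifP => [_|->]; rewrite ?oner_eq0.
Qed.

Lemma mon0 : mon 0 = 1.
Proof. by apply/funext => z; rewrite /mon big1 // => j _; rewrite mxE expr0z. Qed.

Lemma monNr v : mon v * mon (- v) = 1.
Proof. by rewrite -monD subrr mon0. Qed.

Lemma mon_torusE (z : 'rV[C]_m) v : torus z -> mon v z = \prod_j z 0 j ^ v 0 j.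
Proof. by move=> zT; apply: eq_bigr => j _; rewrite (negbTE (zT j)). Qed.

Lemma mon_Posz (z : 'rV[C]_m) (w : 'rV[nat]_m) : torus z ->
  mon (map_mx Posz w) z = monomial z w.
Proof. by move=> zT; rewrite mon_torusE //; apply: eq_bigr => j _; rewrite mxE. Qed.

End FunctionRings.

Arguments mon R {m} v.

Section PlaceGeometry.
Variables (R : realType) (n : nat).
Local Notation C := R[i].
Implicit Types (Phi Psi : set (funring R n * C)) (v w : 'rV[int]_n).

(** Two residues of [p] would put [(0, c - d)], and after scaling [(0, 1)], in the place. *)
Lemma place_functional Phi p c d : place (@cstfun R n) Phi -> Phi (p, c) -> Phi (p, d) -> c = d.
Proof.
move=> [Pc PD PM P01] pc pd; apply: contrapT => /eqP cd; apply: P01.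
have c0 : c - d != 0 by rewrite subr_eq0.
have hN : Phi (0, c - d).
  have -> : (0, c - d) = (p, c) + (@cstfun R n (-1), -1) * (p, d).
    congr pair; rewrite /= ?mulN1r //.
    by rewrite subrr.
  exact: PD pc (PM _ _ (Pc (-1)) pd).
have -> : (0, 1) = (@cstfun R n (c - d)^-1, (c - d)^-1) * (0, c - d) :> funring R n * C.
  by congr pair; rewrite /= ?mulr0 ?mulVf.
exact: (PM _ _ (Pc _) hN).
Qed.

(** Either the quotient of a new monomial by the current minimum or its inverse is adjoined. In the
    second case the new monomial becomes the minimum, and the old quotients are multiplied by the
    adjoined one. *)
Lemma place_minimum Phi (s : seq 'rV[int]_n) : place (@cstfun R n) Phi -> s != [::] ->
  exists Psi w0, [/\ place (@cstfun R n) Psi, Phi `<=` Psi, w0 \in s &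
    forall w, w \in s -> exists c, Psi (mon R (w - w0), c)].
Proof.
move=> PhiP; elim: s => // w [|w' s] IH _.
  exists Phi, w; split=> //; first by rewrite inE.
  move=> w'; rewrite inE => /eqP ->; exists 1; rewrite subrr mon0.
  by case: PhiP => /(_ 1) + _ _ _; rewrite rmorph1.
have [//|Psi [w0 [PsiP PhiPsi w0s hw0]]] := IH.
have [Psi' [al [Psi'P PsiPsi' hal]]] := place_extend PsiP (monNr R (w - w0)).
have [_ _ PM _] := Psi'P.
case: hal => hal.
  exists Psi', w0; split=> //; first exact: subset_trans PsiPsi'.
    by rewrite inE w0s orbT.
  move=> v; rewrite inE => /orP[/eqP ->|/hw0[c hc]]; first by exists al.
  by exists c; exact: PsiPsi'.
exists Psi', w; split=> //; first exact: subset_trans PsiPsi'.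
  by rewrite inE eqxx.
move=> v; rewrite inE => /orP[/eqP ->|/hw0[c hc]].
  by exists 1; rewrite subrr mon0; case: Psi'P => /(_ 1); rewrite rmorph1.
exists (c * al); have := PM _ _ (PsiPsi' _ hc) hal.
by rewrite -[_ * _]/(mon R (v - w0) * mon R (- (w - w0)), c * al) -monD opprB addrA subrK.
Qed.

Section OnePlace.
Variable Psi : set (funring R n * C).
Hypothesis PsiP : place (@cstfun R n) Psi.

Lemma placeM v w c d : Psi (mon R v, c) -> Psi (mon R w, d) -> Psi (mon R (v + w), c * d).
Proof. by move=> h h'; rewrite monD; case: PsiP => _ _ PM _; exact: PM _ _ h h'. Qed.

Lemma place1 : Psi (mon R 0, 1).
Proof. by rewrite mon0; case: PsiP => /(_ 1); rewrite rmorph1. Qed.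

(* With their residues, the monomials of value zero; then those of positive value. *)
Definition unit_ratio : set ('rV[int]_n * C) :=
  [set p | exists v1 v2 c1 c2, [/\ Psi (mon R v1, c1), Psi (mon R v2, c2), c1 != 0, c2 != 0 &
    p = (v1 - v2, c1 / c2)]].

Definition positive_ratio : set 'rV[int]_n :=
  [set v | exists v1 v2 c2, [/\ Psi (mon R v1, 0), Psi (mon R v2, c2), c2 != 0 & v = v1 - v2]].

(** Ratios are needed for closure under opposites: a monomial with nonzero residue need not have its
    inverse in the domain of [Psi]. *)
Lemma unit_ratio_character : partial_character unit_ratio.
Proof.
split.
- by exists 0, 0, 1, 1; rewrite subrr divr1 oner_eq0; split=> //; exact: place1.
- move=> _ _ _ _ [v1 [v2 [c1 [c2 [h1 h2 n1 n2 [-> ->]]]]]] [w1 [w2 [d1 [d2 [k1 k2 m1 m2 [-> ->]]]]]].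
  exists (v1 + w1), (v2 + w2), (c1 * d1), (c2 * d2); split; rewrite ?mulf_neq0 //; try exact: placeM.
  by rewrite opprD addrACA invfM mulrACA.
- move=> _ _ [v1 [v2 [c1 [c2 [h1 h2 n1 n2 [-> ->]]]]]]; split; last by rewrite mulf_neq0 // invr_eq0.
  by exists v2, v1, c2, c1; rewrite opprB invf_div; split.
- move=> c [v1 [v2 [c1 [c2 [h1 h2 n1 n2 [/esym/eqP]]]]]]; rewrite subr_eq0 => /eqP vE ->.
  by rewrite vE in h1; rewrite (place_functional PsiP h1 h2) divff.
Qed.

Lemma positive_ratio_neq0 : ~ positive_ratio 0.
Proof.
move=> [v1 [v2 [c2 [h1 h2 n2 /esym/eqP]]]]; rewrite subr_eq0 => /eqP vE.
by rewrite vE in h1; move/eqP: n2; apply; rewrite (place_functional PsiP h1 h2).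
Qed.

Lemma positive_ratioD v w : positive_ratio v -> positive_ratio w -> positive_ratio (v + w).
Proof.
move=> [v1 [v2 [c2 [h1 h2 n2 ->]]]] [w1 [w2 [d2 [k1 k2 m2 ->]]]].
exists (v1 + w1), (v2 + w2), (c2 * d2); split; rewrite ?mulf_neq0 //; last by rewrite opprD addrACA.
  by rewrite -[0](mulr0 0); exact: placeM.
exact: placeM.
Qed.

Lemma positive_unit_ratioD v w c : positive_ratio v -> unit_ratio (w, c) -> positive_ratio (v + w).
Proof.
move=> [v1 [v2 [c2 [h1 h2 n2 ->]]]] [w1 [w2 [d1 [d2 [k1 k2 m1 m2 [-> _]]]]]].
exists (v1 + w1), (v2 + w2), (c2 * d2); split; rewrite ?mulf_neq0 //; last by rewrite opprD addrACA.
  by rewrite -[0](mul0r d1); exact: placeM.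
exact: placeM.
Qed.

Lemma unit_ratio_mon v c : Psi (mon R v, c) -> c != 0 -> unit_ratio (v, c).
Proof.
move=> h c0; exists v, 0, c, 1; rewrite subr0 divr1 oner_eq0; split=> //; exact: place1.
Qed.

(** A certificate of the transposition theorem would make 0 a nonempty sum of exponents of positive
    value plus one of value zero, against [positive_ratio_neq0]. *)
Lemma place_separation (sP sE : seq 'rV[int]_n) : (forall p, p \in sP -> Psi (mon R p, 0)) ->
  (forall e, e \in sE -> exists2 c, c != 0 & Psi (mon R e, c)) ->
  exists v : 'rV[rat]_n, (forall p, p \in sP -> 0 < qpair p v) /\
    (forall e, e \in sE -> qpair e v = 0).
Proof.
move=> hP hE.
have [[v [vP vE]]|[al [ga [h [i0 ai0]]]]] := motzkin
  (fun i : 'I_(size sP) => nth 0 sP i) (fun j : 'I_(size sE) => nth 0 sE j).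
  exists v; split=> w /[dup] ws /(nth_index 0) <-.
    have wi : (index w sP < size sP)%N by rewrite index_mem.
    exact: (vP (Ordinal wi)).
  have wi : (index w sE < size sE)%N by rewrite index_mem.
  exact: (vE (Ordinal wi)).
have [U0 UD UN _] := unit_ratio_character.
have pos (i : 'I_(size sP)) : positive_ratio (nth 0 sP i).
  exists (nth 0 sP i), 0, 1; rewrite subr0 oner_eq0; split=> //; last exact: place1.
  by apply: hP; exact: mem_nth.
have posMn v q : positive_ratio v -> q != 0%N -> positive_ratio (v *+ q).
  move=> hv; elim: q => [//|[|q] IH _]; first by rewrite mulr1n.
  by rewrite mulrS; apply: positive_ratioD => //; exact: IH.
exfalso; apply: positive_ratio_neq0; rewrite -h.
suff [c hc] : exists c, unit_ratio (\sum_(j < size sE) nth 0 sE j *~ ga j, c).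
  apply: positive_unit_ratioD hc; rewrite (bigD1 i0) //=.
  elim/big_rec: _ => [|i v _ hv]; first by rewrite addr0; exact: posMn.
  have [->|ai] := eqVneq (al i) 0%N; first by rewrite mulr0n add0r.
  by rewrite addrCA; apply: positive_ratioD => //; exact: posMn.
elim/big_rec: _ => [|j v _ [c hc]]; first by exists 1.
have [d d0 hd] := hE _ (mem_nth 0 (ltn_ord j)).
exists (d ^ ga j * c); apply: UD hc; apply: partial_characterMz; first exact: unit_ratio_character.
exact: unit_ratio_mon.
Qed.

End OnePlace.
End PlaceGeometry.

(** * The residue map of the blow-up algebra *)

Section ReesPlace.
Variables (R : realType) (r n : nat) (b : 'M[nat]_(r, n)).
Hypothesis b_neq0 : forall i, row i b != 0.
Local Notation C := R[i].
Local Notation Cr := 'rV[R[i]]_r.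
Local Notation K := 'rV[nat]_r.
Implicit Types (f g : Cr -> C) (k : K).
Local Opaque germ_eq has_taylor taylor.
Variables (I : set (Cr -> C)) (k0 : K).
Hypothesis II : is_ideal b I.

Definition expo (k : K) : 'rV[int]_n := map_mx Posz (k *m b).

Lemma expoD k l : expo (k + l) = expo k + expo l.
Proof. by rewrite /expo mulmxDl; apply/rowP => j; rewrite !mxE. Qed.

Lemma mon_expo (z : 'rV[C]_n) k : torus z -> mon R (expo k) z = monomial (par b z) k.
Proof. by move=> zT; rewrite mon_Posz // monomial_par. Qed.

Definition torus_eq (p q : funring R n) : Prop :=
  \forall z \near (0 : 'rV[C^o]_n), torus z -> p z = q z.

(** The variable stands for [x^(-k0)]; with coefficients of degree [j] in [I^j] this gives the
    elements of [O[I / x^k0]]. *)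
Definition rees_eval (z : 'rV[C^o]_n) (P : {poly funring R r}) : C :=
  (map_poly (evalfun (par b z : 'rV[C^o]_r)) P).[mon R (- expo k0) z].

(* The graph, on the blow-up algebra O[I / x^k0], of the residue map at the
   ideal generated by I / x^k0 and the maximal ideal of O. *)
Definition rees_place : set (funring R n * C) :=
  [set p | exists P : {poly funring R r}, [/\ forall j, ideal_pow b I j P`_j,
    p.2 = P`_0 0 & torus_eq p.1 (fun z => rees_eval z P)]].

Lemma rees_analytic f (p : funring R n) : analytic0 f -> torus_eq p (fun z => f (par b z)) ->
  rees_place (p, f 0).
Proof.
move=> fa pf; exists (f : funring R r)%:P; split.
- move=> [|j]; rewrite coefC /=; first exact: ideal_pow0.
  exact: (ideal0 (ideal_pow_ideal _ II)).
- by rewrite coefC.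
- by apply: filterS pf => z h zT; rewrite /= h // /rees_eval map_polyC hornerC.
Qed.

Lemma rees_fraction f : I f -> rees_place (fun z => f (par b z) * mon R (- expo k0) z, 0).
Proof.
move=> If; exists ((f : funring R r)%:P * 'X); split.
- move=> j; rewrite coefMX coefC; case: j => [|[|j]] /=.
  + exact: (ideal0 (ideal_pow_ideal _ II)).
  + exact: ideal_pow1.
  + exact: (ideal0 (ideal_pow_ideal _ II)).
- by rewrite coefMX.
- by apply: filterE => z zT; rewrite /rees_eval rmorphM /= map_polyC map_polyX hornerMX hornerC.
Qed.

(** Residue 1 for 0 means a relation [sum_j P_j x^(-j k0) = 0] with [P_j] in [I^j] and [P_0] a unit.
    Clearing denominators and dividing by [P_0] gives an equation of integral dependence for
    [x^k0]. *)
Lemma rees_consistent : ~ integral_closure b I (fun x => monomial x k0) -> ~ rees_place (0, 1).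
Proof.
move=> nint [P [PI P01 Pz]]; apply: nint; split; first exact: analytic_monomial.
(* The size rather than the degree is the order of the equation: it is positive, and the extra
   coefficient [P_m] is 0. *)
pose m := size P; pose h (x : Cr) : C := monomial x k0.
have Pa j : analytic0 (P`_j : Cr -> C) := ideal_analytic (ideal_pow_ideal j II) (PI j).
have ha : analytic0 h by exact: analytic_monomial.
have m0 : (0 < m)%N.
  rewrite size_poly_gt0; apply/eqP => P0; move/eqP: P01; rewrite P0 coef0.
  by rewrite oner_eq0.
pose F x := \sum_(j < m.+1) (P`_j : Cr -> C) x * h x ^+ (m - j).
have Fa : analytic0 F.
  by apply: analytic_sum => j; apply: analyticM; [exact: Pa|exact: analyticX].
have F0 : germ_eq b F (fun=> 0).
  apply: (germ_eq_torus b_neq0 Fa (analytic_cst r 0)); apply: filterS Pz => z /[swap] zT /(_ zT) /= Pz0.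
  have hy : h (par b z) * mon R (- expo k0) z = 1.
    by rewrite /h -mon_expo // -[RHS](congr1 (fun q : funring R n => q z) (monNr R (expo k0))).
  have sP : (size (map_poly (evalfun (par b z : 'rV[C^o]_r)) P) <= m.+1)%N.
    by rewrite (leq_trans (size_poly _ _)).
  rewrite -[RHS](mulr0 (h (par b z) ^+ m)) [X in _ = _ * X]Pz0 /rees_eval.
  rewrite (horner_coef_wide _ sP) mulr_sumr; apply: eq_bigr => j _.
  rewrite coef_map /= mulrCA; congr (_ * _).
  have jm : (j <= m)%N by rewrite -ltnS.
  by move: (nat_of_ord j) jm => d /subnK {2}<-; rewrite exprD -mulrA -exprMn hy expr1n mulr1.
have P0n0 : (P`_0 : Cr -> C) 0 != 0 by rewrite -P01 oner_eq0.
have [e ea eP] := analytic_inverse (Pa 0%N) P0n0.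
exists m, (fun (j : 'I_m) x => e x * (P`_j.+1 : Cr -> C) x); split=> //.
  by move=> j; exact: (idealM (ideal_pow_ideal _ II) ea (PI _)).
have eF := germ_eqM (germ_eq_refl b e) F0.
have E1 : germ_eq b (fun x => h x ^+ m + \sum_(j < m) e x * (P`_j.+1 : Cr -> C) x * h x ^+ (m - j.+1))
    (fun x => e x * F x).
  apply: germ_eqT; apply: filterS eP => x ex; rewrite /F big_ord_recl subn0 mulrDr mulrA.
  rewrite [e x * _]mulrC ex mul1r; congr (_ + _); rewrite mulr_sumr.
  by apply: eq_bigr => j _; rewrite mulrA.
apply: germ_eq_trans E1 _; move: eF.
by under [X in germ_eq _ _ X -> _]eq_fun do rewrite mulr0.
Qed.

Lemma rees_is_place : ~ integral_closure b I (fun x => monomial x k0) ->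
  place (@cstfun R n) rees_place.
Proof.
move=> nint; split; last exact: rees_consistent.
- by move=> c; apply: (rees_analytic (analytic_cst r c)); exact: filterE.
- move=> [p c] [q d] [P [PI /= -> Pz]] [Q [QI /= -> Qz]]; exists (P + Q); split.
  + by move=> j; rewrite coefD; exact: (idealD (ideal_pow_ideal _ II) (PI j) (QI j)).
  + by rewrite coefD.
  + apply: filterS2 Pz Qz => z hP hQ zT.
    by rewrite -[LHS]/(p z + q z) hP // hQ // /rees_eval rmorphD hornerD.
- move=> [p c] [q d] [P [PI /= -> Pz]] [Q [QI /= -> Qz]]; exists (P * Q); split.
  + move=> j; rewrite coefM.
    rewrite (_ : \sum_(i < j.+1) P`_i * Q`_(j - i) =
      fun x => \sum_(i < j.+1) (P`_i : Cr -> C) x * (Q`_(j - i) : Cr -> C) x); last first.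
      by apply/funext => x; rewrite -[LHS]/(evalfun x _) rmorph_sum.
    apply: (ideal_sum _ (ideal_pow_ideal j II)) => i.
    by have := ideal_powM II (PI i) (QI (j - i)%N); rewrite subnKC // -ltnS.
  + by rewrite coefM big_ord1.
  + apply: filterS2 Pz Qz => z hP hQ zT.
    by rewrite -[LHS]/(p z * q z) hP // hQ // /rees_eval rmorphM hornerM.
Qed.

End ReesPlace.

Section FiniteDecomposition.
Variables (R : realType) (r : nat).
Local Notation C := R[i].
Local Notation Cr := 'rV[R[i]]_r.
Local Notation K := 'rV[nat]_r.
Local Opaque germ_eq has_taylor taylor.

(** The terms at [s] are removed before the monomial division, which is what makes the quotients
    vanish at 0, hence have residue zero later. *)
Lemma finite_decomposition (f : Cr -> C) (a : K -> C) (s : seq K) : uniq s -> has_taylor f a ->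
  (forall k, a k != 0 -> exists2 l, l \in s & lek l k) ->
  exists q : 'I_(size s) -> Cr -> C, [/\ forall i, analytic0 (q i), forall i, q i 0 = 0 &
    \forall x \near (0 : 'rV[C^o]_r),
      f x = \sum_(k <- s) a k * monomial x k + \sum_(i < size s) monomial x (nth 0 s i) * q i x].
Proof.
move=> us fa as_.
have sT : has_taylor (fun x : Cr => \sum_(i < size s) a (nth 0 s i) * monomial x (nth 0 s i))
    (fun k => \sum_(i < size s) a (nth 0 s i) * (k == nth 0 s i)%:R).
  by apply: has_taylor_sum => i; apply: has_taylorZ; exact: has_taylor_monomial.
have aE k : \sum_(i < size s) a (nth 0 s i) * (k == nth 0 s i)%:R = if k \in s then a k else 0.
  transitivity (\sum_(l <- s) a l * (k == l)%:R); first by rewrite (big_nth 0) big_mkord.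
  case: ifP => ks; last first.
    rewrite big_seq big1 // => l ls; have [kl|] := eqVneq k l; last by rewrite mulr0.
    by rewrite kl ls in ks.
  rewrite (bigD1_seq k) //= eqxx mulr1 big1 ?addr0 // => l lk.
  by rewrite eq_sym (negbTE lk) mulr0.
pose e (i : 'I_(size s)) : K := nth 0 s i.
pose g k : C := a k - \sum_(i < size s) a (nth 0 s i) * (k == nth 0 s i)%:R.
have [q [rm [qa rma fE]]] : exists q rm, [/\ forall i, has_taylor (q i) (mquo e g i),
    has_taylor rm (mrem e g) & \forall x \near (0 : 'rV[C^o]_r),
    f x - \sum_(i < size s) a (nth 0 s i) * monomial x (nth 0 s i) =
    \sum_i monomial x (e i) * q i x + rm x] := monomial_division e (has_taylorB fa sT).
have gE k : g k = if k \in s then 0 else a k.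
  by rewrite /g aE; case: ifP => _; rewrite ?subrr ?subr0.
exists q; split=> [i|i|].
- by eexists; exact: qa.
- rewrite (has_taylor_at0 (qa i)) /mquo; case: ifP => // _.
  by rewrite gE addr0 mem_nth.
have rm0 : has_taylor rm (fun=> 0).
  rewrite (_ : (fun=> 0) = mrem e g) //; apply/funext => k; apply/esym/eqP.
  apply: contrapT => /negP nz; have gk : mrem e g k = g k by move: nz; rewrite /mrem; case: (divisor _ _) => //; rewrite eqxx.
  move: (nz); rewrite gk gE; case: ifP => [_|_ /as_[l ls lk]]; first by rewrite eqxx.
  have li : (index l s < size s)%N by rewrite index_mem.
  by have := mrem_neq0 (Ordinal li) nz; rewrite /e /= nth_index // lk.
have z0 : has_taylor (fun _ : Cr => 0 : C) (fun=> 0).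
  have := has_taylorZ 0 rm0; under eq_fun do rewrite mul0r.
  by under [X in has_taylor _ X]eq_fun do rewrite mul0r.
have rmE := has_taylor_unique_fun rm0 z0.
apply: filterS2 fE rmE => x + rmx; rewrite rmx addr0 => hx.
by rewrite -[RHS]/(_ + \sum_i monomial x (e i) * q i x) -hx (big_nth 0) big_mkord addrC subrK.
Qed.

End FiniteDecomposition.

Section PlaceRelation.
Variables (R : realType) (r n : nat) (b : 'M[nat]_(r, n)).
Hypothesis b_neq0 : forall i, row i b != 0.
Local Notation C := R[i].
Local Notation Cr := 'rV[R[i]]_r.
Local Notation K := 'rV[nat]_r.
Local Opaque germ_eq has_taylor taylor.
Variables (I : set (Cr -> C)) (k0 : K) (Psi : set (funring R n * C)).
Hypothesis II : is_ideal b I.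
Hypothesis PsiP : place (@cstfun R n) Psi.
Hypothesis sub_Psi : rees_place b I k0 `<=` Psi.

(** The difference agrees with 0 near the origin of the torus, so the residue place already contains
    it with residue 0. *)
Lemma place_torus_eq (p q : funring R n) c : Psi (p, c) -> torus_eq q p -> Psi (q, c).
Proof.
move=> pc qp; have [_ PD _ _] := PsiP.
have h : Psi (q - p, 0).
  apply: sub_Psi; apply: (rees_analytic k0 II (f := fun=> 0) (analytic_cst r 0)).
  by apply: filterS qp => z h zT; rewrite -[LHS]/(q z - p z) h // subrr.
by have := PD _ _ h pc; rewrite -[_ + _]/((q - p) + p, 0 + c) subrK add0r.
Qed.

Lemma place_analytic f : analytic0 f -> Psi ((fun z => f (par b z)) : funring R n, f 0).
Proof. by move=> fa; apply/sub_Psi/rees_analytic => //; exact: filterE. Qed.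

Lemma place_sum (T : eqType) (s : seq T) (P : T -> funring R n) (c : T -> C) :
  (forall i, i \in s -> Psi (P i, c i)) -> Psi (\sum_(i <- s) P i, \sum_(i <- s) c i).
Proof.
move=> h; have [Pc PD _ _] := PsiP; rewrite big_seq [X in (_, X)]big_seq.
apply: (big_rec2 (fun x y => Psi (x, y))) => [|i x y /h hi hx]; last exact: PD _ _ hi hx.
by have := Pc 0; rewrite rmorph0.
Qed.

Lemma place_expo k : Psi (mon R (expo b k), monomial (0 : Cr) k).
Proof.
have /place_analytic h : analytic0 (fun x : Cr => monomial x k) by exact: analytic_monomial.
apply: (place_torus_eq h); by apply: filterE => z zT; exact: mon_expo.
Qed.

(** The residue of [f / x^w0] is computed twice. It is 0, because [f / x^k0] has residue 0 and
    [x^(k0 - w0)] has a residue, [k0] being above some [l] of [s]. It is also the sum, because the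
    quotients of the finite decomposition vanish at 0. *)
Lemma place_relation (s : seq K) (w0 : 'rV[int]_n) (chi : K -> C) f f' (a : K -> C) :
  uniq s -> (forall k, k \in s -> Psi (mon R (expo b k - w0), chi k)) ->
  (exists2 l, l \in s & lek l k0) -> I f -> germ_eq b f f' -> has_taylor f' a ->
  (forall k, a k != 0 -> exists2 l, l \in s & lek l k) ->
  \sum_(k <- s) a k * chi k = 0.
Proof.
move=> us hchi [l ls lk] If ff' f'a as_; have [Pc PD PM _] := PsiP.
have [q [qa q0 fE]] := finite_decomposition us f'a as_.
pose p1 : funring R n := fun z => f (par b z) * mon R (- w0) z.
have hp1 : Psi (p1, 0).
  have h1 := sub_Psi (rees_fraction k0 II If).
  have h2 := placeM PsiP (hchi l ls) (place_expo (subk k0 l)).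
  have := PM _ _ h1 h2; rewrite -[_ * _]/(_ * _, 0 * _) mul0r => h.
  apply: (place_torus_eq h); apply: filterE => z zT; rewrite /p1.
  rewrite -[RHS]/(f (par b z) * mon R (- expo b k0) z * mon R (expo b l - w0 + expo b (subk k0 l)) z).
  rewrite -mulrA; congr (_ * _).
  rewrite -[RHS]/((mon R (- expo b k0) * mon R (expo b l - w0 + expo b (subk k0 l))) z) -monD.
  by congr (mon R _ z); have := congr1 (expo b) (subkK lk); rewrite expoD => <-; rewrite (addrAC (expo b l)) addKr.
pose P1 k : funring R n := @cstfun R n (a k) * mon R (expo b k - w0).
pose P2 (i : 'I_(size s)) : funring R n := mon R (expo b (nth 0 s i) - w0) * ((fun z => q i (par b z)) : funring R n).
have h1 : Psi (\sum_(k <- s) P1 k, \sum_(k <- s) a k * chi k).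
  by apply: place_sum => k ks; exact: PM _ _ (Pc (a k)) (hchi k ks).
have h2 : Psi (\sum_i P2 i, \sum_(i < size s) 0).
  apply: place_sum => i _; have := PM _ _ (hchi _ (mem_nth 0 (ltn_ord i))) (place_analytic (qa i)).
  by rewrite -[_ * _]/(P2 i, chi (nth 0 s i) * q i 0) q0 mulr0.
have := PD _ _ h1 h2; rewrite -[_ + _]/(_ + _, _ + _) [X in (_, _ + X)]big1 // addr0 => h.
apply: (place_functional PsiP _ hp1); apply: (place_torus_eq h).
have := germ_eq_par b_neq0 ff'; have := near_par b_neq0 fE.
apply: filterS2 => z h3 h4 zT; rewrite /p1 h4 h3 mulrDl.
rewrite -[RHS]/(evalfun z (_ + _)) rmorphD !rmorph_sum !mulr_suml.
congr (_ + _); apply: eq_bigr => k _.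
  rewrite -[RHS]/(a k * mon R (expo b k - w0) z) -mulrA; congr (_ * _).
  by rewrite monD -mon_expo.
rewrite -[RHS]/(mon R (expo b (nth 0 s k) - w0) z * q k (par b z)) mulrAC monD; congr (_ * _).
by rewrite -mon_expo.
Qed.

End PlaceRelation.

(** * Faces cut out by weights positive on the generators *)

Section PositiveFaces.
Variables (R : realType) (r n : nat) (b : 'M[nat]_(r, n)).
Local Notation K := 'rV[nat]_r.
Implicit Types (k : K) (c : 'rV[R]_r) (v x : 'rV[R]_n).

Lemma pairing_mul c v : pairing (c *m to_real R b) v =
  \sum_i c 0 i * pairing (to_real R (row i b)) v.
Proof.
rewrite mulmx_sum_row pairing_sum; apply: eq_bigr => i _.
by rewrite pairingZl; congr (_ * pairing _ _); apply/rowP => j; rewrite !mxE.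
Qed.

Section PositiveRows.
Variable v : 'rV[R]_n.
Hypothesis vpos : forall i, 0 < pairing (to_real R (row i b)) v.

Lemma pairing_ge0 c : (forall i, 0 <= c 0 i) -> 0 <= pairing (c *m to_real R b) v.
Proof. by move=> c0; rewrite pairing_mul sumr_ge0 // => i _; rewrite mulr_ge0 // ltW. Qed.

Lemma pairing_eq0 c : (forall i, 0 <= c 0 i) -> pairing (c *m to_real R b) v = 0 -> c = 0.
Proof.
move=> c0; rewrite pairing_mul => /eqP; rewrite psumr_eq0 => [/allP h|i _]; last first.
  by rewrite mulr_ge0 // ltW.
apply/rowP => i; have := h i (mem_index_enum i); rewrite mulf_eq0 (gt_eqF (vpos i)) orbF => /eqP ->.
by rewrite mxE.
Qed.

Lemma positive_dual_cone : dual_cone b v.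
Proof. by move=> _ [c c0 <-]; rewrite pairingC; exact: pairing_ge0. Qed.

Lemma hyperplane_convex l : convex_set [set x : 'rV[R]_n | pairing x v = l].
Proof.
apply/convex_setP => t x y _ /= xl yl; rewrite pairingDl !pairingZl xl yl; ring.
Qed.

(** Since [v] is positive on the rows, any nonzero nonnegative combination of them raises the level;
    a point stays at level [l] only if nothing is added to a point of [F]. *)
Lemma newton_face (A : set 'rV[nat]_n) (F : set 'rV[R]_n) l :
  (forall x, F x -> pairing x v = l) ->
  (forall w, A w -> exists x k, [/\ to_real R w = x + to_real R (k *m b) & F x \/ l < pairing x v]) ->
  newton_polyhedron b A `<=` [set x | convex_hull F x \/ l < pairing x v].
Proof.
move=> Fl AF; have hl : convex_hull F `<=` [set x | pairing x v = l].
  by apply: convex_hull_sub => //; exact: hyperplane_convex.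
apply: newton_sub => [|w _ /AF[x [k [-> xF]]] [c c0 <-]].
  by apply: face_union_convex => //; exact: convex_hull_convex.
have d0 i : 0 <= (to_real R k + c) 0 i by rewrite !mxE addr_ge0 // c0.
rewrite -addrA to_real_mul -mulmxDl /=.
have [/(pairing_eq0 d0) ->|dn0] := eqVneq (pairing ((to_real R k + c) *m to_real R b) v) 0.
  by rewrite mul0mx addr0; case: xF => [/sub_convex_hull|]; [left|right].
right; rewrite pairingDl; have xl : l <= pairing x v by case: xF => [/Fl ->|/ltW].
have : 0 < pairing ((to_real R k + c) *m to_real R b) v by rewrite lt_neqAle eq_sym dn0 pairing_ge0.
by lra.
Qed.

End PositiveRows.

Lemma pairing_ratr (w : 'rV[nat]_n) (v : 'rV[rat]_n) :
  pairing (to_real R w) (map_mx ratr v) = ratr (qpair (map_mx Posz w) v).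
Proof.
rewrite pairingE rmorph_sum; apply: eq_bigr => j _.
by rewrite !mxE rmorphM /= ratr_int.
Qed.

End PositiveFaces.

Section Forward.
Variables (R : realType) (r n : nat) (b : 'M[nat]_(r, n)).
Hypothesis b_neq0 : forall i, row i b != 0.
Local Notation C := R[i].
Local Notation Cr := 'rV[R[i]]_r.
Local Notation K := 'rV[nat]_r.
Local Opaque germ_eq has_taylor taylor.

Lemma expo_delta i : expo b (delta_mx 0 i) = map_mx Posz (row i b).
Proof. by rewrite /expo rowE. Qed.

Lemma monomial0_delta i : monomial (0 : Cr) (delta_mx 0 i) = 0.
Proof. by rewrite /monomial (bigD1 i) //= !mxE !eqxx expr1 mul0r. Qed.

(** Monomials of residue zero, the generators among them, become strict inequalities; nonzero
    residues become equations. *)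
Lemma place_weights (Psi : set (funring R n * C)) (s : seq K) (w0 : 'rV[int]_n) (chi : K -> C) :
  place (@cstfun R n) Psi ->
  (forall i, Psi (mon R (expo b (delta_mx 0 i)), 0)) ->
  (forall k, k \in s -> Psi (mon R (expo b k - w0), chi k)) ->
  exists v : 'rV[rat]_n, [/\ forall i, 0 < qpair (map_mx Posz (row i b)) v,
    forall k, k \in s -> chi k = 0 -> qpair w0 v < qpair (expo b k) v &
    forall k, k \in s -> chi k != 0 -> qpair (expo b k) v = qpair w0 v].
Proof.
move=> PsiP hrow hchi.
pose sP := [seq expo b (delta_mx 0 i) | i <- enum 'I_r] ++
           [seq expo b k - w0 | k <- s & chi k == 0].
pose sE := [seq expo b k - w0 | k <- s & chi k != 0].
have qB k v : qpair (expo b k) v = qpair (expo b k - w0) v + qpair w0 v.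
  by rewrite -qpairDl subrK.
have hP p : p \in sP -> Psi (mon R p, 0).
  rewrite mem_cat => /orP[/mapP[i _ ->] //|/mapP[k]].
  by rewrite mem_filter => /andP[/eqP k0 ks] ->; rewrite -k0; exact: hchi.
have hE e : e \in sE -> exists2 c, c != 0 & Psi (mon R e, c).
  move=> /mapP[k]; rewrite mem_filter => /andP[k0 ks] ->.
  by exists (chi k) => //; exact: hchi.
have [v [vP vE]] := place_separation PsiP hP hE; exists v; split=> [i|k ks k0|k ks k0].
- by rewrite -expo_delta vP // mem_cat; apply/orP; left; apply/mapP; exists i; rewrite ?mem_enum.
- rewrite [ltRHS]qB ltrDr vP // mem_cat; apply/orP; right.
  by apply/mapP; exists k => //; rewrite mem_filter k0 eqxx.
- by rewrite qB vE ?add0r //; apply/mapP; exists k => //; rewrite mem_filter k0.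
Qed.

(** Up to the factor [z^w0], the value of [L] is the residue relation, as [z] takes [x^k / x^w0] to
    [chi k] on the face. Several [k] of [s] may lie over one point of the support, hence the
    regrouping by fibres. *)
Lemma Lmap_vanishes (a : K -> C) (s : seq K) (D : set 'rV[R]_n) (z : 'rV[C]_n) (w0 : 'rV[int]_n) chi :
  uniq s -> torus z ->
  (forall k, k \in s -> D (to_real R (k *m b)) <-> chi k != 0) ->
  (forall k, a k != 0 -> D (to_real R (k *m b)) -> k \in s) ->
  (forall k, k \in s -> chi k != 0 -> mon R (expo b k - w0) z = chi k) ->
  \sum_(k <- s) a k * chi k = 0 ->
  Lmap b (restrict_series b D a) z = 0.
Proof.
move=> us zT sD aD chiE sum0.
pose G : {fset 'rV[nat]_n} := [fset w in [seq k *m b | k <- s & chi k != 0]]%fset.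
have GP w : reflect (exists2 k, k \in s & chi k != 0 /\ w = k *m b) (w \in G).
  rewrite inE; apply: (iffP mapP) => -[k]; rewrite ?mem_filter.
    by move=> /andP[? ?] ->; exists k.
  by move=> ks [k0 ->]; exists k => //; rewrite mem_filter k0.
have GD w : w \in G -> D (to_real R w) by move=> /GP[k ks [k0 ->]]; exact/sD.
pose h k := a k * monomial (par b z) k.
have hG : \sum_(w \in [set w | supp b a w /\ D (to_real R w)]) coefS b a w * monomial z w =
    \sum_(w <- G) fsum (fun k => k *m b) h w.
  rewrite (fsbig_widen _ [set` G]) => [||w [/= /GD Dw nw]].
  - by rewrite fsbig_finite //= set_fsetK; apply: eq_bigr => w _; rewrite -coefS_par.
  - move=> w [/= /coefS_neq0[k kw ak] Dw]; rewrite -kw in Dw.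
    by apply/GP; exists k; [exact: aD|split=> //; apply/sD => //; exact: aD].
  - suff -> : coefS b a w = 0 by rewrite mul0r.
    by apply/eqP; apply: contrapT => /negP ?; apply: nw; split.
rewrite LmapE hG (sum_fsum (finite_toric_fibres b_neq0)) (bigID (mem s)) /= [X in _ + X]big1_seq ?addr0; last first.
  move=> k /andP[ks]; rewrite mem_fibres; last exact: finite_toric_fibres.
  move=> /GD Dk; suff ak : a k = 0 by rewrite /h ak mul0r.
  by apply/eqP; apply: contrapT => /negP ak; move: ks; rewrite aD.
rewrite -big_filter (perm_big [seq k <- s | chi k != 0]) /=; last first.
  apply: uniq_perm; rewrite ?filter_uniq //; first exact: fset_uniq.
  move=> k; rewrite !mem_filter mem_fibres; last exact: finite_toric_fibres.
  have [ks|] := boolP (k \in s); rewrite ?andbF // andbT; apply/idP/idP.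
    by move=> /GD/sD -> .
  by move=> k0; apply/GP; exists k.
rewrite big_filter; transitivity (mon R w0 z * \sum_(k <- s) a k * chi k); last first.
  by rewrite sum0 mulr0.
rewrite mulr_sumr [RHS](bigID (fun k => chi k != 0)) /= [X in _ + X]big1 ?addr0; last first.
  by move=> k /negbNE/eqP ->; rewrite !mulr0.
rewrite big_seq_cond [RHS]big_seq_cond; apply: eq_bigr => k /andP[ks k0].
rewrite /h -mon_expo // mulrCA; congr (_ * _); rewrite -(chiE k ks k0).
by rewrite -[RHS]/((mon R w0 * mon R (expo b k - w0)) z) -monD addrC subrK.
Qed.

End Forward.

(** * From non-degeneracy to the equality of polyhedra *)

Section Nondegenerate.
Variables (R : realType) (r n : nat) (b : 'M[nat]_(r, n)).
Hypothesis b_neq0 : forall i, row i b != 0.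
Local Notation C := R[i].
Local Notation Cr := 'rV[R[i]]_r.
Local Notation K := 'rV[nat]_r.
Local Opaque germ_eq has_taylor taylor.

Lemma newton_hull_of_nondegenerate (m : nat) (g : 'I_m -> Cr -> C) :
  (forall i, analytic0 (g i)) -> nondegenerate_system b g ->
  newton_of b (ideal_gen b (range g)) `<=`
  monomial_hull b (integral_closure b (ideal_gen b (range g))).
Proof.
move=> ga nd; set I := ideal_gen b (range g).
have gaI : range g `<=` @analytic0 R r by move=> _ [i _ <-].
have II : is_ideal b I := ideal_gen_ideal b gaI.
have Ig i : I (g i) by apply: sub_ideal_gen; exists i.
apply: newton_monomial_hull => k k' Ik; apply: contrapT => nint.
(* Minimal exponents are taken among the [k] rather than among the points [k *m b], so that
   divisibility is coordinatewise. *)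
have [s0 [s0I s0P]] := dickson [set k : K | supp_set b I (k *m b)].
pose s := undup s0; have us : uniq s := undup_uniq s0.
have sI l : l \in s -> supp_set b I (l *m b) by rewrite mem_undup; exact: s0I.
have sP l : supp_set b I (l *m b) -> exists2 l', l' \in s & lek l' l.
  by move=> /s0P[l' l's ll]; exists l' => //; rewrite mem_undup.
have [k1 k1s k1k] := sP k Ik.
have k1k0 : lek k1 (k + k') by rewrite -(subkK k1k) -addrA lek_addr.
have sn0 : [seq expo b k | k <- s] != [::] by case: (s) k1s.
have [Psi [w0 [PsiP PsiI w0s hw0]]] := place_minimum (rees_is_place b_neq0 II nint) sn0.
have [kw kws w0E] := mapP w0s.
have /choice[chi hchi] l : exists c, l \in s -> Psi (mon R (expo b l - w0), c).
  have [ls|nl] := boolP (l \in s); last by exists 0.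
  by have [c hc] := hw0 _ (map_f _ ls); exists c.
have hrow i : Psi (mon R (expo b (delta_mx 0 i)), 0).
  by have := place_expo II PsiP PsiI (delta_mx 0 i); rewrite monomial0_delta.
have [v [vrow vpos vzero]] := place_weights PsiP hrow hchi.
pose vR : 'rV[R]_n := map_mx ratr v; pose l := pairing (to_real R (kw *m b)) vR.
have lE : l = ratr (qpair w0 v) by rewrite /l pairing_ratr w0E.
have rowpos i : 0 < pairing (to_real R (row i b)) vR by rewrite pairing_ratr ltr0q.
have sval t : t \in s -> if chi t == 0 then is_true (l < pairing (to_real R (t *m b)) vR)
    else pairing (to_real R (t *m b)) vR = l.
  move=> ts; case: eqP => [/(vpos t ts)|/eqP/(vzero t ts) e]; first by rewrite lE pairing_ratr ltr_rat.
  by rewrite lE pairing_ratr e.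
pose F := [seq to_real R (t *m b) | t <- s & chi t != 0].
have FP x : x \in F -> exists2 t, t \in s & chi t != 0 /\ x = to_real R (t *m b).
  by move=> /mapP[t]; rewrite mem_filter => /andP[? ?] ->; exists t.
have Fl x : x \in F -> pairing x vR = l.
  by move=> /FP[t ts [t0 ->]]; have := sval t ts; rewrite (negbTE t0).
have FI t : t \in s -> chi t != 0 -> to_real R (t *m b) \in F.
  by move=> ts t0; apply/mapP; exists t => //; rewrite mem_filter t0.
(* An exponent over the support is a minimal one plus a rest, and the minimal one lies either on the
   face or strictly above it. *)
have NF : newton_of b I `<=` [set x | convex_hull [set` F] x \/ l < pairing x vR].
  apply: newton_face => // w wI.
  have [t tw] : exists t : K, t *m b = w.
    by case: wI => f _ fw; exact: (supp_semigroup fw).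
  rewrite -tw in wI *; have [t' t's t't] := sP t wI.
  exists (to_real R (t' *m b)), (subk t t'); rewrite -to_realD -mulmxDl subkK //; split=> //.
  by have := sval _ t's; case: eqP => [_|/eqP ? _]; [right|left; exact: FI].
have FN : convex_hull [set` F] `<=` [set x | newton_of b I x /\ pairing x vR = l].
  move=> x Fx; split; last first.
    exact: (convex_hull_sub (A := [set` F]) (@hyperplane_convex R n vR l) Fl Fx).
  have FS y : y \in F -> newton_of b I y.
    by move=> /FP[t ts [_ ->]]; apply: newton_mem; exact: sI.
  exact: (convex_hull_sub (A := [set` F]) (@newton_convex R r n b _) FS Fx).
pose D := convex_hull [set` F].
have DE : D = [set x | newton_of b (range g) x /\ pairing x vR = l].
  rewrite -newton_ideal_gen //; apply/seteqP; split=> [x|x [/NF[//|lx] xl]]; first exact: FN.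
  by move: lx; rewrite xl ltxx.
have Df : is_face b (newton_of b (range g)) D.
  exists vR, l; rewrite -newton_ideal_gen //; split.
  - exact: positive_dual_cone.
  - by exists (to_real R (kw *m b)) => //; apply: newton_mem; exact: sI.
  - by move=> x /NF[/FN[_ <-]//|/ltW].
  - by rewrite DE newton_ideal_gen.
have [z [zT hz]] := character_point (unit_ratio_character PsiP).
apply: (nd D Df); first exact: compact_hull.
exists z; split=> // i.
(* The Taylor series of [g i] may have exponents that cancel on [X(S)]; those of the reduced series
   are all above some element of [s]. *)
have [f' f'a gf'] := has_taylor_reduce b_neq0 (taylorP (ga i)).
set a := reduce b _ in f'a.
have LE : Lmap b (restrict_series b D (taylor (g i))) z = Lmap b (restrict_series b D a) z.
  by rewrite !LmapE /supp coefS_reduce.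
have aI t : a t != 0 -> supp_set b I (t *m b) by move=> /reduce_neq0 h; exists (g i).
have sD t : t \in s -> D (to_real R (t *m b)) <-> chi t != 0.
  move=> ts; split=> [/FN[_ tl]|t0]; last by apply: sub_convex_hull; exact: FI.
  by have := sval t ts; case: eqP => //; rewrite tl ltxx.
rewrite LE; apply: (Lmap_vanishes b_neq0 us (w0 := w0) (chi := chi)) => //.
(* An exponent on the face is a minimal one plus a rest pairing to 0 with [vR]; positivity on the
   rows makes the rest vanish. *)
- move=> t /aI/sP[t' t's t't] /FN[_]; rewrite -{1}(subkK t't) mulmxDl to_realD pairingDl => tl.
  have t'l : l <= pairing (to_real R (t' *m b)) vR by have := sval t' t's; case: eqP => [_ /ltW|_ ->].
  have d0 j : 0 <= (to_real R (subk t t')) 0 j by rewrite mxE.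
  have := pairing_ge0 rowpos d0; rewrite -to_real_mul => p0.
  have : pairing (to_real R (subk t t' *m b)) vR = 0 by lra.
  rewrite to_real_mul => /(pairing_eq0 rowpos d0) e.
  rewrite -(subkK t't) (_ : subk t t' = 0) ?addr0 //; apply/rowP => j; apply/eqP.
  by have /rowP/(_ j) := e; rewrite !mxE => /eqP; rewrite pnatr_eq0.
- move=> t ts t0; rewrite mon_torusE //; apply: hz.
  by apply: unit_ratio_mon => //; exact: hchi.
- apply: (place_relation b_neq0 II PsiP PsiI us hchi _ (Ig i) gf' f'a) => [|t /aI/sP //].
  by exists k1.
Qed.

End Nondegenerate.

Theorem theorem4p7 (R : realType) (r n : nat) (b : 'M[nat]_(r, n))
    (b_neq0 : forall i, row i b != 0)
    (b_lattice : generates_lattice b)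
    (b_dim : cone_dim R b = n)
    (b_convex : strongly_convex (cone R b))
    (I : set ('rV[R[i]]_r -> R[i])) (I_ideal : is_ideal b I) :
  nondegenerate_ideal b I <->
  newton_of b I = monomial_hull b (integral_closure b I).
Proof.
split=> [[m [g [ga IE nd]]]|]; last exact: nondegenerate_of_newton_eq.
apply/seteqP; split; last exact: monomial_hull_newton.
by rewrite IE; exact: newton_hull_of_nondegenerate.
Qed.
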